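(* Let $d\geq 2$ be an integer, let $p_d(z)=z(z^d-1)$, and let $H_d$ be Halley's map applied to $p_d$. Let $\alpha_k=\exp(2k\pi i/d)$, $k=0,\ldots,d-1$, be the $d$th roots of unity. Denote by $A^{\star}_{H_d}(0)$ and $A^{\star}_{H_d}(\alpha_k)$ the immediate basins of attraction under $H_d$ of the fixed points $0$ and $\alpha_k$. Then the following statements hold. (a) The sets $A^{\star}_{H_d}(\alpha_k)$, $k=0,\ldots,d-1$, as well as $A^{\star}_{H_d}(0)$, are simply connected. (b) The sets $A^{\star}_{H_d}(\alpha_k)$, $k=0,\ldots,d-1$, are unbounded. (c) For $d=2,3,4$ the set $A^{\star}_{H_d}(0)$ is unbounded. (d) For $d\geq 5$ the set $A^{\star}_{H_d}(0)$ is bounded.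
   Context: For a polynomial $p$ in one complex variable, Halley's map is the rational map $H_p:\hat{\mathbb C}\to\hat{\mathbb C}$ on the Riemann sphere $\hat{\mathbb C}=\mathbb C\cup\{\infty\}$ given by $$H_p(z)=z-\frac{p(z)p'(z)}{(p'(z))^2-\frac12 p(z)p''(z)},$$ and $H_d:=H_{p_d}$. Every root of $p_d$ is a (super)attracting fixed point of $H_d$. For an attracting fixed point $\alpha\in\mathbb C$ of a rational map $F$, the basin of attraction is $A_F(\alpha)=\{z\in\mathbb C : F^n(z)\to\alpha \text{ as } n\to\infty\}$, and the immediate basin $A^{\star}_F(\alpha)$ is the connected component of $A_F(\alpha)$ containing $\alpha$. Boundedness is understood for subsets of $\mathbb C$. *)

(* Defs.v *)
From HB Require Import structures.
From mathcomp Require Import all_boot all_order all_algebra.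
From mathcomp Require Export complex.
From mathcomp Require Export all_classical all_reals all_analysis.
Export numFieldNormedType.Exports.

Set Implicit Arguments.
Unset Strict Implicit.
Unset Printing Implicit Defensive.
Import Order.TTheory GRing.Theory Num.Theory.

Local Open Scope classical_set_scope.
Local Open Scope ring_scope.
Local Open Scope complex_scope.

(* R[i] carries its Euclidean topology through the regular-module alias ^o. *)
Notation Cplane R := ((R[i])^o).

(* [Some z] is the finite point z, [None] is the point at infinity. *)
Definition sphere (R : realType) : topologicalType :=
  one_point_compactification (Cplane R).

(* The self-map of the sphere defined by the rational function n / m, m != 0.
   Common factors are cancelled first, so that the numerator and denominator
   never vanish together; the value at infinity is the limit of n / m there
   (recall size = degree + 1, and that m`_i = 0 for i >= size m). *)
Definition rational_map (R : realType) (n m : {poly R[i]}) :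
    sphere R -> sphere R :=
  let n' := n %/ gcdp n m in
  let m' := m %/ gcdp n m in
  fun w => match w with
  | Some z => if m'.[z] == 0 then None else Some (n'.[z] / m'.[z])
  | None => if (size m' < size n')%N then None
            else Some (n'`_(size m').-1 / lead_coef m')
  end.

(* With D = p'^2 - (1/2) p p'', the map is z - p p' / D = (z D - p p') / D.
   For nonconstant p, D != 0: if n = deg p, then D has the nonzero coefficient
   n (n + 1) / 2 * (lead_coef p)^2 in degree 2 n - 2. *)
Definition halley (R : realType) (p : {poly R[i]}) : sphere R -> sphere R :=
  let D := p^`() ^+ 2 - 2^-1 *: (p * p^`(2)) in
  rational_map ('X * D - p * p^`()) D.

Definition pd (R : realType) (d : nat) : {poly R[i]} := 'X * ('X^d - 1).

Definition Hd (R : realType) (d : nat) : sphere R -> sphere R :=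
  halley (pd R d).
Arguments Hd R d _ : clear implicits.

Definition cexp (R : realType) (z : R[i]) : R[i] :=
  (expR (complex.Re z))%:C * (cos (complex.Im z) +i* sin (complex.Im z)).

Definition alpha (R : realType) (d k : nat) : R[i] :=
  cexp (2 * k%:R * (pi : R)%:C * 'i / d%:R).

Definition basin (R : realType) (F : sphere R -> sphere R) (a : R[i]) :
    set (Cplane R) :=
  [set z : Cplane R |
    (fun n => iter n F (Some z : sphere R)) @ \oo --> (Some a : sphere R)].

Definition immediate_basin (R : realType) (F : sphere R -> sphere R)
    (a : R[i]) : set (Cplane R) :=
  connected_component (basin F a) a.

Definition path_connected (R : realType) (T : topologicalType) (A : set T) :=
  A !=set0 /\
  forall x y, A x -> A y ->
    exists g : R -> T,
      [/\ {within `[0, 1]%classic, continuous g},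
          g @` `[0, 1]%classic `<=` A, g 0 = x & g 1 = y].

(* [h (s, t)] is a homotopy, relative to the endpoints and inside A, from the
   loop [g] (at s = 0) to the constant loop (at s = 1). *)
Definition null_homotopic (R : realType) (T : topologicalType) (A : set T)
    (g : R -> T) :=
  exists h : R * R -> T,
    [/\ {within `[0, 1]%classic `*` `[0, 1]%classic, continuous h},
        h @` (`[0, 1]%classic `*` `[0, 1]%classic) `<=` A,
        {in `[0, 1], forall t, h (0, t) = g t},
        {in `[0, 1], forall t, h (1, t) = g 0} &
        {in `[0, 1], forall s, h (s, 0) = g 0 /\ h (s, 1) = g 0}].

Definition simply_connected (R : realType) (T : topologicalType) (A : set T) :=
  path_connected R A /\
  forall g : R -> T,
    {within `[0, 1]%classic, continuous g} ->
    g @` `[0, 1]%classic `<=` A -> g 0 = g 1 ->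
    null_homotopic A g.

(* Main.v *)
Require Import Defs.
From mathcomp Require Import all_boot all_order all_algebra.
From mathcomp Require Import ring lra zify.
From mathcomp Require Import all_classical all_reals all_analysis.
Set Implicit Arguments.
Unset Strict Implicit.
Unset Printing Implicit Defensive.
Import Order.TTheory GRing.Theory Num.Theory.
Local Open Scope classical_set_scope.
Local Open Scope ring_scope.
Local Open Scope complex_scope.

(* With [u = z^d], Halley's map is
     H(z) = d z u ((d+1) u + d - 1) / ((d+1)(d+2) u^2 + (d+1)(d-4) u + 2);
   it commutes with the rotations of order [d] and the conjugations that permute
   the roots of unity.

   An open connected set [U] of the plane is simply connected as soon as it is
   full, that is, contains every bounded open set whose boundary it contains:
   replace a loop by a path in a fine square lattice, sweep off one by one the
   squares that it encloses, which lie in [U], and contract what remains by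
   backtracking.  By the open mapping theorem, an immediate basin [A] is full
   when no bounded open [V] with boundary in [A] contains a pole: the images
   of [V] are then controlled by those of its boundary, so [V] is attracted.

   - The immediate basin of a root of unity misses the rays [u <= 0], as each of
     them lies on the axis of a reflection moving the root or opposite to it.
     These rays lead to infinity, so [V] misses them as well; in particular [H]
     has no zero in [V].  If [V] had a pole, [1 / H] would vanish there, hence
     take a value on one of those rays on the boundary of [V], which is absurd.
   - If [d <= 4], the rays [u <= 0] are in the immediate basin of [0].  A pole in
     [V] lies in the sector of some root of unity [a].  In that sector [H = a]
     only at [a], which is not in [V], so [1 / (H - a)] is finite on the closure
     of the part of [V] in the sector.  It vanishes at the pole, and therefore
     maps some boundary point to the ray of [1 / a]; then [H] maps that point,
     which is attracted by [0], to the ray from [a] outwards, attracted by [a].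
   - If [d >= 5], let [B] be the disc [|u| < 1 / (d+1)] cut along the negative
     real axis of [u] from the first pole on.  [H] sends no point of the boundary
     of [B] into [B], so the immediate basin of [0] is contained in [B], which is
     bounded, has no poles, and whose complement is a union of rays.

   The rays from the roots of unity outwards and, for [d <= 4], the rays [u <= 0]
   give the unboundedness statements. *)

(** * The complex plane *)

(** Fullness is chosen because [H] transports it with the open mapping theorem alone: the boundary
    of an image is covered by the image of the boundary. By compactness the boundary of [V] enters a
    small disc about the root within a bounded number of steps, and this bound passes to all of [V]
    one step at a time. Poles are the only obstruction: infinity is fixed, so an orbit through a
    pole never returns. Winding numbers enter only modulo 2 and only for lattice loops, where they
    are finite counts of edges. The circle |u| = 1/(d+1) carries the zeros of p', which [H] fixes,
    and the estimate |H(z)| >= |z| on it amounts to d^2 - 4d - 4 >= 0; this is what separates d >= 5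
    from d <= 4. Halley's method has order three: H - a has a triple zero at a root of unity a. This
    shapes the estimate on the ray from 1 outwards, and for d <= 4 it leaves cofactors of degree 2,
    4 and 6, whose zeros have to be kept out of one sector. *)

Section Modulus.
Context {R : realType}.
Implicit Types z w : R[i].

(** The norm of [R[i]] takes its values in [R[i]]; the estimates need a modulus in the ordered field
    [R]. *)
Definition cmod z : R := complex.Re `|z|.

Lemma cmodE z : (cmod z)%:C = `|z|.
Proof. by rewrite /cmod normc_def. Qed.

Lemma sqr_cmod z : cmod z ^+ 2 = complex.Re z ^+ 2 + complex.Im z ^+ 2.
Proof. by rewrite /cmod normc_def /= sqr_sqrtr // addr_ge0 ?sqr_ge0. Qed.

Lemma cmod_ge0 z : 0 <= cmod z.
Proof. by rewrite -(lecR 0) cmodE normr_ge0. Qed.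

Lemma cmod_eq0 z : (cmod z == 0) = (z == 0).
Proof. by rewrite -[RHS]normr_eq0 -cmodE; apply/eqP/eqP => [->|[]]. Qed.

Lemma cmod_gt0 z : (0 < cmod z) = (z != 0).
Proof. by rewrite lt_def cmod_ge0 andbT cmod_eq0. Qed.

Lemma cmod0 : cmod 0 = 0. Proof. by rewrite /cmod normr0. Qed.

Lemma cmod1 : cmod 1 = 1. Proof. by rewrite /cmod normr1. Qed.

Lemma cmodM z w : cmod (z * w) = cmod z * cmod w.
Proof.
suff: (cmod (z * w))%:C = (cmod z * cmod w)%:C by case.
by rewrite rmorphM /= !cmodE normrM.
Qed.

Lemma cmodX z n : cmod (z ^+ n) = cmod z ^+ n.
Proof. by elim: n => [|n IH]; rewrite ?expr0 ?cmod1 // !exprS cmodM IH. Qed.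

Lemma cmodV z : cmod z^-1 = (cmod z)^-1.
Proof.
have [->|z0] := eqVneq z 0; first by rewrite invr0 cmod0 invr0.
have c0 : cmod z != 0 by rewrite cmod_eq0.
by apply: (mulfI c0); rewrite -cmodM !divff // cmod1.
Qed.

Lemma cmodN z : cmod (- z) = cmod z.
Proof. by rewrite /cmod normrN. Qed.

Lemma cmodB z w : cmod (z - w) = cmod (w - z).
Proof. by rewrite -cmodN opprB. Qed.

Lemma ler_cmodD z w : cmod (z + w) <= cmod z + cmod w.
Proof. by rewrite -lecR rmorphD /= !cmodE ler_normD. Qed.

Lemma ler_cmodBD v z w : cmod (z - w) <= cmod (z - v) + cmod (v - w).
Proof. by rewrite -[z - w](subrKA v) ler_cmodD. Qed.

Lemma lerB_cmod z w : cmod z - cmod w <= cmod (z - w).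
Proof. by rewrite lerBlDr -{1}[z](subrK w) ler_cmodD. Qed.

Lemma cmodR (x : R) : cmod x%:C = `|x|.
Proof.
apply: (@pexpIrn _ 2); rewrite ?nnegrE ?cmod_ge0 ?normr_ge0 //.
by rewrite sqr_cmod /= expr0n addr0 real_normK ?num_real.
Qed.

Lemma ler_Re z : `|complex.Re z| <= cmod z.
Proof.
rewrite -(@ler_pXn2r _ 2) ?nnegrE ?cmod_ge0 ?normr_ge0 //.
by rewrite sqr_cmod real_normK ?num_real // lerDl sqr_ge0.
Qed.

Lemma ler_Im z : `|complex.Im z| <= cmod z.
Proof.
rewrite -(@ler_pXn2r _ 2) ?nnegrE ?cmod_ge0 ?normr_ge0 //.
by rewrite sqr_cmod real_normK ?num_real // lerDr sqr_ge0.
Qed.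

Lemma ler_cmod z : cmod z <= `|complex.Re z| + `|complex.Im z|.
Proof.
have {1}-> : z = (complex.Re z)%:C + (complex.Im z)%:C * 'i.
  by case: z => a b; simpc; rewrite /=.
rewrite (le_trans (ler_cmodD _ _)) // cmodM !cmodR lerD2l.
by rewrite /cmod normc_def /= expr0n expr1n add0r sqrtr1 mulr1.
Qed.

Lemma cmodJ z : cmod z^* = cmod z.
Proof. by rewrite /cmod normcJ. Qed.

Lemma real_complexP z : complex.Im z = 0 -> z = (complex.Re z)%:C.
Proof. by case: z => a b /= ->. Qed.

Lemma mulc_conj z : z * z^* = ((cmod z) ^+ 2)%:C.
Proof. by rewrite sqr_cmod; case: z => a b; simpc; congr (_ +i* _); ring. Qed.

End Modulus.

Section PlaneTopology.
Context {R : realType}.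
Local Notation C := (Cplane R).
Implicit Types (A B K V : set C).

Lemma nbhs_cmodP (z : C) A :
  nbhs z A <-> exists2 e : R, 0 < e & forall w : C, cmod (w - z) < e -> A w.
Proof.
split; last move=> [e e0 zA]; last apply/nbhs_ballP.
  move=> /nbhs_ballP[e /= e0 zA].
  have ee : e = (complex.Re e)%:C.
    by apply: real_complexP; case: e e0 {zA} => a b; rewrite ltcE /= => /andP[/eqP].
  exists (complex.Re e); first by rewrite -(ltcR 0) -ee.
  move=> w; rewrite -ltcR -ee cmodE => wz; apply: zA.
  by rewrite -ball_normE /ball_ /= distrC.
exists e%:C; first by rewrite /= (ltcR 0).
by move=> w; rewrite -ball_normE /ball_ /= distrC -cmodE ltcR; exact: zA.
Qed.

Lemma open_cmodP A : open A <->
  forall z : C, A z -> exists2 e : R, 0 < e & forall w : C, cmod (w - z) < e -> A w.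
Proof.
rewrite openE; split=> [oA z /oA/nbhs_cmodP //|oA z /oA ?].
exact/nbhs_cmodP.
Qed.

Lemma closure_cmodP A (z : C) : closure A z <->
  forall e : R, 0 < e -> exists2 w : C, A w & cmod (w - z) < e.
Proof.
split=> [cA e e0|cA B /nbhs_cmodP[e e0 eB]].
  have [|w [Aw we]] := cA [set w : C | cmod (w - z) < e].
    by apply/nbhs_cmodP; exists e.
  by exists w.
by have [w Aw /eB Bw] := cA e e0; exists w.
Qed.

Lemma open_ball_cmod (z : C) (e : R) : open [set w : C | cmod (w - z) < e].
Proof.
apply/open_cmodP => w /= we; exists (e - cmod (w - z)); first by rewrite subr_gt0.
by move=> v /=; rewrite ltrBrDr => /(le_lt_trans (ler_cmodBD w _ _)).
Qed.

Lemma continuous_cmodP (T : topologicalType) (f : T -> C) (x : T) :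
  {for x, continuous f} <->
  forall e : R, 0 < e -> \forall y \near x, cmod (f y - f x) < e.
Proof.
split=> [cf e e0|cf A /nbhs_cmodP[e e0 eA]].
  by apply: (cf [set w | cmod (w - f x) < e]); apply/nbhs_cmodP; exists e.
by have := cf e e0; apply: filterS => y /eA.
Qed.

Lemma continuous_complex (T : topologicalType) (f g : T -> R) (x : T) :
  {for x, continuous f} -> {for x, continuous g} ->
  {for x, continuous (fun t => (f t +i* g t : C))}.
Proof.
move=> cf cg; apply/continuous_cmodP => e e0.
have e2 : 0 < e / 2 by rewrite divr_gt0.
move/cvgrPdist_lt/(_ _ e2) : cf => cf; move/cvgrPdist_lt/(_ _ e2) : cg => cg.
near=> y; rewrite (le_lt_trans (ler_cmod _)) // (splitr e) /=.
by rewrite ltrD // distrC; near: y.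
Unshelve. all: by end_near. Qed.

Lemma continuous_real_distP (T : topologicalType) (f : T -> R) (x : T) :
  {for x, continuous f} <->
  forall e : R, 0 < e -> \forall y \near x, `|f x - f y| < e.
Proof. exact: cvgrPdist_lt. Qed.

Lemma Re_continuous : continuous (fun z : C => complex.Re z).
Proof.
move=> z; apply/continuous_real_distP => e e0.
apply/nbhs_cmodP; exists e => // w /(le_lt_trans _); apply.
by rewrite cmodB (le_trans _ (ler_Re _)) //; case: (z) (w) => ? ? [].
Qed.

Lemma Im_continuous : continuous (fun z : C => complex.Im z).
Proof.
move=> z; apply/continuous_real_distP => e e0.
apply/nbhs_cmodP; exists e => // w /(le_lt_trans _); apply.
by rewrite cmodB (le_trans _ (ler_Im _)) //; case: (z) (w) => ? ? [].
Qed.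

Lemma cmod_continuous : continuous (fun z : C => cmod z).
Proof.
move=> z; apply/continuous_real_distP => e e0.
apply/nbhs_cmodP; exists e => // w /(le_lt_trans _); apply.
rewrite ler_norml lerNl opprB {2}cmodB.
by apply/andP; split; exact: lerB_cmod.
Qed.

Lemma continuousDC (T : topologicalType) (f g : T -> C) (x : T) :
  {for x, continuous f} -> {for x, continuous g} ->
  {for x, continuous (fun t => f t + g t : C)}.
Proof. exact: continuousD. Qed.

Lemma continuousMC (T : topologicalType) (f g : T -> C) (x : T) :
  {for x, continuous f} -> {for x, continuous g} ->
  {for x, continuous (fun t => f t * g t : C)}.
Proof. exact: (@continuousM R[i] T f g x). Qed.

Lemma continuousVC (T : topologicalType) (f : T -> C) (x : T) :
  f x != 0 -> {for x, continuous f} ->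
  {for x, continuous (fun t => (f t)^-1 : C)}.
Proof. by move=> fx; exact: (@continuousV R[i] T f x fx). Qed.

Lemma horner_continuous (p : {poly R[i]}) : continuous (fun z : C => p.[z] : C).
Proof.
elim/poly_ind: p => [|p c IH] z.
  rewrite (_ : (fun z : C => _) = cst (0 : C)); first exact: cst_continuous.
  by apply/funext => w; rewrite horner0.
rewrite (_ : (fun z : C => _) = fun z : C => p.[z] * z + c); last first.
  by apply/funext => w; rewrite hornerMXaddC.
apply: (@continuousDC C (fun w => p.[w] * w) (cst c)).
  by apply: (@continuousMC C (horner p) id); [exact: IH|exact: (fun A h => h)].
exact: cst_continuous.
Qed.

Lemma bounded_closed_compact_plane A (M : R) :
  (forall z : C, A z -> cmod z <= M) -> closed A -> compact A.
Proof.
move=> AM cA.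
pose f := fun p : R * R => (p.1 +i* p.2 : C).
have cf : continuous f.
  by move=> p; apply: continuous_complex; [exact: cvg_fst|exact: cvg_snd].
have : compact (f @` (`[-M, M] `*` `[-M, M])).
  apply: continuous_compact; first exact: continuous_subspaceT.
  by apply: compact_setX; exact: segment_compact.
move=> /(subclosed_compact cA); apply => z Az; exists (complex.Re z, complex.Im z).
  split; rewrite /= in_itv /= -ler_norml (le_trans _ (AM _ Az)) //.
    exact: ler_Re.
  exact: ler_Im.
by case: z {Az}.
Qed.

Lemma hausdorff_plane : hausdorff_space C.
Proof. exact: norm_hausdorff. Qed.

Lemma compact_closed_plane K : compact K -> closed K.
Proof. exact: compact_closed hausdorff_plane. Qed.

Lemma compact_bounded_plane K : compact K ->
  exists M : R, forall z : C, K z -> cmod z <= M.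
Proof.
move=> cK; have [->|/set0P K0] := eqVneq K set0; first by exists 0.
have [c _ cM] := compact_EVT_max K0 cK
  (continuous_subspaceT cmod_continuous).
by exists (cmod c) => z Kz; apply: cM; rewrite inE.
Qed.

(** [A] avoids the boundary of [O], so [O] and the complement of its closure would separate [A]. The
    arguments in which a ray or a component cannot cross a boundary take this form. *)
Lemma connected_sub_open (T : topologicalType) (A O : set T) :
  connected A -> open O -> (forall x, A x -> closure O x -> O x) ->
  A `&` O !=set0 -> A `<=` O.
Proof.
move=> cA oO AO [x [Ax Ox]].
have := @connected_subset _ O (~` closure O) A.
case=> //.
- split; first by rewrite setICr.
  apply/seteqP; split => // y [Oy /(_ O)[|z [cz Oz]]].
    exact: open_nbhs_nbhs.
  by apply: cz; exact: subset_closure.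
- by move=> y Ay; have [/(AO _ Ay)|] := pselect (closure O y); [left|right].
- by move=> /(_ x Ax) /=; case; exact: subset_closure.
Qed.

Lemma segment_sub (z w : C) A : (forall t : R, 0 <= t <= 1 ->
    A (z + t%:C * (w - z))) ->
  exists B, [/\ connected B, B `<=` A, B z & B w].
Proof.
move=> zwA; exists ((fun t : R => (z + t%:C * (w - z) : C)) @` `[0, 1]).
split.
- apply: connected_continuous_connected; first exact: segment_connected.
  apply: continuous_subspaceT => t; apply: cvgD; first exact: cvg_cst.
  apply: cvgM; last exact: cvg_cst.
  by apply: continuous_complex; [exact: cvg_id|exact: cvg_cst].
- by move=> _ [t t01 <-]; apply: zwA; rewrite /= in_itv /= in t01.
- by exists 0; [rewrite /= in_itv /= lexx ler01|rewrite mul0r addr0].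
- by exists 1; [rewrite /= in_itv /= lexx ler01|rewrite mul1r addrC subrK].
Qed.

End PlaneTopology.

(** * Homotopies of polygonal loops *)

Section PiecewiseLinear.
Context {R : realType}.
Local Notation C := (Cplane R).

(** Precomposition with this retraction onto [0, 1] turns paths given on the interval into
    continuous functions on all of [R]. *)
Definition clip (x : R) : R := Num.min 1 (Num.max 0 x).

Lemma clip_le0 (x : R) : x <= 0 -> clip x = 0.
Proof. by move=> x0; rewrite /clip (max_idPl x0) min_r. Qed.

Lemma clip_ge1 (x : R) : 1 <= x -> clip x = 1.
Proof. by move=> x1; rewrite /clip (max_idPr _) ?(le_trans ler01)// min_l. Qed.

Lemma clip_id (x : R) : 0 <= x <= 1 -> clip x = x.
Proof. by case/andP=> x0 x1; rewrite /clip (max_idPr _)// min_r. Qed.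

Lemma clip_itv (x : R) : 0 <= clip x <= 1.
Proof.
case: (lerP x 0) => [/clip_le0 ->|x0]; first by rewrite lexx ler01.
case: (lerP 1 x) => [/clip_ge1 ->|x1]; first by rewrite lexx ler01.
by rewrite clip_id ?(ltW x0) ?(ltW x1).
Qed.

Lemma clip_continuous : continuous clip.
Proof.
move=> x; apply: (@continuous_min _ R (cst 1) (fun x => Num.max 0 x)).
  exact: cst_continuous.
by apply: (@continuous_max _ R (cst 0) id); [exact: cst_continuous|exact: (fun A h => h)].
Qed.

(* Linear interpolation of [f 0, ..., f n] at the integers, constant outside. *)
Fixpoint interp (n : nat) (f : nat -> C) (s : R) : C :=
  if n is m.+1 then interp m f s + (clip (s - m%:R))%:C * (f m.+1 - f m)
  else f 0.

Lemma interp_ge n f s : n%:R <= s -> interp n f s = f n.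
Proof.
elim: n => //= n IH ns; rewrite IH; last by rewrite (le_trans _ ns) // ler_nat.
rewrite clip_ge1; last by rewrite lerBrDr addrC natr1.
by rewrite mul1r addrC subrK.
Qed.

Lemma interp_le0 n f s : s <= 0 -> interp n f s = f 0.
Proof.
move=> s0; elim: n => //= n ->; rewrite clip_le0 ?mul0r ?addr0 //.
by rewrite subr_le0 (le_trans s0).
Qed.

Lemma interpE n f s k : (k < n)%N -> k%:R <= s <= k%:R + 1 ->
  interp n f s = f k + (s - k%:R)%:C * (f k.+1 - f k).
Proof.
elim: n => // n IH; rewrite ltnS leq_eqVlt => /orP[/eqP->|kn] /andP[ks sk] /=.
  by rewrite interp_ge // clip_id // subr_ge0 ks lerBlDl.
rewrite IH ?ks // clip_le0 ?mul0r ?addr0 // subr_le0 (le_trans sk) //.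
by rewrite natr1 ler_nat.
Qed.

Lemma interp_cst n f s c : (forall i, f i = c) -> interp n f s = c.
Proof.
by move=> fc; elim: n => //= n ->; rewrite !fc subrr mulr0 addr0.
Qed.

Lemma interp_continuous (T : topologicalType) n (f : nat -> T -> C) (s : T -> R) :
  (forall i, continuous (f i)) -> continuous s ->
  continuous (fun x => interp n (f^~ x) (s x)).
Proof.
move=> cf cs; elim: n => [|n IH] x /=; first exact: cf.
apply: (@continuousDC _ _ (fun x => interp n (f^~ x) (s x))
  (fun x => (clip (s x - n%:R))%:C * (f n.+1 x - f n x))); first exact: IH.
apply: (@continuousMC _ _ (fun x => (clip (s x - n%:R))%:C)
  (fun x => f n.+1 x - f n x)); last first.
  by apply: (@cvgB _ C); exact: cf.
apply: (@continuous_complex _ _ (fun x => clip (s x - n%:R)) (cst 0)); last first.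
  exact: cst_continuous.
apply: (@continuous_comp _ _ _ (fun x => s x - n%:R) clip); last exact: clip_continuous.
by apply: cvgB; [exact: cs|exact: cvg_cst].
Qed.

Lemma nat_interval n (t : R) : 0 <= t <= n.+1%:R ->
  exists2 k, (k < n.+1)%N & k%:R <= t <= k%:R + 1.
Proof.
elim: n => [|n IH] /andP[t0 tn]; first by exists 0%N; rewrite // t0 add0r.
have [tn1|tn1] := lerP t n.+1%:R.
  by have [|k kn kt] := IH; [rewrite t0|exists k => //; exact: ltnW].
by exists n.+1; rewrite // (ltW tn1) natr1.
Qed.

End PiecewiseLinear.

(** * Polygonal loops and their elementary moves *)

Section Deformations.
Context {R : realType}.
Local Notation C := (Cplane R).
Variables (U : set C) (p0 : C).
Hypothesis Up0 : U p0.

Definition convex (K : set C) := forall (x y : C) (t : R),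
  0 <= t <= 1 -> K x -> K y -> K (x + t%:C * (y - x)).

(** Any convex subset of [U] around the points will do, which spares the hull itself; balls and
    lattice squares are the typical witnesses. *)
Definition cohull (s : seq C) :=
  exists2 K : set C, convex K /\ K `<=` U & forall z, z \in s -> K z.

Lemma cohull_sub s s' : {subset s' <= s} -> cohull s -> cohull s'.
Proof. by move=> ss' [K KU sK]; exists K => // z /ss'/sK. Qed.

Lemma cohull_base : cohull [:: p0].
Proof.
exists [set p0]; last by move=> z; rewrite inE => /eqP.
split; last by move=> _ ->.
by move=> _ _ t _ -> ->; rewrite /= subrr mulr0 addr0.
Qed.

(* Vertex lists are closed up by an infinite tail at the base point [p0]. *)
Local Notation pt := (nth p0).

(** Edges of equal index share a convex part of [U], so linear interpolation between the two
    polygons stays in [U]. *)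
Definition step (a b : seq C) :=
  [/\ pt a 0 = p0, pt b 0 = p0 &
    forall i, cohull [:: pt a i; pt a i.+1; pt b i; pt b i.+1]].

Inductive deform (a : seq C) : seq C -> Prop :=
  | deform_refl : deform a a
  | deform_step b c : step a b -> deform b c -> deform a c.

Definition valid (a : seq C) :=
  pt a 0 = p0 /\ forall i, cohull [:: pt a i; pt a i.+1].

Lemma step_sym a b : step a b -> step b a.
Proof.
move=> [a0 b0 ab]; split=> // i; apply: cohull_sub (ab i) => z.
by rewrite !inE => /or4P[] ->; rewrite ?orbT.
Qed.

Lemma step_valid a b : step a b -> valid b.
Proof.
move=> [a0 b0 ab]; split=> // i; apply: cohull_sub (ab i) => z.
by rewrite !inE => /orP[] ->; rewrite ?orbT.
Qed.

Lemma deform1 a b : step a b -> deform a b.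
Proof. by move=> ab; apply: deform_step ab _; exact: deform_refl. Qed.

Lemma deform_trans a b c : deform a b -> deform b c -> deform a c.
Proof. by elim=> // {}a d e ad _ IH /IH; exact: deform_step. Qed.

Lemma deform_sym a b : deform a b -> deform b a.
Proof.
elim=> [{}a|{}a d e ad _ IH]; first exact: deform_refl.
by apply: deform_trans IH _; exact/deform1/step_sym.
Qed.

Lemma deform_valid a b : deform a b -> valid a -> valid b.
Proof. by elim=> // {}a d e ad _ IH _; apply: IH; exact: step_valid ad. Qed.

Lemma step_eq_nth a b : valid a -> (forall i, pt a i = pt b i) -> step a b.
Proof.
move=> [a0 va] ab; split; rewrite -?ab // => i; rewrite -!ab.
by apply: cohull_sub (va i) => z; rewrite !inE orbA orbb.
Qed.

Lemma step_update x u v w z : valid (x ++ u :: v :: z) ->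
  cohull [:: u; v; w] -> cohull [:: v; w; head p0 z] ->
  step (x ++ u :: v :: z) (x ++ u :: w :: z).
Proof.
move=> [x0 va] uvw vwz.
have same i : (i <= size x)%N -> pt (x ++ u :: v :: z) i = pt (x ++ u :: w :: z) i.
  by move=> ix; rewrite !nth_cat; case: ltngtP ix => // ->; rewrite subnn.
split=> // [|i]; first by rewrite -same.
have [ix|] := ltnP i (size x).
  rewrite -!same ?(ltnW ix) //; apply: cohull_sub (va i) => y.
  by rewrite !inE orbA orbb.
rewrite leq_eqVlt => /orP[/eqP<-|].
  rewrite !nth_cat ltnn ltnNge leqnSn subnn subSnn /=.
  apply: cohull_sub uvw => y; rewrite !inE => /or4P[] ->; rewrite ?orbT //.
have := va i; rewrite !nth_cat => vi xi.
have xi' := ltnW xi; rewrite ltnNge xi' /= in vi *.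
rewrite ltnNge (leqW xi') /= in vi *.
have -> : (i.+1 - size x = (i - (size x).+1).+2)%N by lia.
move: vi; have -> : (i.+1 - size x = (i - (size x).+1).+2)%N by lia.
have -> : (i - size x = (i - (size x).+1).+1)%N by lia.
case: (i - (size x).+1)%N => [|k] /= vi.
  apply: cohull_sub vwz => y; rewrite -nth0 !inE.
  by move=> /or4P[] ->; rewrite ?orbT.
by apply: cohull_sub vi => y; rewrite !inE orbA orbb.
Qed.

(** A move compares vertices of equal index, so an insertion has to shift the whole tail by one
    place. The shift starts from the end of the list: once [w] is doubled, its first copy can be
    moved to [y]. *)
Lemma deform_dup x y z : valid (x ++ y :: z) ->
  deform (x ++ y :: z) (x ++ y :: y :: z).
Proof.
elim: z x y => [|w z IH] x y va.
  (* One entry of the constant tail is written out; this changes no vertex and makes room for the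
     copy of [y]. *)
  have pad : step (x ++ [:: y]) (x ++ [:: y; p0]).
    apply: step_eq_nth => // i; rewrite !nth_cat.
    by case: ifP => // _; case: (i - size x)%N => [|[|k]] //=; rewrite !nth_nil.
  have vp := step_valid pad.
  apply: deform_step pad _; apply/deform1/step_update => //.
  - have := va.2 (size x); rewrite !nth_cat ltnn ltnNge leqnSn subnn subSnn /=.
    by apply: cohull_sub => v; rewrite !inE => /or3P[] ->; rewrite ?orbT.
  - have := va.2 (size x); rewrite !nth_cat ltnn ltnNge leqnSn subnn subSnn /=.
    by apply: cohull_sub => v; rewrite !inE => /or3P[] ->; rewrite ?orbT.
rewrite -cat_rcons in va; have := IH _ _ va; rewrite !cat_rcons => d.
apply: deform_trans d _; apply/deform1/step_update.
- by have := deform_valid (IH _ _ va) va; rewrite cat_rcons.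
- have := va.2 (size x); rewrite cat_rcons !nth_cat ltnn ltnNge leqnSn subnn subSnn /=.
  by apply: cohull_sub => v; rewrite !inE => /or3P[] ->; rewrite ?orbT.
- have := va.2 (size x); rewrite cat_rcons !nth_cat ltnn ltnNge leqnSn subnn subSnn /=.
  by apply: cohull_sub => v; rewrite !inE => /or3P[] ->; rewrite ?orbT.
Qed.

Lemma deform_insert x u v z : valid (x ++ u :: z) ->
  cohull [:: u; v; head p0 z] -> deform (x ++ u :: z) (x ++ u :: v :: z).
Proof.
move=> va uvz; have d := deform_dup va; have vd := deform_valid d va.
apply: deform_trans d _; apply/deform1/step_update => //.
by apply: cohull_sub uvz => w; rewrite !inE => /or3P[] ->; rewrite ?orbT.
Qed.

(** Row [j] is the polygon after [j] moves. Thanks to the constant tail all rows have a common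
    length [n], and each cell of the array lies in a convex part of [U]. *)
Lemma deform_array a : valid a -> deform a [::] ->
  exists (P : nat -> nat -> C) (m n : nat), [/\ forall i, P 0 i = pt a i,
    forall i, P m i = p0,
    forall j i, (n <= i)%N -> P j i = p0,
    forall j, P j 0 = p0 &
    forall j i, cohull [:: P j i; P j i.+1; P j.+1 i; P j.+1 i.+1]].
Proof.
move=> va ae; have [e e0] : {e | e = [::] :> seq C} by exists [::].
rewrite -e0 in ae; elim: ae va e0 => {a e}.
  move=> a va a0; exists (fun _ _ => p0), 0%N, 0%N; rewrite a0; split=> //.
  - by move=> i; rewrite nth_nil.
  - move=> j i; apply: cohull_sub cohull_base => z.
    by rewrite !inE => /or4P[].
move=> a b e ab _ IH va /(IH (step_valid ab))[P [m [n [P0 Pm Pn Pj PP]]]].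
exists (fun j i => if j is k.+1 then P k i else pt a i), m.+1, (maxn n (size a)).
split=> //.
- move=> [|j] i; rewrite geq_max => /andP[ni ai]; last exact: Pn.
  by rewrite nth_default.
- by case=> [|j]; [case: va|exact: Pj].
- by move=> [|j] i; [rewrite !P0; case: ab|exact: PP].
Qed.

End Deformations.

(** * From moves of polygons to a homotopy of the loop *)

Section NullHomotopy.
Context {R : realType}.
Local Notation C := (Cplane R).
Variables (U : set C) (g : R -> C) (n : nat).
Hypothesis cg : continuous g.
Hypothesis gU : forall t, U (g t).
Hypothesis g0 : forall t, t <= 0 -> g t = g 0.
Hypothesis g1 : forall t, 1 <= t -> g t = g 0.
Hypothesis n_gt0 : (0 < n)%N.
Hypothesis g_fine : forall i : nat, exists2 K : set C, convex K /\ K `<=` U &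
  forall t : R, i%:R <= t * n%:R <= i%:R + 1 -> K (g t).

Lemma null_homotopic_deform :
  deform U (g 0) [seq g (i%:R / n%:R) | i <- iota 0 n.+1] [::] ->
  null_homotopic U g.
Proof.
have n0 : (n%:R : R) != 0 by rewrite pnatr_eq0 -lt0n.
set a := map _ _.
have aE i : nth (g 0) a i = g (i%:R / n%:R).
  have [ni|ni] := ltnP i n.+1.
    by rewrite (nth_map 0%N) ?size_iota // nth_iota.
  rewrite nth_default ?size_map ?size_iota // g1 //.
  by rewrite ler_pdivlMr ?ltr0n // mul1r ler_nat ltnW.
have va : valid U (g 0) a.
  split=> [|i]; first by rewrite aE mul0r.
  have [K KU gK] := g_fine i; exists K => // z; rewrite !inE !aE.
  move=> /orP[]/eqP->; apply: gK; rewrite divfK //.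
    by rewrite lexx lerDl ler01.
  by rewrite -natr1 lexx andbT lerDl ler01.
move=> /(deform_array (gU 0) va)[P [m [N [P0 Pm PN Pj PP]]]].
pose N1 := maxn N n.
have N1_gt0 : (0 < N1)%N by rewrite leq_max n_gt0 orbT.
pose B (s t : R) := interp m (fun j => interp N1 (P j) t) s.
pose s' (s : R) := m.+2%:R * s; pose t' (t : R) := N1%:R * t.
(* The homotopy has three phases, read on [s' s] in [0, m + 2]. Up to 1, [g] is reparametrised so
   that its i-th piece is run while [t' t] goes from i to i + 1; up to 2, it is moved straight to
   its inscribed polygon; then the [m] rows of the array are followed. *)
pose rho (x : R * R) := (1 - clip (s' x.1)) * x.2 + clip (s' x.1) * (t' x.2 / n%:R).
pose h (x : R * R) : C := B (s' x.1 - 2) (t' x.2) +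
  (clip (2 - s' x.1))%:C * (g (rho x) - B 0 (t' x.2)).
have B0 s t : s <= 0 -> B s t = interp N1 (P 0) t.
  by move=> s0; rewrite /B interp_le0.
have PN1 j : P j N1 = g 0 by rewrite PN // leq_maxl.
exists h; split.
- have cs : continuous (fun x : R * R => s' x.1).
    by move=> x; apply: cvgM; [exact: cvg_cst|exact: cvg_fst].
  have ct : continuous (fun x : R * R => t' x.2).
    by move=> x; apply: cvgM; [exact: cvg_cst|exact: cvg_snd].
  have cB (s : R * R -> R) : continuous s -> continuous (fun x => B (s x) (t' x.2)).
    move=> cs0; apply: (@interp_continuous _ _ m (fun j x => interp N1 (P j) (t' x.2))) => //.
    by move=> j; apply: (@interp_continuous _ _ N1 (fun i _ => P j i)) => // i x;
      exact: cst_continuous.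
  have ccl (s : R * R -> R) : continuous s -> continuous (fun x => clip (s x)).
    by move=> cs0 x; apply: continuous_comp; [exact: cs0|exact: clip_continuous].
  apply: continuous_subspaceT => x.
  apply: (@continuousDC _ _ (fun x => B (s' x.1 - 2) (t' x.2))).
    by apply: cB => y; apply: cvgB; [exact: cs|exact: cvg_cst].
  apply: (@continuousMC _ _ (fun x => (clip (2 - s' x.1))%:C)
    (fun x => g (rho x) - B 0 (t' x.2))).
    apply: (@continuous_complex _ _ (fun x => clip (2 - s' x.1)) (cst 0)).
      by apply: ccl => y; apply: cvgB; [exact: cvg_cst|exact: cs].
    exact: cst_continuous.
  apply: (@cvgB _ C); last by apply: (cB (cst 0)); exact: cst_continuous.
  apply: (@continuous_comp _ _ _ rho g); last exact: cg.
  apply: cvgD; apply: cvgM.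
  + by apply: cvgB; [exact: cvg_cst|exact: ccl].
  + exact: cvg_snd.
  + exact: ccl.
  + by apply: cvgM; [exact: ct|exact: cvg_cst].
- move=> _ [[s t] [/= s01 t01] <-].
  rewrite !in_itv /= in s01 t01; case/andP: s01 t01 => s0 s1 /andP[t0 t1].
  have t'0 : 0 <= t' t <= N1%:R by rewrite mulr_ge0 //= /t' ler_piMr.
  have [k kN kt] : exists2 k, (k < N1)%N & k%:R <= t' t <= k%:R + 1.
    by rewrite -(prednK N1_gt0) in t'0 *; exact: nat_interval.
  have [s'1|s'1] := lerP (s' s) 1.
    rewrite /h /= !B0 ?lexx //; last by lra.
    by rewrite clip_ge1; [rewrite mul1r addrC subrK; exact: gU|lra].
  have [s'2|s'2] := lerP (s' s) 2.
    rewrite /h /= !B0 // ?subr_le0 // /rho /= (clip_ge1 (ltW s'1)) subrr mul0r add0r mul1r.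
    have [K [cK KU] gK] := g_fine k; apply: KU; apply: (cK).
    + by apply: clip_itv.
    + have gKk i : (i == k) || (i == k.+1) -> K (P 0%N i).
        move=> ik; rewrite P0 aE; apply: gK; rewrite divfK //.
        by case/orP: ik => /eqP ->; rewrite -?natr1 lexx lerDl ler01.
      rewrite (interpE _ kN kt); apply: (cK); last 2 first.
      * by apply: gKk; rewrite eqxx.
      * by apply: gKk; rewrite eqxx orbT.
      by case/andP: kt => ? ?; rewrite subr_ge0 lerBlDl; apply/andP.
    + by apply: gK; rewrite divfK.
  have m_gt0 : (0 < m)%N.
    rewrite lt0n; apply/negP => /eqP m0; move: s'2; rewrite /s' m0.
    by apply/negP; rewrite -leNgt ler_piMr.
  rewrite /h /= (clip_le0 (x := 2 - s' s)) ?mul0r ?addr0; last by rewrite subr_le0 ltW.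
  have [j jm js] : exists2 j, (j < m.-1.+1)%N & j%:R <= s' s - 2 <= j%:R + 1.
    apply: nat_interval; rewrite prednK // subr_ge0 ltW //= lerBlDr.
    by rewrite -natrD addn2 ler_piMr.
  rewrite prednK // in jm.
  have [K [cK KU] PK] := PP j k; apply: KU.
  rewrite /B (interpE _ jm js) !(interpE _ kN kt).
  have unit (x : R) (i : nat) : i%:R <= x <= i%:R + 1 -> 0 <= x - i%:R <= 1.
    by case/andP => ? ?; rewrite subr_ge0 lerBlDl; apply/andP.
  by apply: (cK); [exact: unit|apply: (cK)|apply: (cK)]; try (exact: unit);
    apply: PK; rewrite !inE eqxx ?orbT.
- move=> t; rewrite in_itv /= => /andP[t0 t1].
  rewrite /h /= /rho /= /s' mulr0 !B0 ?sub0r ?oppr_le0 //.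
  by rewrite subr0 clip_ge1 ?ler1n // clip_le0 // subr0 mul1r mul0r addr0 mul1r addrC subrK.
- move=> t; rewrite in_itv /= => /andP[t0 t1].
  rewrite /h /= /s' mulr1 [clip (2 - _)]clip_le0 ?mul0r ?addr0.
    rewrite /B interp_ge; first exact: interp_cst.
    by rewrite -addn2 natrD addrK.
  by rewrite subr_le0 ler_nat.
- move=> s; rewrite in_itv /= => /andP[s0 s1].
  have Bt t : (t == 0) || (t == N1%:R) -> forall s, B s t = g 0.
    move=> tt s2; apply: interp_cst => j; case/orP: tt => /eqP ->.
      by rewrite interp_le0 // Pj.
    by rewrite interp_ge // PN1.
  split; rewrite /h /= /t' ?mulr0 ?mulr1 !Bt ?eqxx ?orbT //.
    by rewrite /rho /= /t' !(mulr0, mul0r) addr0 subrr mulr0 addr0.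
  rewrite g1 ?subrr ?mulr0 ?addr0 // /rho /= /t' !mulr1.
  have : 1 <= N1%:R / n%:R :> R by rewrite ler_pdivlMr ?ltr0n // mul1r ler_nat leq_maxr.
  have /andP[c0 c1] := clip_itv (s' s).
  by move=> /(ler_wpM2l c0); lra.
Qed.

End NullHomotopy.

(** * Lattice loops in full sets *)

Definition full {R : realType} (U : set (Cplane R)) :=
  forall (V : set (Cplane R)) (M : R), open V ->
    (forall z : Cplane R, V z -> cmod z <= M) ->
    (forall z : Cplane R, closure V z -> ~ V z -> U z) -> V `<=` U.

Section LatticePaths.
Implicit Types (u v a b q : int * int) (p : seq (int * int)).

Definition adj u v : bool :=
  ((u.1 == v.1) && ((v.2 == u.2 + 1) || (u.2 == v.2 + 1))) ||
  ((u.2 == v.2) && ((v.1 == u.1 + 1) || (u.1 == v.1 + 1))).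

Definition same_edge a b u v : bool :=
  ((u == a) && (v == b)) || ((u == b) && (v == a)).

Fixpoint parity (r : rel (int * int)) u p : bool :=
  if p is v :: p' then r u v (+) parity r v p' else false.

Lemma parity_split r u p : parity r u p ->
  exists p1 v p2, p = p1 ++ v :: p2 /\ r (last u p1) v.
Proof.
elim: p u => //= v p IH u.
have [ruv _|ruv /= /IH[p1 [w [p2 [-> rw]]]]] := boolP (r u v).
  by exists [::], v, p.
by exists (v :: p1), w, p2.
Qed.

(** A relation that is a coboundary counts to the difference of the values of [g] at the two ends,
    hence to zero on a loop. *)
Lemma parity_telescope (e r : rel (int * int)) (g : int * int -> bool) u p :
  (forall u v, e u v -> r u v = g u (+) g v) -> path e u p ->
  parity r u p = g u (+) g (last u p).
Proof.
move=> rg; elim: p u => [|v p IH] u /=; first by rewrite addbb.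
by case/andP=> /rg -> /IH ->; rewrite addbA addbK.
Qed.

Lemma eq_parity (e r s t : rel (int * int)) u p :
  (forall u v, e u v -> r u v = s u v (+) t u v) -> path e u p ->
  parity r u p = parity s u p (+) parity t u p.
Proof.
move=> rst; elim: p u => //= v p IH u /andP[/rst -> /IH ->].
by rewrite addbACA.
Qed.

Fixpoint subdiv (ins : int * int -> int * int -> seq (int * int)) u p :=
  if p is v :: p' then ins u v ++ v :: subdiv ins v p' else [::].

Lemma last_subdiv ins u p : last u (subdiv ins u p) = last u p.
Proof. by elim: p u => //= v p IH u; rewrite last_cat /= IH. Qed.

Lemma path_subdiv (e e' : rel (int * int)) ins u p :
  (forall u v, e u v -> path e' u (rcons (ins u v) v)) ->
  path e u p -> path e' u (subdiv ins u p).
Proof.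
move=> ee'; elim: p u => //= v p IH u /andP[/ee' uv /IH vp].
by rewrite -cat_rcons cat_path uv last_rcons vp.
Qed.

Definition range (M : nat) : seq int :=
  [seq (k%:Z - M%:Z) | k <- iota 0 (M + M).+1].

Lemma mem_range M i : (i \in range M) = (- M%:Z <= i <= M%:Z).
Proof.
apply/mapP/idP => [[k] |iM]; first by rewrite mem_iota; lia.
by exists (absz (i + M%:Z)); rewrite ?mem_iota; lia.
Qed.

Definition box M := [seq (i, j) | i <- range M, j <- range M].

Lemma mem_box M q : (q \in box M) = (q.1 \in range M) && (q.2 \in range M).
Proof.
case: q => i j; apply/allpairsP/andP => [[[i' j'] [/= ? ? [-> ->]]]//|[? ?]].
by exists (i, j).
Qed.

Lemma sub_box (s : seq (int * int)) : exists M, {subset s <= box M}.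
Proof.
elim: s => [|q s [M sM]]; first by exists 0%N.
exists (M + `|q.1| + `|q.2|)%N => r; rewrite inE => /orP[/eqP->|/sM].
  by rewrite mem_box !mem_range; lia.
by rewrite !mem_box !mem_range; lia.
Qed.

(* A square is named by its lower left corner.  The common edge of a square of
   [S] with one outside [S] belongs to [X]. *)
Definition bounds (X : rel (int * int)) (S : seq (int * int)) :=
  forall i j,
    (((i, j) \in S) (+) ((i - 1, j) \in S) -> X (i, j) (i, j + 1)) /\
    (((i, j) \in S) (+) ((i, j - 1) \in S) -> X (i, j) (i + 1, j)).

Lemma exit_seq (S : seq (int * int)) (f : nat -> int * int) :
  injective f -> f 0%N \in S -> exists2 n, f n \in S & f n.+1 \notin S.
Proof.
move=> fi f0; have [//|nex] := pselect (exists2 n, f n \in S & f n.+1 \notin S).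
have fS n : f n \in S.
  elim: n => // n fn; apply/negPn/negP => fn1; apply: nex; by exists n.
have : (size [seq f n | n <- iota 0 (size S).+1] <= size S)%N.
  apply: uniq_leq_size; first by rewrite map_inj_uniq // iota_uniq.
  by move=> _ /mapP[n _ ->].
by rewrite size_map size_iota ltnn.
Qed.

(** Walking up from a square of [S] leads out of [S] through a horizontal edge of [X], which
    confines [i]; walking left does the same for [j]. *)
Lemma bounds_box (X : rel (int * int)) M S :
  (forall u v, X u v -> u \in box M) -> bounds X S -> {subset S <= box M}.
Proof.
move=> XM bS [i j] qS.
have [n n0 n1] : exists2 n : nat, (i, j + n%:Z) \in S & (i, j + n.+1%:Z) \notin S.
  apply: (@exit_seq S (fun n : nat => (i, j + n%:Z))); last by rewrite addr0.
  by move=> m n []; lia.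
have [m m0 m1] : exists2 n : nat, (i - n%:Z, j) \in S & (i - n.+1%:Z, j) \notin S.
  apply: (@exit_seq S (fun n : nat => (i - n%:Z, j))); last by rewrite subr0.
  by move=> m k []; lia.
have /XM : X (i, j + n%:Z + 1) (i + 1, j + n%:Z + 1).
  apply: (bS _ _).2; rewrite addrK n0.
  have -> : j + n%:Z + 1 = j + n.+1%:Z by lia.
  by rewrite (negbTE n1).
have /XM : X (i - m%:Z, j) (i - m%:Z, j + 1).
  apply: (bS _ _).1; rewrite m0.
  have -> : i - m%:Z - 1 = i - m.+1%:Z by lia.
  by rewrite (negbTE m1).
by rewrite !mem_box !mem_range; lia.
Qed.

(** These are the edges met by the ray that runs to the right from the centre of the square (i, j).
    Along a loop their parity is the winding number about that square modulo 2. *)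
Definition crossing (i j : int) u v : bool := (u.1 == v.1) && (i < u.1) &&
  (((u.2 == j) && (v.2 == j + 1)) || ((u.2 == j + 1) && (v.2 == j))).

(** The squares about which the loop winds an odd number of times form a finite set [S]. Across an
    edge the winding parity changes by the number of passages of the loop through that edge. Hence
    the boundary of [S] lies in [X], so [S] is empty and all these numbers are even. *)
Lemma even_edges (X : rel (int * int)) u p :
  (forall a b, X a b -> adj a b) -> symmetric X ->
  (forall S, bounds X S -> S = [::]) ->
  path X u p -> last u p = u -> forall a b, adj a b ->
  parity (same_edge a b) u p = false.
Proof.
move=> Xadj Xsym noS up pu.
have Xedge a b : parity (same_edge a b) u p -> X a b.
  case/parity_split=> p1 [v [p2 [pE]]]; move: up; rewrite pE cat_path /=.
  by case/and3P=> _ Xv _ /orP[]/andP[/eqP <- /eqP <-] //; rewrite Xsym.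
have [M sM] := sub_box (u :: p).
have out q : parity (crossing q.1 q.2) u p -> q \in box M.
  move=> qp; have qM : (- M%:Z <= q.2 <= M%:Z) && (q.1 <= M%:Z).
    have [p1 [v [p2 [pE]]]] := parity_split qp.
    have := sM (last u p1); have := sM v.
    have -> : v \in u :: p by rewrite pE inE mem_cat inE eqxx !orbT.
    have -> : last u p1 \in u :: p.
      by rewrite pE -cat_cons mem_cat mem_last.
    rewrite !mem_box !mem_range /crossing => /(_ isT) vM /(_ isT) uM.
    by move: vM uM; move: (last u p1) v {pE} => [? ?] [? ?] /=; lia.
  rewrite mem_box !mem_range; case: (lerP (- M%:Z) q.1) => [|iM]; first by lia.
  (* From a square to the left of the box, the ray meets every edge by which the loop crosses the
     horizontal line at that height, and a loop crosses a line an even number of times. *)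
  have pM : path (fun a b => X a b && (- M%:Z <= a.1)) u p.
    have : {in u :: p, forall a : int * int, - M%:Z <= a.1}.
      by move=> a /sM; rewrite mem_box !mem_range; lia.
    elim: (p) (u) up => //= v p' IH u' /andP[-> /IH vp] uM /=.
    rewrite uM ?inE ?eqxx // vp // => w wp; apply: uM; by rewrite inE wp orbT.
  move: qp; rewrite (parity_telescope (g := fun a => q.2 < a.2) _ pM).
    by rewrite pu addbb.
  move=> [a1 a2] [b1 b2] /andP[/Xadj]; rewrite /adj /crossing /= => ab aM.
  by apply/idP/idP; lia.
pose S := [seq q <- box M | parity (crossing q.1 q.2) u p].
have memS q : (q \in S) = parity (crossing q.1 q.2) u p.
  by rewrite mem_filter; case: (boolP (parity _ _ _)) => //= /out.
have vert i j : parity (same_edge (i, j) (i, j + 1)) u p =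
    ((i, j) \in S) (+) ((i - 1, j) \in S).
  rewrite !memS; apply: eq_parity up => -[a1 a2] [b1 b2] /Xadj.
  by rewrite /adj /same_edge /crossing !xpair_eqE /= => ab; apply/idP/idP; lia.
have horz i j : parity (same_edge (i, j) (i + 1, j)) u p =
    ((i, j) \in S) (+) ((i, j - 1) \in S).
  rewrite !memS -(eq_parity (e := X) (r := fun a b => (i < a.1) && (a.1 == b.1) &&
    [|| (a.2 == j) && ((b.2 == j + 1) || (b.2 == j - 1)) |
        (b.2 == j) && ((a.2 == j + 1) || (a.2 == j - 1))]) _ up); last first.
    move=> [a1 a2] [b1 b2] /Xadj.
    by rewrite /adj /crossing /= => ab; apply/idP/idP; lia.
  (* [g] marks the half-row at height [j] to the right of column [i]. A loop has an even number of
     edges with just one end in it; these are vertical edges, counted by the two rays, and the edge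
     from (i, j) to (i + 1, j). *)
  pose g (a : int * int) := (a.2 == j) && (i < a.1).
  have := @parity_telescope X (fun a b => g a (+) g b) g u p (fun _ _ _ => erefl) up.
  rewrite pu addbb => tel.
  rewrite -[LHS]addFb -tel; apply/esym; apply: eq_parity up.
  move=> [a1 a2] [b1 b2] /Xadj; rewrite /adj /same_edge /g !xpair_eqE /= => ab.
  by apply/idP/idP; lia.
have S0 : S = [::].
  apply: noS => i j; split; first by rewrite -vert; exact: Xedge.
  by rewrite -horz; exact: Xedge.
have vert0 i j : parity (same_edge (i, j) (i, j + 1)) u p = false.
  by rewrite vert S0.
have horz0 i j : parity (same_edge (i, j) (i + 1, j)) u p = false.
  by rewrite horz S0.
have sC a b : parity (same_edge a b) u p = parity (same_edge b a) u p.
  by elim: (p) (u) => //= v p' IH u'; rewrite IH /same_edge orbC.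
move=> [a1 a2] [b1 b2]; rewrite /adj /= => /orP[]/andP[/eqP <-] /orP[]/eqP->.
- exact: vert0.
- by rewrite sC vert0.
- exact: horz0.
- by rewrite sC horz0.
Qed.

Lemma same_edge_vv i j k l :
  same_edge (i, j) (i, j + 1) (k, l) (k, l + 1) -> (k, l) = (i, j).
Proof. by rewrite /same_edge !xpair_eqE => ?; congr (_, _); lia. Qed.

Lemma same_edge_hh i j k l :
  same_edge (i, j) (i + 1, j) (k, l) (k + 1, l) -> (k, l) = (i, j).
Proof. by rewrite /same_edge !xpair_eqE => ?; congr (_, _); lia. Qed.

Lemma same_edge_hv i j k l : same_edge (i, j) (i + 1, j) (k, l) (k, l + 1) = false.
Proof. by rewrite /same_edge !xpair_eqE; apply/negP; lia. Qed.

Lemma same_edge_vh i j k l : same_edge (i, j) (i, j + 1) (k, l) (k + 1, l) = false.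
Proof. by rewrite /same_edge !xpair_eqE; apply/negP; lia. Qed.

Lemma int_neighbours (i j : int) : i <= j + 1 -> j <= i + 1 ->
  i = j + 1 \/ j = i + 1 \/ j = i.
Proof. lia. Qed.

Lemma topmost (S : seq (int * int)) : S != [::] ->
  exists2 q, q \in S & forall q', q' \in S -> q'.2 <= q.2.
Proof.
elim: S => // q S IH _; have [->|/IH[r rS rM]] := eqVneq S [::].
  by exists q; rewrite ?inE // => q'; rewrite inE => /eqP->.
have [qr|rq] := lerP q.2 r.2.
  exists r; rewrite ?inE ?rS ?orbT // => q'.
  by rewrite inE => /orP[/eqP->|/rM].
exists q; rewrite ?inE ?eqxx // => q'; rewrite inE => /orP[/eqP->//|/rM].
by move/le_trans; apply; exact: ltW.
Qed.

End LatticePaths.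

Section JoinedVertices.
Context {R : realType}.
Local Notation C := (Cplane R).
Variables (U : set C) (p0 : C).

Definition joined : rel C := fun u v => `[< cohull U [:: u; v] >].

Lemma joined_sym : symmetric joined.
Proof.
by move=> u v; apply/asboolP/asboolP; apply: cohull_sub => z; rewrite !inE orbC.
Qed.

(** Turns validity into a [path] condition on the finite list closed up by [p0], so that
    concatenations can be split. *)
Lemma valid_path s : valid U p0 s <->
  head p0 s = p0 /\ path joined p0 (rcons s p0) /\ U p0.
Proof.
split=> [[s0 vs]|[s0 [/(pathP p0) ps Up]]].
  split; first by rewrite -nth0.
  split; last by have [K [_ KU] Kp] := vs 0%N; apply: KU; apply: Kp; rewrite s0 inE eqxx.
  apply/(pathP p0) => i; rewrite size_rcons ltnS => is_; apply/asboolP.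
  case: i is_ => [|i] is_.
    have := vs 0%N; apply: cohull_sub => z; rewrite /= !inE s0.
    have -> : nth p0 (rcons s p0) 0 = p0 by case: (s) s0.
    by rewrite orbb => ->.
  have := vs i; apply: cohull_sub => z; rewrite /= !nth_rcons is_.
  rewrite if_same; case: ifP => // /negbT; rewrite -leqNgt => si.
  by rewrite [nth p0 s i.+1]nth_default.
split=> [|i]; first by rewrite nth0.
have [is_|is_] := ltnP i (size s).
  have := ps i.+1; rewrite size_rcons ltnS => /(_ is_) /asboolP.
  apply: cohull_sub => z; rewrite /= !nth_rcons is_.
  rewrite if_same; case: ifP => // /negbT; rewrite -leqNgt => si.
  by rewrite [nth p0 s i.+1]nth_default.
rewrite !nth_default //; last exact: leqW.
by apply: cohull_sub (cohull_base Up) => z; rewrite !inE orbb.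
Qed.

(** Moving [v] onto [u] leaves a duplicate of [u], which [deform_dup] removes when read
    backwards. *)
Lemma deform_delete x u v z : valid U p0 (x ++ u :: v :: z) ->
  cohull U [:: u; v; head p0 z] ->
  deform U p0 (x ++ u :: v :: z) (x ++ u :: z).
Proof.
move=> va uvz.
have va' : valid U p0 (x ++ u :: z).
  move/valid_path: va => [h [pa Up]]; apply/valid_path.
  split; first by case: (x) h.
  split=> //; move: pa; rewrite !rcons_cat !cat_path /= => /and4P[-> -> _].
  have uz : joined u (head p0 z).
    by apply/asboolP; apply: cohull_sub uvz => w; rewrite !inE => /orP[]->; rewrite ?orbT.
  by case: z {uvz h} uz => [|y z] /= -> // /andP[].
apply: deform_step (deform_sym (deform_dup va')).
apply: step_update va _ _.
  by apply: cohull_sub uvz => w; rewrite !inE => /or3P[]->; rewrite ?orbT.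
by apply: cohull_sub uvz => w; rewrite !inE => /or3P[]->; rewrite ?orbT.
Qed.

End JoinedVertices.

Section LatticeDeformations.
Context {R : realType}.
Local Notation C := (Cplane R).
Variables (U : set C) (p0 : C) (eps : R).
Hypotheses (eps_gt0 : 0 < eps) (fullU : full U).
Implicit Types (u v a b q : int * int) (p : seq (int * int)).

Definition lat v : C :=
  (complex.Re p0 + eps * v.1%:~R) +i* (complex.Im p0 + eps * v.2%:~R).

Definition strip (i : int) (x : R) := i%:~R <= x <= i%:~R + 1.
Definition lat_re (z : C) : R := (complex.Re z - complex.Re p0) / eps.
Definition lat_im (z : C) : R := (complex.Im z - complex.Im p0) / eps.
Definition in_square q (z : C) := strip q.1 (lat_re z) /\ strip q.2 (lat_im z).

Definition lvalid p := valid U p0 (map lat p).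
Definition ldeform p p' := deform U p0 (map lat p) (map lat p').
Definition edge : rel (int * int) := fun u v => adj u v && joined U (lat u) (lat v).

Lemma edge_sym : symmetric edge.
Proof.
move=> u v; rewrite /edge joined_sym; congr (_ && _).
by rewrite /adj; apply/idP/idP; lia.
Qed.

Lemma ldeform_backtrack x u v p : lvalid (x ++ u :: v :: u :: p) ->
  ldeform (x ++ u :: v :: u :: p) (x ++ u :: p).
Proof.
rewrite /lvalid /ldeform !map_cat /= => va.
have [h [pa Up]] := (valid_path _ _ _).1 va.
move: pa; rewrite rcons_cat cat_path /= => /and5P[_ _ _ _ pp].
have va' : deform U p0 (map lat x ++ lat u :: lat v :: lat u :: map lat p)
    (map lat x ++ lat u :: lat u :: map lat p).
  apply: deform_delete => //=.
  have [_ [+ _]] := (valid_path _ _ _).1 va.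
  rewrite rcons_cat cat_path /= => /and4P[_ _ /asboolP + _].
  by apply: cohull_sub => w; rewrite !inE => /or3P[]->; rewrite ?orbT.
apply: (deform_trans va' _); apply: deform_delete; first exact: deform_valid va' va.
have /asboolP : joined U (lat u) (head p0 (map lat p)).
  by case: (p) pp => [|y p'] /= /andP[].
by apply: cohull_sub => w; rewrite !inE => /or3P[]->; rewrite ?orbT.
Qed.

Lemma ldeform_subdiv ins (e : rel (int * int)) x u p :
  (forall u v x y, e u v -> lvalid (x ++ u :: v :: y) ->
    ldeform (x ++ u :: v :: y) (x ++ u :: ins u v ++ v :: y)) ->
  path e u p -> lvalid (x ++ u :: p) ->
  ldeform (x ++ u :: p) (x ++ u :: subdiv ins u p).
Proof.
move=> eins; elim: p x u => [|v p IH] x u /=; first by move=> *; exact: deform_refl.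
move=> /andP[uv vp] va; have d := eins _ _ _ _ uv va.
have va' := deform_valid d va.
apply: (deform_trans d _); have := IH (x ++ u :: ins u v) v vp.
by rewrite -!catA /= => /(_ va').
Qed.

(** By parity the first edge of the loop is used again, which splits the loop into shorter ones. If
    it is used in the same direction, both parts are loops at [u]; if in the opposite direction,
    there are a loop at [v], a backtrack along the edge and a loop at [u]. *)
Lemma ldeform_contract (X : rel (int * int)) n x u p y :
  (forall a b, X a b -> adj a b) -> symmetric X ->
  (forall S, bounds X S -> S = [::]) ->
  (size p <= n)%N -> path X u p -> last u p = u -> lvalid (x ++ u :: p ++ y) ->
  ldeform (x ++ u :: p ++ y) (x ++ u :: y).
Proof.
move=> Xadj Xsym noS.
elim: n x u p y => [|n IH] x u [|v p] y //=; try by move=> *; exact: deform_refl.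
rewrite ltnS => pn uvp pu va; have /andP[uv vp] := uvp.
have := even_edges Xadj Xsym noS (p := v :: p) uvp pu (Xadj _ _ uv).
rewrite /= {1}/same_edge !eqxx /= => /negPn.
move=> /parity_split[p1 [w [p2 [pE]]]].
rewrite pE in pn vp pu va *; rewrite cat_path /= in vp; rewrite last_cat /= in pu.
rewrite size_cat /= in pn; case/and3P: vp => vp1 _ wp2.
move=> /orP[]/andP[/eqP p1u /eqP wv]; rewrite wv in va pu wp2 *.
  suff: ldeform (x ++ u :: (v :: p1) ++ (v :: p2) ++ y) (x ++ u :: y).
    by rewrite /= -catA.
  have {}va : lvalid (x ++ u :: (v :: p1) ++ (v :: p2) ++ y).
    by move: va; rewrite /= -catA.
  have d1 := IH x u (v :: p1) ((v :: p2) ++ y).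
  have {}d1 : ldeform (x ++ u :: (v :: p1) ++ (v :: p2) ++ y)
      (x ++ u :: (v :: p2) ++ y).
    by apply: d1 => //=; [lia|rewrite uv].
  apply: (deform_trans d1 _); apply: IH => //=; [lia|by rewrite uv|].
  exact: deform_valid d1 va.
have d1 : ldeform (x ++ [:: u] ++ v :: p1 ++ u :: p2 ++ y)
    ((x ++ [:: u]) ++ v :: u :: p2 ++ y).
  rewrite catA; apply: IH => //; first lia.
  by move: va; rewrite -!catA.
rewrite -!catA /=; apply: (deform_trans d1 _).
have va1 := deform_valid d1; rewrite -catA /= in va1.
have {}va1 : lvalid (x ++ u :: v :: u :: p2 ++ y).
  by apply: va1; move: va; rewrite -!catA.
rewrite -catA /=; have d2 := ldeform_backtrack va1.
apply: (deform_trans d2 _); apply: IH => //; first lia.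
exact: deform_valid d2 va1.
Qed.

Lemma floor_ler (x : R) : (Num.floor x)%:~R <= x < (Num.floor x)%:~R + 1.
Proof.
by rewrite floor_le_tmp /= -[1](mulr1z 1) -intrD floorD1_gt.
Qed.

Lemma ltr_int_succ (i j : int) : (i%:~R : R) < j%:~R -> i%:~R + 1 <= j%:~R :> R.
Proof.
by rewrite ltr_int => ij; rewrite -[1](mulr1z 1) -intrD ler_int; lia.
Qed.

(** The strips form a locally finite family of closed sets, so that only those through [x] come
    close to [x]. *)
Lemma strip_near (x : R) : exists2 e : R, 0 < e &
  forall y i, `|y - x| < e -> strip i y -> strip i x.
Proof.
have /andP[nx xn] := floor_ler x; set n := Num.floor x in nx xn.
have [xe|xne] := eqVneq x n%:~R.
  exists 1 => // y i; rewrite ltr_distl => /andP[y1 y2] /andP[iy yi].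
  have := @ltr_int_succ i (n + 1); have := @ltr_int_succ (n - 1) (i + 1).
  rewrite !intrD intrN mulr1z => h1 h2; rewrite /strip xe.
  by apply/andP; split; [have := h2 ltac:(lra)|have := h1 ltac:(lra)]; lra.
exists (Num.min (n%:~R + 1 - x) (x - n%:~R)).
  by rewrite lt_min !subr_gt0 xn lt_neqAle eq_sym xne nx.
move=> y i; rewrite lt_min !ltr_distl => /andP[/andP[_ y2] /andP[y1 _]] /andP[iy yi].
have := @ltr_int_succ i (n + 1); have := @ltr_int_succ n (i + 1).
rewrite !intrD mulr1z => h1 h2; rewrite /strip.
by apply/andP; split; [have := h2 ltac:(lra)|have := h1 ltac:(lra)]; lra.
Qed.

Lemma strip_le (x : R) i j : strip i x -> strip j x -> i <= j + 1.
Proof.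
move=> /andP[ix _] /andP[_ xj].
by rewrite -(ler_int R) intrD mulr1z (le_trans ix).
Qed.

Lemma strip_meet (x : R) i : strip i x -> strip (i + 1) x -> x = (i + 1)%:~R.
Proof.
move=> /andP[_ x1] /andP[x2 _]; apply/eqP; rewrite eq_le x2 andbT.
by rewrite intrD mulr1z.
Qed.

Lemma lat_reE v : lat_re (lat v) = v.1%:~R.
Proof. by rewrite /lat_re /= addrC addKr mulrC mulKf // gt_eqF. Qed.

Lemma lat_imE v : lat_im (lat v) = v.2%:~R.
Proof. by rewrite /lat_im /= addrC addKr mulrC mulKf // gt_eqF. Qed.

Lemma lat_coord (z w : C) : lat_re z = lat_re w -> lat_im z = lat_im w -> z = w.
Proof.
have e0 : eps^-1 != 0 by rewrite invr_neq0 // gt_eqF.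
by case: z w => [a b] [c e]; rewrite /lat_re /lat_im /=
  => /(mulIf e0)/addIr -> /(mulIf e0)/addIr ->.
Qed.

Lemma lat_re_comb (x y : C) (t : R) :
  lat_re (x + t%:C * (y - x)) = lat_re x + t * (lat_re y - lat_re x).
Proof. by case: x y => [a b] [c e]; rewrite /lat_re; simpc => /=; field; rewrite gt_eqF. Qed.

Lemma lat_im_comb (x y : C) (t : R) :
  lat_im (x + t%:C * (y - x)) = lat_im x + t * (lat_im y - lat_im x).
Proof. by case: x y => [a b] [c e]; rewrite /lat_im; simpc => /=; field; rewrite gt_eqF. Qed.

Lemma strip_convex i (x y t : R) : 0 <= t <= 1 -> strip i x -> strip i y ->
  strip i (x + t * (y - x)).
Proof. by rewrite /strip; move: (i%:~R) => a; nra. Qed.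

Lemma square_convex q : convex (in_square q).
Proof.
move=> x y t t01 [x1 x2] [y1 y2].
by split; rewrite ?lat_re_comb ?lat_im_comb; apply: strip_convex.
Qed.

Lemma edge_horizontal i j (z : C) : edge (i, j) (i + 1, j) ->
  strip i (lat_re z) -> lat_im z = j%:~R -> U z.
Proof.
move=> /andP[_ /asboolP[K [cK KU] Kl]] zi zj; apply: KU.
have -> : z = lat (i, j) + (lat_re z - i%:~R)%:C * (lat (i + 1, j) - lat (i, j)).
  apply: lat_coord; rewrite ?lat_re_comb ?lat_im_comb !(lat_reE, lat_imE) /=.
    by rewrite intrD mulr1z; ring.
  by rewrite zj; ring.
by apply: cK; [move: zi; rewrite /strip; lra|apply: Kl..]; rewrite !inE eqxx ?orbT.
Qed.

Lemma edge_vertical i j (z : C) : edge (i, j) (i, j + 1) ->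
  strip j (lat_im z) -> lat_re z = i%:~R -> U z.
Proof.
move=> /andP[_ /asboolP[K [cK KU] Kl]] zj zi; apply: KU.
have -> : z = lat (i, j) + (lat_im z - j%:~R)%:C * (lat (i, j + 1) - lat (i, j)).
  apply: lat_coord; rewrite ?lat_re_comb ?lat_im_comb !(lat_reE, lat_imE) /=.
    by rewrite zi; ring.
  by rewrite intrD mulr1z; ring.
by apply: cK; [move: zj; rewrite /strip; lra|apply: Kl..]; rewrite !inE eqxx ?orbT.
Qed.

(** Two squares that meet at [z] are joined through the square (i, l) by a vertical and a horizontal
    move. Membership in [S] changes in one of them, and [z] lies on the edge crossed there. *)
Lemma bounds_frontier S q r (z : C) : bounds edge S -> q \in S -> r \notin S ->
  in_square q z -> in_square r z -> U z.
Proof.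
case: q r => [i j] [k l] bS qS rS [/= zi zj] [/= zk zl].
have hor j' l' : ((i, j') \in S) (+) ((i, l') \in S) -> strip j' (lat_im z) ->
    strip l' (lat_im z) -> U z.
  move=> jl zj' zl'; have := strip_le zj' zl'; have := strip_le zl' zj'.
  move=> h1 h2; have [jl1|[jl1|jl1]] := int_neighbours h1 h2.
  - rewrite jl1 in zl' jl; apply: (@edge_horizontal i (j' + 1)) => //.
      by apply: (bS _ _).2; rewrite addrK addbC.
    exact: strip_meet.
  - rewrite jl1 in zj' jl; apply: (@edge_horizontal i (l' + 1)) => //.
      by apply: (bS _ _).2; rewrite addrK.
    exact: strip_meet.
  - by rewrite jl1 addbb in jl.
have [ilS|ilS] := boolP ((i, l) \in S); last first.
  by apply: (hor j l) => //; rewrite qS (negbTE ilS).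
have := strip_le zi zk; have := strip_le zk zi.
move=> h1 h2; have [ik|[ik|ik]] := int_neighbours h1 h2.
- rewrite ik in zk rS; apply: (@edge_vertical (i + 1) l) => //.
    by apply: (bS _ _).1; rewrite addrK ilS (negbTE rS).
  exact: strip_meet.
- rewrite ik in zi ilS; apply: (@edge_vertical (k + 1) l) => //.
    by apply: (bS _ _).1; rewrite addrK ilS (negbTE rS).
  exact: strip_meet.
- by rewrite -ik ilS in rS.
Qed.

Lemma strip_exists (x : R) : exists i, strip i x.
Proof.
exists (Num.floor x); rewrite /strip.
by have /andP[-> /ltW ->] := floor_ler x.
Qed.

Lemma in_square_near (z : C) : exists2 e : R, 0 < e &
  forall w q, cmod (w - z) < e -> in_square q w -> in_square q z.
Proof.
have [e1 e1_gt0 h1] := strip_near (lat_re z).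
have [e2 e2_gt0 h2] := strip_near (lat_im z).
exists (Num.min (e1 * eps) (e2 * eps)); first by rewrite lt_min !mulr_gt0.
move=> w q; rewrite lt_min => /andP[w1 w2] [q1 q2]; split.
  apply: h1 q1; rewrite /lat_re -mulrBl normrM [`|eps^-1|]gtr0_norm ?invr_gt0 //.
  rewrite ltr_pdivrMr // (le_lt_trans _ w1) // (le_trans _ (ler_Re _)) //.
  by case: (z) (w) (p0) => ? ? [? ?] [? ?] /=; rewrite opprB addrA subrK.
apply: h2 q2; rewrite /lat_im -mulrBl normrM [`|eps^-1|]gtr0_norm ?invr_gt0 //.
rewrite ltr_pdivrMr // (le_lt_trans _ w2) // (le_trans _ (ler_Im _)) //.
by case: (z) (w) (p0) => ? ? [? ?] [? ?] /=; rewrite opprB addrA subrK.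
Qed.

(** Fullness of [U] enters here: the points all of whose squares belong to [S] form a bounded open
    set, and [bounds_frontier] puts its boundary in [U]. *)
Lemma bounds_filled S q : bounds edge S -> q \in S -> in_square q `<=` U.
Proof.
move=> bS qS z qz.
have [zV|] := pselect (forall r, in_square r z -> r \in S); last first.
  move=> /existsNP[r /not_implyP[rz rS]].
  by apply: (bounds_frontier bS qS _ qz rz); apply/negP.
pose V : set C := [set w | forall r, in_square r w -> r \in S].
have cover (w : C) : exists r, in_square r w.
  have [i wi] := strip_exists (lat_re w); have [j wj] := strip_exists (lat_im w).
  by exists (i, j).
have [M SM] := sub_box S.
apply: (@fullU V (`|complex.Re p0| + `|complex.Im p0| + 2 * (eps * (M%:R + 1)))) => //.
- apply/open_cmodP => w wV; have [e e0 we] := in_square_near w.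
  by exists e => // v ve r /(we _ _ ve)/wV.
- move=> w wV; have [[i j] [/= wi wj]] := cover w.
  have := SM _ (wV (i, j) (conj wi wj)); rewrite mem_box !mem_range => /andP[iM jM].
  have bnd (x y : R) (k : int) : strip k ((x - y) / eps) -> - M%:Z <= k <= M%:Z ->
      `|x| <= `|y| + eps * (M%:R + 1).
    move=> /andP[]; rewrite ler_pdivlMr // ler_pdivrMr // => k1 k2.
    rewrite -!(ler_int R) intrN -!pmulrn => /andP[k3 k4].
    rewrite -[x in `|x|](subrK y) addrC (le_trans (ler_normD _ _)) // lerD2l.
    by rewrite ler_norml; apply/andP; split; nra.
  rewrite (le_trans (ler_cmod _)) //.
  by have := bnd _ _ _ wi iM; have := bnd _ _ _ wj jM; lra.
- move=> w /closure_cmodP cw /existsNP[r /not_implyP[rw rS]].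
  have [e e0 we] := in_square_near w; have [v vV vw] := cw e e0.
  have [s sv] := cover v.
  apply: (bounds_frontier bS (vV _ sv) _ (we _ _ vw sv) rw).
  exact/negP.
Qed.

Lemma ldeform_insert2 K x a b c d y : convex K -> K `<=` U ->
  K (lat a) -> K (lat b) -> K (lat c) -> K (lat d) ->
  lvalid (x ++ a :: b :: y) ->
  ldeform (x ++ a :: b :: y) (x ++ [:: a; c; d] ++ b :: y).
Proof.
move=> cK KU Ka Kb Kc Kd; rewrite /lvalid /ldeform !map_cat /= => va.
have d1 : deform U p0 (map lat x ++ lat a :: lat b :: map lat y)
    (map lat x ++ lat a :: lat c :: lat b :: map lat y).
  apply: deform_insert => //=; exists K => // z.
  by rewrite !inE => /or3P[]/eqP->.
apply: (deform_trans d1); rewrite -!(cat_rcons (lat a)).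
apply: deform_insert; first by rewrite cat_rcons; exact: deform_valid d1 va.
by exists K => // z; rewrite !inE => /or3P[]/eqP->.
Qed.

Lemma square_corners i j : [/\ in_square (i, j) (lat (i, j)),
  in_square (i, j) (lat (i + 1, j)), in_square (i, j) (lat (i, j + 1)) &
  in_square (i, j) (lat (i + 1, j + 1))].
Proof.
by split; split; rewrite /= ?lat_reE ?lat_imE /strip /= ?intrD ?mulr1z;
  rewrite ?lexx ?lerDl ?ler01.
Qed.

(** [S] contains every square that edges of [X] can enclose, and its size decreases. If a region
    bounded by [X] contains the topmost square of [S], this square lies in [U], and the loop can
    trade its top edge for the three other sides. The new edge set [X'] can no longer enclose the
    square. If there is no such region, the square is simply dropped from [S]. *)
Lemma ldeform_closed n (S : seq (int * int)) (X : rel (int * int)) u p :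
  (size S <= n)%N -> subrel X edge -> symmetric X ->
  (forall S', bounds X S' -> {subset S' <= S}) ->
  path X u p -> last u p = u -> lvalid (u :: p) -> ldeform (u :: p) [:: u].
Proof.
elim: n S X p => [|n IH] S X p Sn Xe Xsym XS up pu va.
  have := @ldeform_contract X (size p) [::] u p [::]; rewrite /= cats0.
  apply=> //; first by move=> a b /Xe/andP[].
  move=> S' /XS; case: S Sn {XS} => // _; case: S' => // q S' /(_ q).
  by rewrite inE eqxx => /(_ isT).
have [S0|S0] := eqVneq S [::]; first by apply: (IH S X p) => //; rewrite S0.
have [[i j] qS qtop] := topmost S0; pose S2 := [seq r <- S | r != (i, j)].
have S2n : (size S2 <= n)%N.
  rewrite -ltnS (leq_trans _ Sn) // /S2 size_filter -(count_predC (pred1 (i, j)) S).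
  by rewrite -addn1 addnC leq_add2r -has_count has_pred1.
have above : (i, j + 1) \notin S.
  by apply/negP => /qtop /=; rewrite gerDl.
have [[S1 [bS1 qS1]]|noS1] :=
    pselect (exists S1, bounds X S1 /\ (i, j) \in S1); last first.
  apply: (IH S2 X p) => // S' bS' r rS'; rewrite mem_filter (XS _ bS' _ rS') andbT.
  by apply/eqP => rq; apply: noS1; exists S'; rewrite -rq.
have QU : in_square (i, j) `<=` U.
  apply: (@bounds_filled S1) => // k l; have [h1 h2] := bS1 k l.
  by split => [/h1/Xe|/h2/Xe].
have [cD cC cA cB] := square_corners i j.
pose A := (i, j + 1); pose B := (i + 1, j + 1).
pose D := (i, j); pose E := (i + 1, j).
pose X' : rel (int * int) := fun a b => [|| X a b && ~~ same_edge A B a b,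
  same_edge D A a b, same_edge D E a b | same_edge E B a b].
pose ins a b := if (a == A) && (b == B) then [:: D; E]
  else if (a == B) && (b == A) then [:: E; D] else [::].
have X'e : subrel X' edge.
  have sq a b : adj a b -> in_square (i, j) (lat a) -> in_square (i, j) (lat b) -> edge a b.
    move=> ab qa qb; rewrite /edge ab; apply/asboolP; exists (in_square (i, j)).
      by split=> //; exact: square_convex.
    by move=> z; rewrite !inE => /orP[]/eqP->.
  move=> a b /or4P[/andP[/Xe//]| | |] /orP[]/andP[/eqP-> /eqP->];
    by apply: sq => //; rewrite /adj /=; lia.
have X'sym : symmetric X'.
  have ss a b c d : same_edge a b c d = same_edge a b d c.
    by rewrite /same_edge orbC; congr (_ || _); rewrite andbC.
  by move=> a b; rewrite /X' Xsym; congr [|| _ && ~~ _, _, _ | _]; exact: ss.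
have d : ldeform (u :: p) (u :: subdiv ins u p).
  apply: (@ldeform_subdiv _ X [::]) => // a b x y _ vab; rewrite /ins.
  case: ifP => [/andP[/eqP aE /eqP bE]|_]; last case: ifP => [/andP[/eqP aE /eqP bE]|_].
  - rewrite aE bE in vab *; apply: ldeform_insert2 QU _ _ _ _ vab => //.
    exact: square_convex.
  - rewrite aE bE in vab *; apply: ldeform_insert2 QU _ _ _ _ vab => //.
    exact: square_convex.
  - exact: deform_refl.
apply: (deform_trans d); apply: (IH S2 X') => //.
- move=> S' bS' r rS'.
  (* The edges added in [X'] are sides of the square (i, j), which belongs to [S1]; such a side is
     either inside the union or already part of the boundary of [S1]. *)
  have bSS : bounds X (S' ++ S1).
    move=> k l; have [v1 h1] := bS1 k l; have [v2 h2] := bS' k l.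
    rewrite !mem_cat; split.
      move: v1 v2; case: (boolP ((k, l) \in S1)) => k1;
        case: (boolP ((k - 1, l) \in S1)) => k2; rewrite ?orbT ?orbF //=; try by auto.
      move=> _ h /h /or4P[/andP[]//| | |].
      + by move=> /same_edge_vv kl; rewrite kl qS1 in k1.
      + by rewrite same_edge_hv.
      + by move=> /same_edge_vv [ki lj]; rewrite ki lj addrK qS1 in k2.
    move: h1 h2; case: (boolP ((k, l) \in S1)) => k1;
      case: (boolP ((k, l - 1) \in S1)) => k2; rewrite ?orbT ?orbF //=; try by auto.
    move=> _ h /h /or4P[/andP[]//| | |]; rewrite ?same_edge_vh //.
    by move=> /same_edge_hh kl; rewrite kl qS1 in k1.
  have SS := XS _ bSS; rewrite mem_filter SS ?mem_cat ?rS' // andbT.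
  (* If [S'] contained (i, j), which has no square of [S] above it, the top edge would be on the
     boundary of [S']; but [X'] has lost that edge. *)
  apply/eqP => rq; rewrite rq in rS'.
  have aS' : (i, j + 1) \notin S'.
    by apply: contra above => aS; apply: SS; rewrite mem_cat aS.
  have := (bS' i (j + 1)).2; rewrite addrK rS' (negbTE aS') /= => /(_ isT).
  rewrite /X' !same_edge_vh orbF {1}/same_edge !eqxx /= andbF /=.
  by move=> /same_edge_hh [/eqP]; rewrite -subr_eq0 addrC addKr.
- apply: path_subdiv up => a b Xab; rewrite /ins.
  have XD : X' A D /\ X' D A by rewrite /X' /same_edge !eqxx /= !orbT.
  have XE : X' D E /\ X' E D by rewrite /X' /same_edge !eqxx /= !orbT.
  have XB : X' E B /\ X' B E by rewrite /X' /same_edge !eqxx /= !orbT.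
  case: ifP => [/andP[/eqP-> /eqP->]|h1] /=.
    by rewrite XD.1 XE.1 XB.1.
  case: ifP => [/andP[/eqP-> /eqP->]|h2] /=; first by rewrite XD.2 XE.2 XB.2.
  by rewrite andbT /X' Xab /same_edge h1 h2.
- by rewrite last_subdiv.
- exact: deform_valid d va.
Qed.

Lemma ldeform_loop u p : path edge u p -> last u p = u -> lvalid (u :: p) ->
  ldeform (u :: p) [:: u].
Proof.
move=> up pu va; have [M sM] := sub_box (u :: p).
pose X : rel (int * int) := fun a b => [&& edge a b, a \in box M & b \in box M].
apply: (@ldeform_closed _ (box M) X _ _ (leqnn _)) => //.
- by move=> a b /andP[].
- by move=> a b; rewrite /X edge_sym [(a \in _) && _]andbC.
- by move=> S'; apply: bounds_box => a b /and3P[].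
- elim: (p) (u) up sM => //= v p' IH u' /andP[uv vp] sM.
  rewrite {1}/X uv !sM ?inE ?eqxx ?orbT //=; apply: IH => // a ap.
  by apply: sM; rewrite inE ap orbT.
Qed.

End LatticeDeformations.

(** * From lattice loops to continuous loops *)

Section SimplyConnected.
Context {R : realType}.
Local Notation C := (Cplane R).
Implicit Types U : set C.

Lemma clip_lip (x y : R) : `|clip x - clip y| <= `|x - y|.
Proof.
wlog xy : x y / x <= y => [h|].
  have /orP[/h//|/h] := le_total x y.
  by rewrite (distrC (clip x)) (distrC x).
have mono : clip x <= clip y.
  by rewrite /clip le_min2 // le_max2.
rewrite !ler0_norm ?subr_le0 // !opprB.
have [y0|y0] := lerP y 0; first by rewrite !clip_le0 ?(le_trans xy) // subrr subr_ge0.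
have [x1|x1] := lerP 1 x; first by rewrite !clip_ge1 ?(le_trans x1) // subrr subr_ge0.
have [x0|x0] := lerP x 0; have [y1|y1] := lerP 1 y.
- by rewrite (clip_le0 x0) (clip_ge1 y1); lra.
- by rewrite (clip_le0 x0) clip_id ?(ltW y0) ?(ltW y1) //; lra.
- by rewrite (clip_ge1 y1) clip_id ?(ltW x0) ?(ltW x1) //; lra.
- by rewrite !clip_id ?(ltW x0) ?(ltW x1) ?(ltW y0) ?(ltW y1).
Qed.

Lemma clip_idem (x : R) : clip (clip x) = clip x.
Proof. by rewrite clip_id // clip_itv. Qed.

Lemma continuous_clip (g : R -> C) :
  {within `[0, 1], continuous g} -> continuous (g \o clip).
Proof.
move=> cg x; apply/continuous_cmodP => e e0.
have c01 : `[0, 1]%classic (clip x) by rewrite /= in_itv /= clip_itv.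
have h : \forall y \near clip x, `[0, 1]%classic y -> cmod (g y - g (clip x)) < e.
  apply: ((subspace_continuousP _ _).1 cg _ c01 [set w | cmod (w - g (clip x)) < e]).
  by apply/nbhs_cmodP; exists e.
have hx : \forall y \near x, `[0, 1]%classic (clip y) ->
    cmod (g (clip y) - g (clip x)) < e := clip_continuous h.
by apply: filterS hx => y; apply; rewrite /= in_itv /= clip_itv.
Qed.

(** Compactness of [0, 1] in its near-covering form: a property that holds eventually, locally in
    [x], holds eventually for all [x] at once. *)
Lemma uniform_itv (P : nat -> R -> Prop) :
  (forall x : R, \forall x' \near x & n \near \oo, P n x') ->
  exists n0, forall n x, (n0 <= n)%N -> 0 <= x <= 1 -> P n x.
Proof.
move=> Px; have /compact_near_coveringP := @segment_compact R 0 1.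
move=> /(_ nat \oo P _ (fun x _ => Px x))[n0 _ h].
by exists n0 => n x nn x01; apply: (h n nn); rewrite /= in_itv.
Qed.

Lemma loop_scale U (G : R -> C) : open U -> continuous G -> (forall t, U (G t)) ->
  exists2 r : R, 0 < r & forall x w, 0 <= x <= 1 -> cmod (w - G x) < r -> U w.
Proof.
move=> /open_cmodP oU cG GU.
have [|n0 h] := @uniform_itv (fun n x => forall w, cmod (w - G x) < n.+1%:R^-1 -> U w).
  move=> x; have [e e0 eU] := oU _ (GU x).
  have e2 : 0 < e / 2 by rewrite divr_gt0.
  have h1 : \forall x' \near x, cmod (G x' - G x) < e / 2.
    exact: (continuous_cmodP G x).1 (cG x) _ e2.
  have h2 : \forall n \near \oo, n.+1%:R^-1 < e / 2 :> R.
    exact: near_infty_natSinv_lt (PosNum e2).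
  exists ([set x' | cmod (G x' - G x) < e / 2], [set n | n.+1%:R^-1 < e / 2]) => //.
  move=> [x' n] [/= h3 h4] w wx'; apply: eU.
  by rewrite (le_lt_trans (ler_cmodBD (G x') _ _)) // (splitr e) ltrD // (lt_trans wx').
exists (n0.+1%:R^-1); first by rewrite invr_gt0 ltr0n.
by move=> x w x01; apply: h.
Qed.

Lemma loop_uniform (G : R -> C) (e : R) : continuous G -> 0 < e ->
  exists n, forall x y, 0 <= x <= 1 -> `|y - x| <= n.+1%:R^-1 -> cmod (G y - G x) < e.
Proof.
move=> cG e0; have [|n0 h] := @uniform_itv (fun n x =>
    forall y, `|y - x| <= n.+1%:R^-1 -> cmod (G y - G x) < e).
  move=> x; have e2 : 0 < e / 2 by rewrite divr_gt0.
  have /nbhs_ballP[d /= d0 dG] := (continuous_cmodP G x).1 (cG x) _ e2.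
  have d2 : 0 < d / 2 by rewrite divr_gt0.
  have h2 : \forall n \near \oo, n.+1%:R^-1 < d / 2 :> R.
    exact: near_infty_natSinv_lt (PosNum d2).
  exists (ball x (d / 2), [set n | n.+1%:R^-1 < d / 2]).
    by split => //; exact: nbhsx_ballx.
  move=> [x' n] [/=]; rewrite /ball /= => h3 h4 y yx'.
  rewrite (le_lt_trans (ler_cmodBD (G x) _ _)) // (splitr e) ltrD //.
    apply: dG; rewrite /ball /= (le_lt_trans (ler_distD x' _ _)) // (splitr d) ltrD //.
    by rewrite distrC (le_lt_trans yx').
  rewrite cmodB; apply: dG; rewrite /ball /= (lt_le_trans h3) //.
  by rewrite ler_pdivrMr // ler_peMr ?ltW // ltr1n.
by exists n0 => x y x01; apply: h.
Qed.

Lemma convex_ball (z : C) (r : R) : convex [set w : C | cmod (w - z) < r].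
Proof.
move=> x y t /andP[t0 t1] /= xr yr.
have -> : x + t%:C * (y - x) - z = (1 - t)%:C * (x - z) + t%:C * (y - z).
  by rewrite rmorphB rmorph1; ring.
rewrite (le_lt_trans (ler_cmodD _ _)) // !cmodM !cmodR ger0_norm ?subr_ge0 //.
rewrite (ger0_norm t0); have [->|tn0] := eqVneq t 0; first lra.
have tp : 0 < t by rewrite lt_def tn0.
have := ltr_pM2l tp (cmod (y - z)) r; rewrite yr => /idP h.
have : (1 - t) * cmod (x - z) <= (1 - t) * r by rewrite ler_wpM2l ?subr_ge0 // ltW.
by move: h; lra.
Qed.

(** Rounding may send consecutive points of a loop to one lattice point, which [adj] does not
    allow. *)
Fixpoint squeeze (u : int * int) p :=
  if p is v :: p' then if u == v then squeeze u p' else v :: squeeze v p'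
  else [::].

Lemma path_squeeze (e : rel (int * int)) u p :
  path (fun a b => (a == b) || e a b) u p -> path e u (squeeze u p).
Proof.
elim: p u => //= v p IH u; have [->|uv] := eqVneq u v; first by move/IH.
by rewrite /= => /andP[-> /IH].
Qed.

Lemma last_squeeze u p : last u (squeeze u p) = last u p.
Proof. by elim: p u => //= v p IH u; have [->|] := eqVneq u v => /=. Qed.

Lemma ldeform_squeeze U p0 eps x u p : lvalid U p0 eps (x ++ u :: p) ->
  ldeform U p0 eps (x ++ u :: p) (x ++ u :: squeeze u p).
Proof.
elim: p x u => [|v p IH] x u /=; first by move=> _; exact: deform_refl.
move=> va; have [uv|uv] := eqVneq u v; last first.
  by have := IH (rcons x u) v; rewrite !cat_rcons; apply.
rewrite -uv in va *; have d : ldeform U p0 eps (x ++ u :: u :: p) (x ++ u :: p).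
  move: va; rewrite /lvalid /ldeform !map_cat /= => va.
  apply: deform_delete => //; have [_ [+ _]] := (valid_path _ _ _).1 va.
  rewrite rcons_cat cat_path /= => /and4P[_ _ _ pp].
  have /asboolP : joined U (lat p0 eps u) (head p0 (map (lat p0 eps) p)).
    by case: (p) pp => [|y p'] /= /andP[].
  by apply: cohull_sub => w; rewrite !inE => /or3P[]->; rewrite ?orbT.
apply: (deform_trans d); apply: IH; exact: deform_valid d va.
Qed.

Lemma full_null_homotopic U (g : R -> C) : open U -> full U ->
  {within `[0, 1], continuous g} -> g @` `[0, 1] `<=` U -> g 0 = g 1 ->
  null_homotopic U g.
Proof.
move=> oU fU cg gU g01; pose G := g \o clip.
have cG : continuous G := continuous_clip cg.
have GU t : U (G t) by apply: gU; exists (clip t); rewrite //= in_itv /= clip_itv.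
have clip0 : clip (0 : R) = 0 by rewrite clip_le0.
have Gg t : t \in `[0, 1] -> G t = g t.
  by rewrite in_itv /= => t01; rewrite /G /= clip_id.
suff: null_homotopic U G.
  have G0 : G 0 = g 0 by rewrite /G /= clip0.
  move=> [h [h1 h2 h3 h4 h5]]; exists h; rewrite -G0; split=> //.
  by move=> t t01; rewrite h3 // Gg.
have G0 t : t <= 0 -> G t = G 0 by move=> t0; rewrite /G /= clip0 clip_le0.
have G1 t : 1 <= t -> G t = G 0 by move=> t1; rewrite /G /= clip0 clip_ge1.
have [r r0 rU] := loop_scale oU cG GU.
(* Rounding to the lattice costs at most 2 [eps], passing to the next point less than [eps], and an
   inserted corner at most [eps] more; everything near [c i] thus stays well inside the ball of
   radius [r] = 10 [eps], which lies in [U]. *)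
pose eps := r / 10; have eps0 : 0 < eps by rewrite divr_gt0.
have [m mG] := loop_uniform cG eps0; pose n := m.+1.
have nR : 0 < n%:R :> R by rewrite ltr0n.
pose c i : C := G (i%:R / n%:R); set p0 := G 0.
have cp i : (n <= i)%N -> c i = p0.
  by move=> ni; rewrite /c G1 // ler_pdivlMr // mul1r ler_nat.
have near_c i t : i%:R <= t * n%:R <= i%:R + 1 -> cmod (G t - c i) < eps.
  move=> /andP[ti it]; rewrite /c /G /= -(clip_idem t) -(clip_idem (_ / _)).
  apply: mG; first exact: clip_itv.
  rewrite (le_trans (clip_lip _ _)) // -/n ger0_norm.
    by rewrite -(ler_pM2r nR) mulrBl divfK ?mulVf ?gt_eqF //; lra.
  by rewrite subr_ge0 ler_pdivrMr.
have ballU i (w : C) : cmod (w - c i) < r -> U w.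
  rewrite /c /G /= -(clip_idem (_ / _)); apply: rU; exact: clip_itv.
have Up0 : U p0 := GU 0.
apply: (@null_homotopic_deform _ U G n) => //.
  move=> i; exists [set w : C | cmod (w - c i) < r].
    by split; [exact: convex_ball|move=> w /=; exact: ballU].
  move=> t /near_c /= /lt_trans; apply; rewrite /eps ltr_pdivrMr // ltr_pMr //.
  by rewrite ltr1n.
rewrite -/p0; set a := map _ _.
have aE i : nth p0 a i = c i.
  have [ni|ni] := ltnP i n.+1.
    by rewrite (nth_map 0%N) ?size_iota // nth_iota.
  by rewrite nth_default ?size_map ?size_iota // cp // ltnW.
pose L := @lat R p0 eps.
pose rnd (z : C) := (Num.floor (lat_re p0 eps z), Num.floor (lat_im p0 eps z)).
have rndL z : cmod (L (rnd z) - z) <= 2 * eps.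
  rewrite (le_trans (ler_cmod _)) // mulr_natl mulr2n.
  have fl (x y : R) : `|y + eps * (Num.floor ((x - y) / eps))%:~R - x| <= eps.
    have /andP[] := floor_ler ((x - y) / eps); rewrite ler_pdivlMr // ltr_pdivrMr //.
    by move=> *; rewrite ler_norml; apply/andP; split; nra.
  by rewrite lerD //; case: (z) (p0) => ? ? [? ?]; exact: fl.
have rnd0 : rnd p0 = (0, 0).
  by rewrite /rnd /lat_re /lat_im !subrr !mul0r floor0.
have L0 : L (0, 0) = p0.
  by rewrite /L /lat /= !mulr0 !addr0; case: (p0).
pose w := [seq rnd (c i) | i <- iota 0 n.+1].
have wE i : nth p0 (map L w) i = L (rnd (c i)).
  have [ni|ni] := ltnP i n.+1.
    by rewrite -map_comp (nth_map 0%N) ?size_iota // nth_iota.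
  by rewrite nth_default ?size_map ?size_iota // cp ?rnd0 ?L0 // ltnW.
have cc i : cmod (c i.+1 - c i) < eps.
  by apply: near_c; rewrite divfK ?gt_eqF // -natr1 lexx lerDl ler01.
have aw : step U p0 a (map L w).
  have c0 : c 0 = p0 by rewrite /c mul0r.
  split; rewrite ?aE ?wE ?c0 ?rnd0 ?L0 // => i; rewrite !aE !wE.
  exists [set w : C | cmod (w - c i) < r].
    by split; [exact: convex_ball|move=> z /=; exact: ballU].
  have := cc i; have := rndL (c i); have := rndL (c i.+1) => l1 l2 l3.
  have := ler_cmodBD (c i.+1) (L (rnd (c i.+1))) (c i) => l4.
  have r10 : r = 10 * eps by rewrite /eps mulrC divfK.
  by move=> z; rewrite !inE => /or4P[] /eqP-> /=; rewrite ?subrr ?cmod0 //; lra.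
apply: (deform_step aw); have vw := step_valid aw.
(* Consecutive rounded points may differ in both coordinates; the corner replaces the diagonal by
   two lattice edges. *)
pose ins (u v : int * int) := [:: (v.1, u.2)].
pose near (u v : int * int) := `|u.1 - v.1| <= 1 /\ `|u.2 - v.2| <= 1 /\
  exists2 i, cmod (L u - c i) < 4 * eps & cmod (L v - c i) < 4 * eps.
pose nearb : rel (int * int) := fun u v => `[< near u v >].
have Rw : path nearb (rnd (c 0)) [seq rnd (c i) | i <- iota 1 n].
  have h i : nearb (rnd (c i)) (rnd (c i.+1)).
    have fl (x y : R) : `|y - x| < 1 -> `|Num.floor x - Num.floor y| <= 1 :> int.
      have /andP[x1 x2] := floor_ler x; have /andP[y1 y2] := floor_ler y.
      rewrite ltr_distl -(ler_int R) => /andP[xy1 xy2].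
      have h1 : ((Num.floor x)%:~R : R) < (Num.floor y + 2)%:~R.
        by rewrite intrD; lra.
      have h2 : ((Num.floor y)%:~R : R) < (Num.floor x + 2)%:~R.
        by rewrite intrD; lra.
      by move: h1 h2; rewrite !ltr_int ler_int; lia.
    have sm (x y z : R) : `|x - y| <= cmod (c i.+1 - c i) ->
        `|(x - z) / eps - (y - z) / eps| < 1.
      move=> xy; rewrite -mulrBl normrM [`|eps^-1|]gtr0_norm ?invr_gt0 //.
      rewrite ltr_pdivrMr // mul1r opprB addrA subrK (le_lt_trans xy) //; exact: cc.
    apply/asboolP; split; [|split].
    - apply: fl; apply: sm; rewrite (le_trans _ (ler_Re _)) //.
      by case: (c i) (c i.+1) => ? ? [].
    - apply: fl; apply: sm; rewrite (le_trans _ (ler_Im _)) //.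
      by case: (c i) (c i.+1) => ? ? [].
    - have := cc i; have := rndL (c i); have := rndL (c i.+1) => l1 l2 l3.
      have := ler_cmodBD (c i.+1) (L (rnd (c i.+1))) (c i) => l4.
      by exists i; lra.
  suff: forall k j, path nearb (rnd (c j)) [seq rnd (c i) | i <- iota j.+1 k] by apply.
  by elim=> //= k IH j; rewrite h IH.
have r10 : r = 10 * eps by rewrite /eps mulrC divfK.
have corner u v : near u v -> exists i, [/\ cmod (L u - c i) < r,
    cmod (L (v.1, u.2) - c i) < r & cmod (L v - c i) < r].
  case=> uv1 [uv2 [i ui vi]]; exists i; split; try by lra.
  have h : cmod (L (v.1, u.2) - L u) <= eps.
    have -> : L (v.1, u.2) - L u = (eps * (v.1 - u.1)%:~R)%:C.
      by rewrite /L /lat intrB; simpc; congr (_ +i* _); rewrite /=; ring.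
    rewrite cmodR normrM gtr0_norm //; apply: ler_piMr; first exact: ltW.
    rewrite -intr_norm distrC.
    by move: uv1; rewrite -(ler_int R) mulr1z.
  by have := ler_cmodBD (L u) (L (v.1, u.2)) (c i); lra.
have cohullK i s : (forall z, z \in s -> cmod (z - c i) < r) -> cohull U s.
  move=> sK; exists [set w : C | cmod (w - c i) < r] => //.
  by split; [exact: convex_ball|move=> z /=; exact: ballU].
pose p := subdiv ins (rnd (c 0)) [seq rnd (c i) | i <- iota 1 n].
have d1 : ldeform U p0 eps w (rnd (c 0) :: p).
  apply: (@ldeform_subdiv _ _ _ _ ins nearb [::]) => // u v x y.
  move=> /asboolP/corner[i [ui ci vi]]; rewrite /lvalid /ldeform !map_cat /= => va.
  apply: deform_insert => //; apply: (cohullK i) => z.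
  by rewrite !inE => /or3P[]/eqP->.
have v1 := deform_valid d1 vw.
have d2 := @ldeform_squeeze _ _ _ [::] _ _ v1.
have v2 := deform_valid d2 v1.
have c0 : rnd (c 0) = (0, 0) by rewrite /c mul0r rnd0.
have cn : last (rnd (c 0)) (squeeze (rnd (c 0)) p) = (0, 0).
  rewrite last_squeeze last_subdiv (last_map (fun i => rnd (c i)) _ 0%N).
  by rewrite (last_nth 0%N) size_iota -/(iota 0 n.+1) nth_iota // cp // rnd0.
have up : path (edge U p0 eps) (rnd (c 0)) (squeeze (rnd (c 0)) p).
  apply: path_squeeze; apply: path_subdiv Rw => u v /asboolP uv.
  have [i [ui ci vi]] := corner _ _ uv; case: uv => uv1 [uv2 _].
  have jn v1' v2' : cmod (L v1' - c i) < r -> cmod (L v2' - c i) < r ->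
      joined U (L v1') (L v2').
    move=> ai bi; apply/asboolP; apply: (cohullK i) => z.
    by rewrite !inE => /orP[]/eqP->.
  rewrite /= /edge !jn // !andbT /adj.
  case: u v uv1 uv2 {ui ci vi} => [u1 u2] [w1 w2] /=; rewrite !xpair_eqE.
  by move=> *; apply/andP; split; lia.
have d3 := @ldeform_loop _ _ _ _ eps0 fU _ _ up (etrans cn (esym c0)) v2.
apply: (deform_trans d1); apply: (deform_trans d2).
apply: (deform_trans d3).
apply/deform1/step_eq_nth; first exact: deform_valid d3 v2.
by move=> i; rewrite c0 /= -/L L0; case: i => //= i; rewrite nth_nil.
Qed.

Lemma path_connected_open U : open U -> connected U -> U !=set0 ->
  path_connected R U.
Proof.
move=> oU cU U0; split=> // x y Ux Uy.
pose reach (z : C) := exists g : R -> C, [/\ continuous g, forall t, U (g t),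
  forall t, t <= 0 -> g t = x & forall t, 1 <= t -> g t = z].
have ext (z w : C) : reach z -> (forall t, 0 <= t <= 1 -> U (z + t%:C * (w - z))) -> reach w.
  move=> [g [cg gU g0 g1]] zw.
  (* The old path is run at double speed up to time 1/2, then the segment; each summand is constant
     while the other one moves. *)
  exists (fun t => g (clip (2 * t)) + (clip (2 * t - 1))%:C * (w - z)); split.
  - move=> t; apply: (@continuousDC R R (fun t => g (clip (2 * t)))
        (fun t => (clip (2 * t - 1))%:C * (w - z))).
      apply: (@continuous_comp R R C (fun t => clip (2 * t)) g); last exact: cg.
      apply: (@continuous_comp R R R (fun t => 2 * t) clip); last exact: clip_continuous.
      by apply: cvgM; [exact: cvg_cst|exact: cvg_id].
    apply: (@continuousMC R R (fun t => (clip (2 * t - 1))%:C) (cst (w - z))); last first.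
      exact: cst_continuous.
    apply: (@continuous_complex R R (fun t => clip (2 * t - 1)) (cst 0)); last first.
      exact: cst_continuous.
    apply: (@continuous_comp R R R (fun t => 2 * t - 1) clip); last exact: clip_continuous.
    apply: cvgB; last exact: cvg_cst.
    by apply: cvgM; [exact: cvg_cst|exact: cvg_id].
  - move=> t; have [t1|t1] := lerP (2 * t) 1.
      by rewrite (@clip_le0 _ (2 * t - 1)) ?mul0r ?addr0 // subr_le0.
    by rewrite (clip_ge1 (ltW t1)) g1 //; apply: zw; exact: clip_itv.
  - move=> t t0; rewrite clip_le0 ?g0 // 1?clip_le0 ?mul0r ?addr0 //; lra.
  - by move=> t t1; rewrite !clip_ge1 ?g1 // ?mul1r 1?addrC ?subrK //; lra.
have ballU (z : C) : U z -> exists2 e : R, 0 < e & forall w : C, cmod (w - z) < e ->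
    forall t, 0 <= t <= 1 -> U (z + t%:C * (w - z)) /\ U (w + t%:C * (z - w)).
  move=> Uz; have [e e0 zU] := (open_cmodP U).1 oU _ Uz; exists e => // w wz t t01.
  have zz : cmod (z - z) < e by rewrite subrr cmod0.
  by split; apply: zU; apply: (@convex_ball z e).
have oA : open [set z | U z /\ reach z].
  apply/open_cmodP => z [Uz zr]; have [e e0 ze] := ballU z Uz; exists e => // w wz.
  have seg t := ze w wz t; split; last by apply: ext zr _ => t t01; case: (seg t t01).
  by have [|] := seg 0; [rewrite lexx ler01|rewrite mul0r addr0 mul0r addr0].
suff [_ [g [cg gU g0 g1]]] : [set z | U z /\ reach z] y.
  exists g; split; [exact: continuous_subspaceT|by move=> _ [t _ <-]|exact: g0|exact: g1].
apply: (connected_sub_open cU oA) Uy.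
- move=> z Uz /closure_cmodP cz; split => //; have [e e0 ze] := ballU z Uz.
  have [w [Uw wr] wz] := cz e e0; apply: ext wr _ => t t01.
  by have [] := ze w wz t t01.
- exists x; split => //; split => //; exists (cst x); split=> //.
  exact: cst_continuous.
Qed.

Lemma full_simply_connected U : open U -> connected U -> U !=set0 -> full U ->
  simply_connected R U.
Proof.
move=> oU cU U0 fU; split; first exact: path_connected_open.
by move=> g cg gU g01; exact: full_null_homotopic.
Qed.

End SimplyConnected.

(** * Open mapping theorem for rational functions *)

Section OpenMapping.
Context {R : realType}.
Local Notation C := (Cplane R).
Implicit Types (p n m : {poly R[i]}) (z w : R[i]) (K : set C).

(** Divided by the constant coefficient, the coefficients are, up to sign, elementary symmetric
    functions of the inverses of the roots, which have modulus at most 1/rho. *)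
Lemma coef_prod_bound (rho : R) (s : seq R[i]) i : 0 < rho ->
  (forall z, z \in s -> rho <= cmod z) ->
  cmod (\prod_(z <- s) ('X - z%:P))`_i <=
  cmod (\prod_(z <- s) ('X - z%:P))`_0 * (1 + rho^-1) ^+ size s.
Proof.
move=> rho0; elim: s i => [|z s IH] i sr.
  rewrite big_nil expr0 mulr1 !coef1 /=.
  by case: i => [|i] //=; rewrite cmod0 cmod1.
have {}IH j := IH j (fun w ws => sr w (@mem_behead _ (z :: s) w ws)).
have zr := sr z (mem_head z s).
rewrite big_cons; set q := \prod_(_ <- s) _ in IH *.
set B := (1 + rho^-1) ^+ size s in IH *.
have cq0 : 0 <= cmod q`_0 := cmod_ge0 _.
have B0 : 0 <= B by rewrite exprn_ge0 // addr_ge0 // invr_ge0 ltW.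
rewrite mulrBl !coefB coefXM coefCM coefXM coefCM /= sub0r cmodN cmodM exprS.
have h1 : cmod (if i == 0%N then 0 else q`_i.-1) <= cmod q`_0 * B.
  by case: eqP => _; [rewrite cmod0 mulr_ge0|exact: IH].
have h2 : cmod (z * q`_i) <= cmod z * (cmod q`_0 * B).
  by rewrite cmodM ler_wpM2l ?cmod_ge0.
rewrite (le_trans (ler_cmodD _ _)) // cmodN (le_trans (lerD h1 h2)) //.
have -> : cmod z * cmod q`_0 * ((1 + rho^-1) * B) =
    cmod z * (cmod q`_0 * B) + (cmod z * rho^-1) * (cmod q`_0 * B) by ring.
rewrite addrC lerD2l ler_peMl ?mulr_ge0 // ler_pdivlMr // mul1r //.
Qed.

Lemma coef_bound (rho : R) p N i : 0 < rho -> (size p <= N)%N ->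
  (forall z, root p z -> rho <= cmod z) ->
  cmod p`_i <= cmod p`_0 * (1 + rho^-1) ^+ N.
Proof.
move=> rho0 pN pr; have [->|p0] := eqVneq p 0.
  by rewrite !coef0 cmod0 mul0r.
have [s ps] := closed_field_poly_normal p.
have lp : lead_coef p != 0 by rewrite lead_coef_eq0.
have sp : size p = (size s).+1 by rewrite ps size_scale // size_prod_XsubC.
have B1 : 1 <= 1 + rho^-1 by rewrite lerDl invr_ge0 ltW.
have sr z : z \in s -> rho <= cmod z.
  by move=> zs; apply: pr; rewrite ps rootZ // root_prod_XsubC.
have := coef_prod_bound i rho0 sr; rewrite ps !coefZ !cmodM -mulrA => h.
rewrite ler_wpM2l ?cmod_ge0 // (le_trans h) // ler_wpM2l ?cmod_ge0 //.
by apply: ler_weXn2l => //; rewrite -ltnS -sp ltnW.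
Qed.

(** At a zero of [m] the value is 0 by convention and not infinity, whence the hypotheses [m.[z] !=
    0] below. *)
Definition ratfun n m : C -> C := fun z => n.[z] / m.[z].

Lemma ratfun_continuous n m (z : C) : m.[z] != 0 -> {for z, continuous (ratfun n m)}.
Proof.
move=> mz; apply: (@continuousMC R C (fun z => n.[z]) (fun z => m.[z]^-1)).
  exact: horner_continuous.
apply: (@continuousVC R C (fun z => m.[z])) => //; exact: horner_continuous.
Qed.

(* The product of the roots of [n - w m], recentred at [z], is small when [w] is
   close to [n.[z] / m.[z]], so that one of the roots is close to [z]. *)
Lemma ratfun_open n m K (z : R[i]) : (forall c, n != c *: m) ->
  (forall z, K z -> m.[z] != 0) -> K° (z : C) -> (ratfun n m @` K)° (ratfun n m z).
Proof.
move=> nm mK Kz; have mz := mK _ (interior_subset Kz).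
have /nbhs_cmodP[rho rho0 rK] := Kz.
pose sh p := p \Po ('X + z%:P).
have sh0 p x : (sh p).[x] = p.[x + z] by rewrite horner_comp hornerD hornerX hornerC.
pose w0 : R[i] := ratfun n m z; pose P w := sh (n - w *: m).
have PE w i : (P w)`_i = (sh n)`_i - w * (sh m)`_i.
  by rewrite /P /sh comp_polyB comp_polyZ coefB coefZ.
have P0 w : (P w)`_0 = (w0 - w) * m.[z].
  by rewrite -horner_coef0 sh0 add0r hornerD hornerN hornerZ mulrBl /w0 /ratfun divfK.
have [k Pk] : exists k, (P w0)`_k != 0.
  apply/not_existsP => Pw0; have : P w0 = 0.
    by apply/polyP => i; rewrite coef0; apply/eqP/negPn/negP; exact: Pw0.
  move/(congr1 (fun p => p \Po ('X - z%:P))); rewrite /P /sh -comp_polyA.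
  have -> : ('X + z%:P) \Po ('X - z%:P) = 'X.
    by rewrite comp_polyD comp_polyX comp_polyC subrK.
  rewrite comp_polyXr comp_poly0.
  by move/eqP; rewrite subr_eq0; apply/negP; exact: nm.
pose N := maxn (size n) (size m); pose B := (1 + rho^-1) ^+ N.
have sPN w : (size (P w) <= N)%N.
  rewrite /P /sh size_comp_poly2 ?size_XaddC // (leq_trans (size_polyD _ _)) //.
  rewrite size_polyN geq_max leq_maxl /= (leq_trans (size_scale_leq _ _)) //.
  exact: leq_maxr.
have kap : 0 < cmod (P w0)`_k by rewrite cmod_gt0.
pose S := cmod (sh m)`_k + cmod m.[z] * B.
have B0 : 0 <= B by rewrite exprn_ge0 // addr_ge0 // invr_ge0 ltW.
have S0 : 0 <= S by rewrite addr_ge0 ?mulr_ge0 ?cmod_ge0.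
apply/nbhs_cmodP; exists (cmod (P w0)`_k / (S + 1)).
  by rewrite divr_gt0 // ltr_wpDl.
move=> w; rewrite -/w0 ltr_pdivlMr ?ltr_wpDl // => ww0.
have [[x Px xr]|] := pselect (exists2 x, root (P w) x & cmod x < rho).
  have Kx : K (x + z) by apply: rK; rewrite addrK.
  exists (x + z) => //; move: Px; rewrite /root sh0 hornerD hornerN hornerZ.
  by rewrite subr_eq0 => /eqP; rewrite /ratfun => ->; rewrite mulfK // mK.
move=> nx; have := @coef_bound rho (P w) N k rho0 (sPN w).
rewrite -/B P0 cmodM => h; have {}h : cmod (P w)`_k <= cmod (w0 - w) * cmod m.[z] * B.
  by apply: h => x Px; rewrite leNgt; apply/negP => xr; apply: nx; exists x.
have wE : (P w0)`_k = (P w)`_k + (w - w0) * (sh m)`_k by rewrite !PE; ring.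
have := ler_cmodD (P w)`_k ((w - w0) * (sh m)`_k); rewrite -wE cmodM => h2.
rewrite cmodB in h; rewrite /S in ww0; have := cmod_ge0 (w - w0).
by lra.
Qed.

Lemma frontier_ratfun n m K (w : C) : (forall c, n != c *: m) ->
  (forall z, K z -> m.[z] != 0) -> (ratfun n m @` K) w -> ~ (ratfun n m @` K)° w ->
  exists z, [/\ K z, ~ K° z & w = ratfun n m z].
Proof.
move=> nm mK [z Kz zw] nz; exists z; split; [exact: Kz| |exact: esym].
by move=> Kz'; apply: nz; rewrite -zw; exact: ratfun_open.
Qed.

Lemma compact_ratfun n m K : compact K -> (forall z, K z -> m.[z] != 0) ->
  compact (ratfun n m @` K).
Proof.
move=> cK mK; apply: continuous_compact => //.
apply/subspace_continuousP => z Kz.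
apply: cvg_within_filter; exact: ratfun_continuous (mK _ Kz).
Qed.

(* [E] starts at a value of [n / m] on [K], leads to infinity, and so leaves the
   compact image of [K] through its boundary. *)
Lemma ratfun_escape n m K (E : set C) (z0 : C) : (forall c, n != c *: m) ->
  compact K -> (forall z, K z -> m.[z] != 0) -> connected E ->
  (forall M : R, exists2 w : C, E w & M < cmod w) -> K z0 -> E (ratfun n m z0) ->
  exists z, [/\ K z, ~ K° z & E (ratfun n m z)].
Proof.
move=> nm cK mK cE Einf Kz0 Ez0; apply: contrapT => nex.
pose I := ratfun n m @` K; have cI : compact I := compact_ratfun cK mK.
have fr w : I w -> E w -> I° w.
  move=> Iw Ew; apply: contrapT => nI.
  by have [z [Kz Kz' wz]] := frontier_ratfun nm mK Iw nI; apply: nex; exists z; rewrite -wz.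
have [M IM] := compact_bounded_plane cI; have [w Ew] := Einf M.
have : I° w.
  apply: (connected_sub_open cE (open_interior I)) Ew.
    move=> v Ev cv; apply: fr => //; apply: (compact_closed_plane cI).
    by apply: closureS cv; exact: interior_subset.
  by exists (ratfun n m z0); split => //; apply: fr => //; exists z0.
by move/interior_subset/IM; rewrite leNgt => /negP.
Qed.

End OpenMapping.

(** * Immediate basins *)

Section Basins.
Context {R : realType}.
Local Notation C := (Cplane R).
Variables (n m : {poly R[i]}) (F : sphere R -> sphere R) (a : C) (del : R).
Local Notation f := (ratfun n m).
Hypothesis F_Some : forall z : C, F (Some z) = if m.[z] == 0 then None else Some (f z).
Hypothesis F_None : F None = None.
Hypothesis nm : forall c, n != c *: m.
Hypothesis del_gt0 : 0 < del.
Hypothesis attr : forall z : C, cmod (z - a) < del ->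
  m.[z] != 0 /\ cmod (f z - a) <= cmod (z - a) / 2.

Lemma iter_None k : iter k F None = None.
Proof. by elim: k => //= k ->. Qed.

Lemma basinP (G : sphere R -> sphere R) (z b : C) : basin G b z <->
  forall e : R, 0 < e -> exists N, forall k, (N <= k)%N ->
    exists2 w : C, iter k G (Some z) = Some w & cmod (w - b) < e.
Proof.
split=> [zb e e0|zb A].
  have : nbhs (Some b : sphere R) [set Some w | w in [set w : C | cmod (w - b) < e]].
    apply: one_point_compactification_some_nbhs.
    by apply/nbhs_cmodP; exists e.
  move=> /zb[N _ h]; exists N => k /h[w wb /esym wk]; by exists w.
move=> /nbhs_cmodP[e e0 eA]; have [N h] := zb e e0; exists N => // k /h[w wk wb].
by rewrite /= wk; exact: eA.
Qed.

(** Poles are excluded explicitly, because the conventional value of [f] there could belong to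
    [O]. *)
Definition pre (O : set C) : set C := [set z | m.[z] != 0 /\ O (f z)].
(** An increasing sequence of open sets that exhausts the basin, so that a compact part of the basin
    lies in a single one. *)
Definition trap k : set C := iter k pre [set z | cmod (z - a) < del].

Lemma open_pre O : open O -> open (pre O).
Proof.
move=> /open_cmodP oO; apply/open_cmodP => z [mz /oO[e e0 eO]].
apply/nbhs_cmodP; have cf := (continuous_cmodP f z).1 (ratfun_continuous mz) e e0.
have cm := (continuous_cmodP (fun z : C => m.[z] : C) z).1 (@horner_continuous _ m z).
have mz0 : 0 < cmod m.[z] by rewrite cmod_gt0.
near=> w; split; last by apply: eO; near: w; exact: cf.
apply/eqP => mw; suff: cmod (m.[w] - m.[z]) < cmod m.[z].
  by rewrite mw sub0r cmodN ltxx.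
by near: w; exact: cm.
Unshelve. all: by end_near. Qed.

Lemma trap_open k : open (trap k).
Proof. by elim: k => [|k IH]; [exact: open_ball_cmod|exact: open_pre]. Qed.

Lemma trap_succ k : trap k `<=` trap k.+1.
Proof.
elim: k => [z /= za|k IH z [mz /IH fz]]; last by split.
have [mz fz] := attr za; split=> //=; rewrite (le_lt_trans fz) //.
by rewrite (le_lt_trans _ za) // ler_piMr ?cmod_ge0 // invf_le1 ?ler1n.
Qed.

Lemma trap_le j k : (j <= k)%N -> trap j `<=` trap k.
Proof.
move=> /subnK <-; elim: (k - j)%N => // i IH z /IH; exact: trap_succ.
Qed.

Lemma basin_pole z : basin F a z -> m.[z] != 0.
Proof.
move=> /basinP/(_ 1 ltr01)[N h]; apply/eqP => mz.
have [w] := h N.+1 (leqnSn N).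
by rewrite iterSr F_Some mz eqxx iter_None.
Qed.

Lemma basin_pre z : basin F a z <-> pre (basin F a) z.
Proof.
split=> [zb|[mz /basinP fb]].
  have mz := basin_pole zb; split=> //; apply/basinP => e e0.
  have [N h] := (basinP F z a).1 zb e e0; exists N => k Nk.
  have [w] := h k.+1 (leqW Nk); rewrite iterSr F_Some (negbTE mz) => wk wa.
  by exists w.
apply/basinP => e /fb[N h]; exists N.+1 => -[|k] // Nk.
have [w wk wa] := h k Nk; exists w => //.
by rewrite iterSr F_Some (negbTE mz).
Qed.

Lemma ball_basin z : cmod (z - a) < del -> basin F a z.
Proof.
move=> za; apply/basinP => e e0.
have iterP k : exists2 w : C, iter k F (Some z) = Some w &
    cmod (w - a) <= cmod (z - a) / 2 ^+ k.
  elim: k => [|k [w wk wa]]; first by exists z; rewrite ?divr1.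
  have w_del : cmod (w - a) < del.
    rewrite (le_lt_trans wa) // (le_lt_trans _ za) // ler_piMr ?cmod_ge0 //.
    by rewrite invf_le1 ?exprn_gt0 // exprn_ege1 // ler1n.
  have [mw fw] := attr w_del; exists (f w); first by rewrite iterS wk F_Some (negbTE mw).
  rewrite (le_trans fw) // exprSr invfM mulrA ler_pM2r // invr_gt0 ltr0n //.
have [N hN] : exists N, del / e < N%:R.
  by exists (Num.bound (del / e)); rewrite archi_boundP // divr_ge0 ?ltW.
exists N => k Nk; have [w wk wa] := iterP k; exists w => //.
rewrite (le_lt_trans wa) // ltr_pdivrMr ?exprn_gt0 // (lt_le_trans za) //.
rewrite -ler_pdivrMl // mulrC (le_trans (ltW hN)) //.
by rewrite -natrX ler_nat (leq_trans Nk) // ltnW // ltn_expl.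
Qed.

Lemma basin_trap z : basin F a z <-> exists k, trap k z.
Proof.
split=> [/basinP/(_ _ del_gt0)[N /(_ N (leqnn N))[w]]|[k]].
  elim: N z => [|N IH] z; first by move=> [->]; exists 0%N.
  rewrite iterSr F_Some; case: eqP => mz; first by rewrite iter_None.
  by move=> wN /(IH _ wN)[k fz]; exists k.+1; split=> //; apply/eqP.
elim: k z => [|k IH] z; first exact: ball_basin.
by move=> [mz /IH fz]; apply/basin_pre; split.
Qed.

Lemma basin_open : open (basin F a).
Proof.
apply/open_cmodP => z /basin_trap[k zk].
have [e e0 ek] := (open_cmodP _).1 (@trap_open k) _ zk.
by exists e => // w /ek wk; apply/basin_trap; exists k.
Qed.

Lemma compact_trap (K : set C) : compact K -> K `<=` basin F a ->
  exists k, K `<=` trap k.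
Proof.
move=> /compact_near_coveringP cK Ka.
have [z Kz|k0 _ h] := cK nat \oo (fun k z => trap k z) _.
  have [k zk] := (basin_trap z).1 (Ka _ Kz).
  exists (trap k, [set j | (k <= j)%N]).
    split; last by exists k.
    by apply: open_nbhs_nbhs; split => //; exact: trap_open.
  by move=> [w j] [/= wk kj]; exact: trap_le wk.
by exists k0 => z Kz; exact: (h k0 (leqnn k0)).
Qed.

Local Notation A := (immediate_basin F a).

Lemma basin_center : basin F a a.
Proof. by apply: ball_basin; rewrite subrr cmod0. Qed.

Lemma immediate_center : A a.
Proof. exact: connected_component_refl basin_center. Qed.

Lemma immediate_basin_sub : A `<=` basin F a.
Proof. exact: connected_component_sub. Qed.

Lemma immediate_connected : connected A.
Proof. exact: component_connected. Qed.

Lemma component_ball (B : set C) (x z w : C) (e : R) :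
  (forall v, cmod (v - z) < e -> B v) -> cmod (w - z) < e ->
  connected_component B x w -> connected_component B x z.
Proof.
move=> eB wz xw.
have [t t01|D [cD DB Dz Dw]] := @segment_sub R z w [set v | cmod (v - z) < e].
  apply: (@convex_ball R z e z w t t01) => //=.
  by rewrite subrr cmod0 (le_lt_trans (cmod_ge0 _) wz).
apply: connected_component_trans xw _.
by apply: (connected_component_max Dw _ cD) => // v /DB/eB.
Qed.

Lemma open_component (B : set C) (x : C) : open B -> open (connected_component B x).
Proof.
move=> /open_cmodP oB; apply/open_cmodP => z zx.
have [e e0 eB] := oB z (connected_component_sub zx); exists e => // w wz.
have [t t01|D [cD DB Dz Dw]] := @segment_sub R z w [set v | cmod (v - z) < e].
  by apply: (@convex_ball R z e z w t t01) => //=; rewrite subrr cmod0.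
apply: connected_component_trans zx _.
by apply: (connected_component_max Dz _ cD) => // v /DB/eB.
Qed.

Lemma immediate_open : open A.
Proof. exact: open_component basin_open. Qed.

Lemma immediate_pole z : A z -> m.[z] != 0.
Proof. by move/immediate_basin_sub/basin_pole. Qed.

Lemma connected_ratfun (D : set C) : connected D -> (forall z, D z -> m.[z] != 0) ->
  connected (f @` D).
Proof.
move=> cD mD; apply: connected_continuous_connected => //.
apply/subspace_continuousP => z Dz.
apply: cvg_within_filter; exact: ratfun_continuous (mD _ Dz).
Qed.

Lemma fixed_center : f a = a.
Proof.
have [|_] := @attr a; first by rewrite subrr cmod0.
rewrite subrr cmod0 mul0r => h; apply/eqP; rewrite -subr_eq0 -cmod_eq0.
by rewrite eq_le h cmod_ge0.
Qed.

Lemma immediate_ratfun z : A z -> A (f z).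
Proof.
move=> Az; have cI := connected_ratfun immediate_connected immediate_pole.
apply: (connected_component_max _ _ cI); last by exists z.
- by exists a; [exact: immediate_center|exact: fixed_center].
- by move=> _ [w /immediate_basin_sub/basin_pre[_ ?] <-].
Qed.

Lemma half_line (z v : C) : v != 0 ->
  let E := [set w : C | exists2 t : R, 0 <= t & w = z + t%:C * v] in
  [/\ connected E, E z & forall M : R, exists2 w, E w & M < cmod w].
Proof.
move=> v0 E; have v1 : 0 < cmod v by rewrite cmod_gt0.
have EE : E = (fun t : R => z + t%:C * v : C) @` `[0, +oo[.
  apply/seteqP; split=> w.
    by move=> [t t0 ->]; exists t => //=; rewrite in_itv /= t0.
  by move=> [t /=]; rewrite in_itv /= andbT => t0 <-; exists t.
split.
- rewrite EE; apply: connected_continuous_connected.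
    by apply/connected_intervalP; exact: interval_is_interval.
  apply: continuous_subspaceT => t.
  apply: (@continuousDC R R (cst z) (fun t => t%:C * v)); first exact: cst_continuous.
  apply: (@continuousMC R R (fun t => t%:C) (cst v)); last exact: cst_continuous.
  by apply: (@continuous_complex R R id (cst 0)); [exact: cvg_id|exact: cst_continuous].
- by exists 0; rewrite // mul0r addr0.
- move=> M; pose t := (`|M| + cmod z + 1) / cmod v.
  have t0 : 0 <= t by rewrite divr_ge0 ?cmod_ge0 // !addr_ge0 ?cmod_ge0.
  exists (z + t%:C * v); first by exists t.
  have := lerB_cmod (t%:C * v) (- z); rewrite opprK [t%:C * v + z]addrC => h.
  rewrite (lt_le_trans _ h) // cmodN cmodM cmodR ger0_norm // divfK ?gt_eqF //.
  by have := ler_norm M; lra.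
Qed.

Lemma trap_fill k (K : set C) :
  (forall (V : set C) (M : R), open V -> (forall z, V z -> cmod z <= M) ->
    (forall z, closure V z -> ~ V z -> A z) -> forall z, V z -> m.[z] != 0) ->
  compact K -> (forall z, K z -> ~ K° z -> A z /\ trap k z) -> K `<=` trap k.
Proof.
move=> no_pole; elim: k K => [|k IH] K cK fK z Kz.
  rewrite /trap /= ltNge; apply/negP => za.
  have zv : z - a != 0 by rewrite -cmod_gt0 (lt_le_trans del_gt0).
  have [cE Ez Einf] := half_line z zv.
  (* The identity is treated as the rational function X / 1, so that [ratfun_escape] applies. *)
  have X1 c : 'X != c *: 1 :> {poly R[i]}.
    apply/eqP => /(congr1 (fun p : {poly R[i]} => p`_1)).
    by rewrite coefX coefZ coef1 mulr0 => /eqP; rewrite oner_eq0.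
  have idE (w : C) : ratfun 'X 1 w = w by rewrite /ratfun hornerX hornerC divr1.
  have h1 (w : C) : K w -> (1 : {poly R[i]}).[w] != 0 by rewrite hornerC oner_neq0.
  have [|w [Kw Kw' [t t0 wE]]] := ratfun_escape X1 cK h1 cE Einf Kz.
    by rewrite idE.
  have [_ /=] := fK w Kw Kw'; rewrite /trap /= -(idE w) wE ltNge => /negP; apply.
  have -> : z + t%:C * (z - a) - a = (1 + t)%:C * (z - a).
    by rewrite rmorphD rmorph1; ring.
  rewrite cmodM cmodR ger0_norm ?addr_ge0 // (le_trans za) //.
  by rewrite ler_peMl ?cmod_ge0 // lerDl.
have [M KM] := compact_bounded_plane cK.
have mK w : K w -> m.[w] != 0.
  move=> Kw; have [Kw'|Kw'] := pselect (K° w); last first.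
    by have [/immediate_pole] := fK w Kw Kw'.
  apply: (no_pole (K°) M (open_interior K) _ _ w Kw').
    by move=> v /interior_subset/KM.
  move=> v cv nv; have Kv : K v.
    apply: (compact_closed_plane cK); apply: closureS cv; exact: interior_subset.
  by have [] := fK v Kv nv.
split; first exact: mK.
apply: (IH (f @` K)); [exact: compact_ratfun| |by exists z].
move=> w Iw Iw'; have [v [Kv Kv' ->]] := frontier_ratfun nm mK Iw Iw'.
by have [Av [_ tv]] := fK v Kv Kv'; split => //; exact: immediate_ratfun.
Qed.

Theorem immediate_basin_full :
  (forall (V : set C) (M : R), open V -> (forall z, V z -> cmod z <= M) ->
    (forall z, closure V z -> ~ V z -> A z) -> forall z, V z -> m.[z] != 0) ->
  full A.
Proof.
move=> no_pole V M oV VM fV.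
have cVM z : closure V z -> cmod z <= M.
  move=> /closure_cmodP cz; rewrite leNgt; apply/negP => Mz.
  have e0 : 0 < cmod z - M by rewrite subr_gt0.
  have [w /VM wM wz] := cz _ e0; have := lerB_cmod z w; rewrite cmodB.
  by move: wz wM; lra.
have cK : compact (closure V).
  by apply: bounded_closed_compact_plane cVM _; exact: closed_closure.
have VK : V `<=` (closure V)°.
  by rewrite -open_subsetE //; exact: subset_closure.
have fK z : closure V z -> ~ (closure V)° z -> A z.
  by move=> cz nz; apply: fV => // /VK.
have [k hk] : exists k, closure V `\` (closure V)° `<=` trap k.
  apply: compact_trap.
    apply: (subclosed_compact _ cK); last exact: subDsetl.
    apply: closedI; first exact: closed_closure.
    by apply: open_closedC; exact: open_interior.
  by move=> z [cz nz]; apply: immediate_basin_sub; exact: fK.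
have Vb : closure V `<=` basin F a.
  move=> z cz; apply/basin_trap; exists k; apply: (trap_fill no_pole cK) cz.
  by move=> w cw nw; split; [exact: fK|exact: hk].
move=> z Vz; apply: contrapT => nAz.
(* [V] is now known to lie in the basin; a component [D] other than [A] has to be excluded. It
   cannot cross the boundary of [V], so it is bounded; but its own boundary would be in the closure
   of [V], hence in the basin, which is impossible for a component of an open set. *)
pose D := connected_component (basin F a) z.
have bz : basin F a z := Vb _ (subset_closure Vz).
have DA w : D w -> ~ A w.
  move=> Dw Aw; apply: nAz; apply: connected_component_trans Aw _.
  exact: connected_component_sym.
have DV : D `<=` V.
  apply: (connected_sub_open (@component_connected _ _ _) oV).
    by move=> w Dw cw; apply: contrapT => nw; exact: DA Dw (fV w cw nw).
  by exists z; split => //; exact: connected_component_refl.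
have oD : open D := open_component basin_open.
have [cE Ez Einf] := half_line z (oner_neq0 _).
have [w Ew] := Einf M; suff /DV/VM : D w by rewrite leNgt => /negP.
apply: (connected_sub_open cE oD) Ew.
  move=> v _ cv; have bv : basin F a v by apply: Vb; exact: closureS cv.
  have [e e0 eb] := (open_cmodP _).1 basin_open v bv.
  have [u Du uv] := (closure_cmodP D v).1 cv e e0.
  exact: component_ball eb uv Du.
by exists z; split => //; exact: connected_component_refl.
Qed.

Theorem immediate_basin_barrier (B : set C) : open B ->
  (forall z, cmod (z - a) < del -> B z) ->
  (forall z, A z -> closure B z -> ~ B z -> ~ B (f z)) -> A `<=` B.
Proof.
move=> oB aB fB.
have main k D : D a -> connected D -> D `<=` A -> D `<=` trap k -> D `<=` B.
  elim: k D => [|k IH] D Da cD DA Dk; first by move=> z /Dk; exact: aB.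
  apply: (connected_sub_open cD oB); last first.
    by exists a; split => //; apply: aB; rewrite subrr cmod0.
  move=> z Dz cz; apply: contrapT => nz; apply: (fB z (DA _ Dz) cz nz).
  apply: (IH (f @` D)); last by exists z.
  - by exists a => //; exact: fixed_center.
  - by apply: connected_ratfun => // w /DA/immediate_pole.
  - by move=> _ [w /DA/immediate_ratfun ? <-].
  - by move=> _ [w /Dk[_ ?] <-].
have [_ pc] := path_connected_open immediate_open immediate_connected
  (ex_intro _ a immediate_center).
move=> z Az; have [g [cg gA g0 g1]] := pc a z immediate_center Az.
have [k Dk] : exists k, g @` `[0, 1] `<=` trap k.
  apply: compact_trap; first by apply: continuous_compact => //; exact: segment_compact.
  by move=> w /gA/immediate_basin_sub.
apply: (main k _ _ _ gA Dk).
- by exists 0; rewrite //= in_itv /= lexx ler01.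
- by apply: connected_continuous_connected => //; exact: segment_connected.
- by exists 1; rewrite //= in_itv /= lexx ler01.
Qed.

End Basins.

(** * Halley's map *)

Section HalleyMap.
Context {R : realType}.
Local Notation C := (Cplane R).
Variable d : nat.
Hypothesis d_ge2 : (2 <= d)%N.
Implicit Types (z w a b : R[i]).

(** Numerator and denominator of Halley's map for [pd], both doubled to clear the factor 1/2. *)
Definition num : {poly R[i]} :=
  d%:R *: ('X * 'X^d * (d.+1%:R *: 'X^d + (d%:R - 1)%:P)).
Definition den : {poly R[i]} :=
  (d.+1 * d.+2)%:R *: 'X^d ^+ 2 + (d.+1%:R * (d%:R - 4)) *: 'X^d + 2%:P.
Local Notation f := (ratfun num den).

Lemma numE z : num.[z] = d%:R * (z * z ^+ d * (d.+1%:R * z ^+ d + (d%:R - 1))).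
Proof. by rewrite /num !hornerE. Qed.

Lemma denE z : den.[z] =
  (d.+1 * d.+2)%:R * z ^+ d ^+ 2 + d.+1%:R * (d%:R - 4) * z ^+ d + 2.
Proof. by rewrite /den !hornerE. Qed.

Let p := pd R d.
Let D : {poly R[i]} := p^`() ^+ 2 - 2^-1 *: (p * p^`(2)).

(** The factor ['X] avoids the exponent d - 1. *)
Lemma pd_derivE : 'X * p^`() = 'X * (d.+1%:R *: 'X^d - 1) /\
  'X * p^`(2) = (d * d.+1)%:R *: 'X^d.
Proof.
have p1 : p^`() = d.+1%:R *: 'X^d - 1.
  rewrite /p /pd derivM derivX mul1r derivB derivXn -polyC1 derivC subr0 mulrnAr -exprS.
  by rewrite prednK ?(ltnW d_ge2) // scaler_nat mulrS addrAC.
rewrite p1; split => //; rewrite /derivn /iter -/p p1 derivB derivZ derivXn -polyC1 derivC subr0.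
rewrite -scalerAr mulrnAr -exprS prednK ?(ltnW d_ge2) // -[_ *+ d]scaler_nat scalerA -natrM.
by rewrite mulnC.
Qed.

Lemma den_halley : 2 *: D = den.
Proof.
have [p1 p2] := pd_derivE; have X0 : 'X != 0 :> {poly R[i]} by rewrite polyX_eq0.
move/(mulfI X0): p1 => p1; rewrite /D scalerBr scalerA divff ?pnatr_eq0 // scale1r p1.
rewrite /p /pd mulrAC p2 /den -!mul_polyC.
rewrite !rmorphM !rmorphB /= !rmorph_nat !natrM; ring.
Qed.

Lemma num_halley : 2 *: ('X * D - p * p^`()) = num.
Proof.
have [p1 _] := pd_derivE; have X0 : 'X != 0 :> {poly R[i]} by rewrite polyX_eq0.
move/(mulfI X0): p1 => p1; rewrite scalerBr scalerAr den_halley p1.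
rewrite /p /pd /den /num -!mul_polyC.
rewrite !rmorphM !rmorphB /= !rmorph_nat rmorph1 !natrM; ring.
Qed.

Lemma num_den_coprime z : num.[z] = 0 -> den.[z] = 0 -> False.
Proof.
rewrite numE denE; have d0 : d%:R != 0 :> R[i] by rewrite pnatr_eq0; lia.
move=> /eqP; rewrite mulf_eq0 (negbTE d0) /= -mulrA mulf_eq0 => /orP[/eqP->|].
  have -> : 0 ^+ d = 0 :> R[i] by rewrite expr0n gtn_eqF //; lia.
  by rewrite expr0n /= !mulr0 !add0r => /eqP; rewrite pnatr_eq0.
rewrite mulf_eq0 => /orP[/eqP->|/eqP uE].
  by rewrite expr0n /= !mulr0 !add0r => /eqP; rewrite pnatr_eq0.
set u := z ^+ d in uE * => h.
(* Multiplied by d + 1, the denominator becomes a polynomial in (d+1) u, which equals 1 - d here;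
   its value is then 4 d^2. *)
have : (d.+1%:R * (d.+1 * d.+2)%:R * u ^+ 2
    + d.+1%:R * (d.+1%:R * (d%:R - 4)) * u + d.+1%:R * 2 : R[i]) = 0.
  by rewrite -[RHS](mulr0 d.+1%:R) -h; ring.
have du : d.+1%:R * u = 1 - d%:R by apply/eqP; rewrite -subr_eq0 -[X in _ == X]uE opprB.
have -> : (d.+1%:R * (d.+1 * d.+2)%:R * u ^+ 2
    + d.+1%:R * (d.+1%:R * (d%:R - 4)) * u + d.+1%:R * 2 : R[i])
  = (d.+2%:R * (1 - d%:R) ^+ 2 + d.+1%:R * (d%:R - 4) * (1 - d%:R) + d.+1%:R * 2).
  by rewrite -du natrM; ring.
have -> : (d.+2%:R * (1 - d%:R) ^+ 2 + d.+1%:R * (d%:R - 4) * (1 - d%:R) + d.+1%:R * 2 : R[i])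
  = (4 * d ^ 2)%:R.
  by rewrite natrM natrX -!natr1; ring.
by move/eqP; rewrite pnatr_eq0; lia.
Qed.

Lemma size_num : size num = (d + d).+2.
Proof.
have d0 : d%:R != 0 :> R[i] by rewrite pnatr_eq0; lia.
have s1 : size (d.+1%:R *: 'X^d + (d%:R - 1)%:P : {poly R[i]}) = d.+1.
  rewrite size_polyDl size_scale ?pnatr_eq0 // size_polyXn //.
  by rewrite (leq_ltn_trans (size_polyC_leq1 _)) //; lia.
rewrite /num size_scale // -exprS mulrC size_mulXn ?s1 -?size_poly_eq0 ?s1 //.
by lia.
Qed.

Lemma size_den : (size den <= (d + d).+1)%N.
Proof.
rewrite /den -exprM muln2 -addnn.
rewrite (leq_trans (size_polyD _ _)) // geq_max; apply/andP; split; last first.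
  by rewrite (leq_trans (size_polyC_leq1 _)).
rewrite (leq_trans (size_polyD _ _)) // geq_max; apply/andP; split.
  by rewrite (leq_trans (size_scale_leq _ _)) // size_polyXn.
by rewrite (leq_trans (size_scale_leq _ _)) // size_polyXn ltnS leq_addr.
Qed.

(** The gcd has no zero, so cancelling it changes no value, and the larger degree of the numerator
    sends infinity to itself. *)
Lemma rational_mapE (n m : {poly R[i]}) : (forall z, n.[z] = 0 -> m.[z] = 0 -> False) ->
  (size m < size n)%N ->
  (forall z : C, rational_map n m (Some z) =
    if m.[z] == 0 then None else Some (ratfun n m z)) /\
  rational_map n m None = None.
Proof.
move=> nm smn; set g := gcdp n m.
have nE : n %/ g * g = n by rewrite divpK // dvdp_gcdl.
have mE : m %/ g * g = m by rewrite divpK // dvdp_gcdr.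
have g0 z : g.[z] != 0.
  apply/eqP => gz; apply: (nm z).
    by rewrite -nE hornerM gz mulr0.
  by rewrite -mE hornerM gz mulr0.
have gg0 : g != 0 by apply/eqP => gE; have := g0 0; rewrite gE horner0 eqxx.
split=> [z|] /=; rewrite -/g.
  rewrite -[in RHS]mE hornerM mulf_eq0 (negbTE (g0 z)) orbF.
  case: eqP => // _; congr Some.
  by rewrite /ratfun -[in RHS]nE !hornerM invfM mulrACA divff ?g0 // mulr1.
rewrite ifT //; have n0 : n != 0 by rewrite -size_poly_gt0 (leq_ltn_trans _ smn).
have n'0 : n %/ g != 0 by apply: contraNneq n0 => n'0; rewrite -nE n'0 mul0r.
have sg : (0 < size g)%N by rewrite size_poly_gt0.
have [->|m'0] := eqVneq (m %/ g) 0; first by rewrite size_poly0 size_poly_gt0.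
have e1 : size m = (size (m %/ g) + size g).-1 by rewrite -[in LHS]mE size_mul.
have e2 : size n = (size (n %/ g) + size g).-1 by rewrite -[in LHS]nE size_mul.
move: smn sg; rewrite e1 e2.
by move: (size g) (size (m %/ g)) (size (n %/ g)) => k i j; lia.
Qed.

Lemma Hd_Some (z : C) : Hd R d (Some z) = if den.[z] == 0 then None else Some (f z).
Proof.
have h2 : 2 != 0 :> R[i] by rewrite pnatr_eq0.
have D2 w : 2 * D.[w] = den.[w] by rewrite -den_halley hornerZ.
have N2 w : 2 * ('X * D - p * p^`()).[w] = num.[w] by rewrite -num_halley hornerZ.
have [||h _] := @rational_mapE ('X * D - p * p^`()) D.
- by move=> w nw mw; apply: (@num_den_coprime w); rewrite -?D2 -?N2 ?nw ?mw mulr0.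
- by rewrite -(size_scale D h2) -(size_scale (_ - _) h2) den_halley num_halley
    size_num ltnS size_den.
rewrite /Hd /halley -/p -/D h -D2 mulf_eq0 (negbTE h2) /=; case: eqP => // _.
by congr Some; rewrite /ratfun -D2 -N2 invfM mulrACA divff // mul1r.
Qed.

Lemma Hd_None : Hd R d None = None.
Proof.
have h2 : 2 != 0 :> R[i] by rewrite pnatr_eq0.
have D2 w : 2 * D.[w] = den.[w] by rewrite -den_halley hornerZ.
have N2 w : 2 * ('X * D - p * p^`()).[w] = num.[w] by rewrite -num_halley hornerZ.
have [||_ h] := @rational_mapE ('X * D - p * p^`()) D => //.
- by move=> w nw mw; apply: (@num_den_coprime w); rewrite -?D2 -?N2 ?nw ?mw mulr0.
- by rewrite -(size_scale D h2) -(size_scale (_ - _) h2) den_halley num_halley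
    size_num ltnS size_den.
Qed.

Lemma d_neq0 : d%:R != 0 :> R[i].
Proof. by rewrite pnatr_eq0; lia. Qed.

Lemma expr0d : 0 ^+ d = 0 :> R[i].
Proof. by rewrite expr0n gtn_eqF //; lia. Qed.

Lemma num0 : num.[0] = 0.
Proof. by rewrite numE mul0r mul0r mulr0. Qed.

Lemma den0 : den.[0] = 2.
Proof. by rewrite denE expr0d expr0n /= !mulr0 !add0r. Qed.

Lemma num_neq0 : num != 0.
Proof. by rewrite -size_poly_eq0 size_num. Qed.

Lemma two_neq0 : 2 != 0 :> R[i].
Proof. by rewrite pnatr_eq0. Qed.

Lemma horner_comb (q r : {poly R[i]}) a z : (q - a *: r).[z] = q.[z] - a * r.[z].
Proof. by rewrite hornerD hornerN hornerZ. Qed.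

Lemma num_den_indep c : num != c *: den.
Proof.
apply/eqP => h; have := congr1 (fun q : {poly R[i]} => q.[0]) h.
rewrite /= num0 hornerZ den0 => /esym/eqP; rewrite mulf_eq0 (negbTE two_neq0) orbF.
by move=> /eqP c0; have := num_neq0; rewrite h c0 scale0r eqxx.
Qed.

(** Says that 1 / (H - a) is not constant; [ratfun_escape] is applied to this function at a
    hypothetical pole of [H]. *)
Lemma den_num_indep a c : den != c *: (num - a *: den).
Proof.
apply/eqP => h; have := congr1 (fun q : {poly R[i]} => q.[0]) h.
rewrite /= (hornerZ c) horner_comb num0 den0 => h0.
have [c0|c0] := eqVneq c 0.
  by move: h0; rewrite c0 mul0r => /eqP; rewrite (negbTE two_neq0).
have := num_den_indep (c^-1 + a); rewrite scalerDl {1}h scalerA mulVf // scale1r.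
by rewrite subrK eqxx.
Qed.

Lemma den_root a : a ^+ d = 1 -> den.[a] = (2 * d ^ 2)%:R.
Proof.
by move=> ad; rewrite denE ad !natrM -!natr1; ring.
Qed.

(** [g / den] is the difference quotient (H(z) - b) / (z - b), continuous and zero at [b], hence of
    modulus less than 1/2 nearby. *)
Lemma attracting_neighbourhood b (g : {poly R[i]}) : den.[b] != 0 ->
  num - b *: den = ('X - b%:P) * g -> g.[b] = 0 ->
  exists2 del : R, 0 < del & forall z : C, cmod (z - b) < del ->
    den.[z] != 0 /\ cmod (f z - b) <= cmod (z - b) / 2.
Proof.
move=> db ng gb; have c1 : {for (b : C), continuous (ratfun g den)}.
  exact: ratfun_continuous.
have h2 : 0 < 1 / 2 :> R by lra.
have h1 := (continuous_cmodP (ratfun g den) b).1 c1 _ h2.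
have db0 : 0 < cmod den.[b] by rewrite cmod_gt0.
have h3 := (continuous_cmodP (fun z : C => den.[z] : C) (b : C)).1
  (@horner_continuous _ den b) _ db0.
have /nbhs_cmodP[del del0 h] : nbhs (b : C) [set z : C |
    cmod (ratfun g den z - ratfun g den b) < 1 / 2 /\
    cmod (den.[z] - den.[b]) < cmod den.[b]] by exact: filterI.
exists del => // z /h[]; rewrite /= /ratfun gb mul0r subr0 => gz dz.
have d0 : den.[z] != 0.
  by apply/eqP => dz0; move: dz; rewrite dz0 sub0r cmodN ltxx.
split=> //; have -> : num.[z] / den.[z] - b = (z - b) * (g.[z] / den.[z]).
  rewrite mulrA -[LHS](mulfK d0) mulrBl divfK //; congr (_ / _).
  have := congr1 (fun q : {poly R[i]} => q.[z]) ng.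
  by rewrite /= horner_comb hornerM hornerXsubC.
by rewrite cmodM ler_wpM2l ?cmod_ge0 // ltW // -[2^-1]div1r.
Qed.

Lemma attracting0 : exists2 del : R, 0 < del & forall z : C, cmod (z - 0) < del ->
    den.[z] != 0 /\ cmod (f z - 0) <= cmod (z - 0) / 2.
Proof.
apply: (@attracting_neighbourhood 0
    (d%:R *: ('X^d * (d.+1%:R *: 'X^d + (d%:R - 1)%:P)))).
- by rewrite den0 two_neq0.
- by rewrite scale0r !subr0 /num -scalerAr mulrA.
- by rewrite hornerZ hornerM hornerXn expr0d mul0r mulr0.
Qed.

Lemma attracting_root a : a ^+ d = 1 -> exists2 del : R, 0 < del &
  forall z : C, cmod (z - a) < del ->
    den.[z] != 0 /\ cmod (f z - a) <= cmod (z - a) / 2.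
Proof.
move=> ad; pose S : {poly R[i]} := \sum_(i < d) 'X^(d.-1 - i) * a%:P ^+ i.
have XS : 'X^d - 1 = ('X - a%:P) * S.
  by rewrite -subrXX -rmorphXn /= ad.
have Sa : a * S.[a] = d%:R.
  rewrite /S horner_sum mulr_sumr (eq_bigr (fun=> 1)) ?sumr_const ?card_ord //.
  move=> i _; rewrite hornerM hornerXn -rmorphXn hornerC -exprD subnK.
    by rewrite -exprS prednK // -1?ad //; lia.
  by have := ltn_ord i; lia.
(* The cofactor is read off from H(z) - a = (z - a) - 2 p p' / [den] with p = X (X - a) S. It
   vanishes at [a] because a S(a) = d, p'(a) = d and [den] takes the value 2 d^2 there. *)
apply: (@attracting_neighbourhood a
  (den - 2 *: ('X * S * (d.+1%:R *: 'X^d - 1)))).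
- by rewrite den_root // pnatr_eq0; lia.
- rewrite mulrBr -scalerAr [('X - _) * (_ * S * _)]mulrA [('X - _) * (_ * S)]mulrCA -XS.
  rewrite /num /den -!mul_polyC !rmorphM !rmorphB /= !rmorph_nat rmorph1 !natrM.
  by rewrite -!natr1; ring.
- have -> : d.+1%:R *: 'X^d - 1 = d.+1%:R *: 'X^d - 1 *: 1 :> {poly R[i]}.
    by rewrite scale1r.
  rewrite horner_comb hornerM hornerM hornerX Sa horner_comb hornerZ hornerXn hornerC.
  by rewrite ad den_root // !natrM -!natr1; ring.
Qed.

End HalleyMap.

(** * Symmetries of the basins; the basins of the roots of unity are full *)

Section HalleyBasins.
Context {R : realType}.
Local Notation C := (Cplane R).
Variable d : nat.
Hypothesis d_ge2 : (2 <= d)%N.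
Implicit Types (z w a b : R[i]).
Local Notation num := (@num R d).
Local Notation den := (@den R d).
Local Notation f := (ratfun num den).
Local Notation F := (Hd R d).
Local Notation A := (immediate_basin F).

Let FS := @Hd_Some R d d_ge2.
Let FN := @Hd_None R d d_ge2.

Definition fixed_root b := b = 0 \/ b ^+ d = 1.

Lemma root_attracting b : fixed_root b -> exists2 del : R, 0 < del &
  forall z : C, cmod (z - b) < del ->
    den.[z] != 0 /\ cmod (f z - b) <= cmod (z - b) / 2.
Proof. by move=> [->|]; [exact: attracting0|exact: attracting_root]. Qed.

Lemma d_gt0 : (0 < d)%N. Proof. exact: ltnW. Qed.

Lemma basin_unique b c z : basin F b z -> basin F c z -> b = c.
Proof.
move=> /basinP zb /basinP zc; apply/eqP; rewrite -subr_eq0 -cmod_eq0.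
apply/negPn/negP => bc; have e0 : 0 < cmod (b - c) / 2.
  by rewrite divr_gt0 // lt_def bc cmod_ge0.
have [N hN] := zb _ e0; have [M hM] := zc _ e0.
have [w wk wb] := hN (N + M)%N (leq_addr _ _).
have [v vk vc] := hM (N + M)%N (leq_addl _ _).
move: vk vc; rewrite wk => -[<-] vc.
have := ler_cmodBD w b c; rewrite [cmod (b - w)]cmodB => h.
by have := le_lt_trans h (ltrD wb vc); rewrite -splitr ltxx.
Qed.

Lemma immediate_subset b z : A b z -> basin F b z.
Proof. exact: immediate_basin_sub. Qed.

Lemma immediate_den b z : A b z -> den.[z] != 0.
Proof. exact: (immediate_pole FS FN). Qed.

Lemma immediate_root b : fixed_root b -> A b b.
Proof. by case/root_attracting => del d0 h; exact: (immediate_center FS d0 h). Qed.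

Lemma immediate_map b z : fixed_root b -> A b z -> A b (f z).
Proof.
by case/root_attracting => del d0 h; exact: (immediate_ratfun FS FN d0 h).
Qed.

Lemma immediate_isopen b : fixed_root b -> open (A b).
Proof. by case/root_attracting => del d0 h; exact: (immediate_open FS FN d0 h). Qed.

Lemma immediate_contains b (E : set C) : connected E -> E b ->
  (forall z : C, E z -> basin F b z) -> E `<=` A b.
Proof. by move=> cE Eb EB; apply: connected_component_max. Qed.

Lemma contracting_basin b (q : R) (P : C -> Prop) : fixed_root b -> 0 <= q < 1 ->
  (forall z : C, P z -> [/\ den.[z] != 0, P (f z) & cmod (f z - b) <= q * cmod (z - b)]) ->
  forall z : C, P z -> basin F b z.
Proof.
move=> /root_attracting[del d0 attr] /andP[q0 q1] Pf.
have main k (z : C) : P z -> q ^+ k * cmod (z - b) < del -> basin F b z.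
  elim: k z => [|k IH] z Pz; first by rewrite mul1r; exact: (ball_basin FS d0 attr).
  have [dz Pfz fz] := Pf z Pz; rewrite exprSr -mulrA => h.
  apply/(basin_pre b FS FN); split=> //; apply: IH => //.
  by rewrite (le_lt_trans _ h) // ler_wpM2l // exprn_ge0.
move=> z Pz; have [zb|zb] := eqVneq (cmod (z - b)) 0.
  by apply: (main 0%N) => //; rewrite zb mulr0.
have zb0 : 0 < cmod (z - b) by rewrite lt_def zb cmod_ge0.
have := @cvg_expr R q; rewrite ger0_norm // => /(_ q1) /cvgrPdist_lt.
move=> /(_ (del / cmod (z - b)) (divr_gt0 d0 zb0))[k _ /(_ k (leqnn k))] /=.
rewrite sub0r normrN ger0_norm ?exprn_ge0 // ltr_pdivlMr //.
exact: main.
Qed.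

Lemma basin_isometry (phi : C -> C) b z :
  (forall v w, cmod (phi v - phi w) = cmod (v - w)) ->
  (forall w, den.[phi w] = 0 <-> den.[w] = 0) ->
  (forall w, f (phi w) = phi (f w)) ->
  basin F b z -> basin F (phi b) (phi z).
Proof.
move=> iso dphi fphi /basinP zb; apply/basinP => e /zb[N h]; exists N => k /h[w wk wb].
exists (phi w); last by rewrite iso.
have Fphi (s : sphere R) : F (omap phi s) = omap phi (F s).
  case: s => [v|]; last first.
    by change (F None = omap phi (F None)); rewrite FN.
  change (F (Some (phi v)) = omap phi (F (Some v))); rewrite !FS.
  case: ifP => [/eqP/dphi v0|/eqP pv]; case: ifP => [/eqP v1|/eqP v1] //.
    by case: pv; apply/dphi.
  by rewrite /= fphi.
have -> : Some (phi z) = omap phi (Some z : sphere R) by [].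
have -> : iter k F (omap phi (Some z : sphere R)) = omap phi (iter k F (Some z)).
  by elim: (k) => //= j ->; rewrite Fphi.
by rewrite wk.
Qed.

Lemma cmod_root a : a ^+ d = 1 -> cmod a = 1.
Proof.
move=> ad; apply: (@pexpIrn _ d); rewrite ?nnegrE ?cmod_ge0 ?ler01 ?d_gt0 //.
by rewrite -cmodX ad cmod1 expr1n.
Qed.

Lemma root_neq0 a : a ^+ d = 1 -> a != 0.
Proof. by move/cmod_root => a1; rewrite -cmod_eq0 a1 oner_neq0. Qed.

Lemma root_conj a : a ^+ d = 1 -> a * a^* = 1.
Proof. by move=> /cmod_root a1; rewrite mulc_conj a1 expr1n. Qed.

Lemma den_rotate a z : a ^+ d = 1 -> den.[a * z] = den.[z].
Proof. by move=> ad; rewrite !denE exprMn ad mul1r. Qed.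

Lemma ratfun_rotate a z : a ^+ d = 1 -> f (a * z) = a * f z.
Proof. by move=> ad; rewrite /ratfun den_rotate // !numE exprMn ad mul1r; ring. Qed.

Lemma den_conj z : den.[z^*] = (den.[z])^*.
Proof.
have main (x y t v : R[i]) : x^* = x -> y^* = y -> t^* = t ->
    (x * v ^+ 2 + y * v + t)^* = x * v^* ^+ 2 + y * v^* + t.
  by move=> xx yy tt; rewrite !(rmorphD, rmorphM, rmorphXn) /= xx yy tt.
rewrite !denE main ?rmorphXn ?rmorph_nat //.
by rewrite rmorphM rmorphB !rmorph_nat.
Qed.

Lemma ratfun_conj z : f z^* = (f z)^*.
Proof.
have main (x y t v : R[i]) : x^* = x -> y^* = y -> t^* = t ->
    (x * (z * v * (y * v + t)))^* = x * (z^* * v^* * (y * v^* + t)).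
  by move=> xx yy tt; rewrite !(rmorphM, rmorphD) /= xx yy tt.
rewrite /ratfun den_conj rmorphM /= fmorphV; congr (_ / _).
rewrite !numE main ?rmorphXn ?rmorph_nat //.
by rewrite rmorphB rmorph_nat rmorph1.
Qed.

Lemma basin_rotate a b z : a ^+ d = 1 -> basin F b z -> basin F (a * b) (a * z).
Proof.
move=> ad; apply: (@basin_isometry (fun z => a * z)) => [v w|w|w].
- by rewrite -mulrBr cmodM cmod_root // mul1r.
- by rewrite den_rotate.
- exact: ratfun_rotate.
Qed.

Lemma basin_reflect a b z : a ^+ d = 1 -> basin F b z -> basin F (a * b^*) (a * z^*).
Proof.
move=> ad bz; apply: (basin_rotate ad); apply: (@basin_isometry (fun z => z^*)) bz.
- by move=> v w; rewrite -rmorphB cmodJ.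
- move=> w; rewrite den_conj; split=> [|->]; last by rewrite rmorph0.
  by move/eqP; rewrite fmorph_eq0 => /eqP.
- exact: ratfun_conj.
Qed.

Lemma immediate_rotate a b z : a ^+ d = 1 -> fixed_root b -> A b z -> A (a * b) (a * z).
Proof.
move=> ad rb Az; have Ab := immediate_root rb.
apply: (@immediate_contains _ ((fun z : C => a * z) @` A b)).
- apply: connected_continuous_connected; first exact: immediate_connected.
  apply: continuous_subspaceT => w.
  apply: (@continuousMC R C (cst a) id); [exact: cst_continuous|exact: (fun A h => h)].
- by exists b.
- by move=> _ [w /immediate_subset bw <-]; exact: basin_rotate.
- by exists z.
Qed.

(* [z] is fixed by the reflection that exchanges the basins of [1] and [a]. *)
Lemma basin1_axis a z : a ^+ d = 1 -> a != 1 -> basin F 1 z -> z != a * z^*.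
Proof.
move=> ad a1 bz; apply/eqP => za; have := basin_reflect ad bz.
rewrite -za rmorph1 mulr1 => bz'.
by have := basin_unique bz bz' => a1'; rewrite -a1' eqxx in a1.
Qed.

(** As [a] has modulus 1, the hypothesis says that [z] is equidistant from 1 and [a], that is, on
    the axis of the reflection that exchanges them. *)
Lemma Re_axis a z : a ^+ d = 1 -> a != 1 ->
  complex.Re (z * a^*) = complex.Re z -> z = a * z^*.
Proof.
move=> ad a1 h; have aa := root_conj ad.
have h2 : z * a^* + z^* * a = z + z^*.
  by move: h; case: (z) (a) => [x y] [s t]; simpc => /= h; congr (_ +i* _); lra.
have h3 : (z - a * z^*) * (1 - a) = 0.
  have -> : (z - a * z^*) * (1 - a) = (z + z^*) - a * (z + z^*) + (a * a - 1) * z^* + 0.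
    by ring.
  rewrite -{2}h2 mulrDr.
  have -> : a * (z * a^*) = z by rewrite mulrCA aa mulr1.
  by ring.
move/eqP: h3; rewrite mulf_eq0 [1 - a == 0]subr_eq0 eq_sym [1 == a]eq_sym (negbTE a1) orbF.
by rewrite eq_sym subr_eq0 => /eqP.
Qed.

(** The immediate basin of 1 is connected, contains 1, and by [basin1_axis] does not meet the axis
    between 1 and [a]. *)
Lemma immediate1_sector a z : a ^+ d = 1 -> a != 1 -> A 1 z ->
  complex.Re (z * a^*) < complex.Re z.
Proof.
move=> ad a1 Az; pose O := [set z : C | complex.Re (z * a^*) < complex.Re z].
have r1 : fixed_root 1 by right; rewrite expr1n.
have cRe : continuous (fun z : C => complex.Re z - complex.Re (z * a^*)).
  move=> w; apply: continuousB; first exact: Re_continuous.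
  apply: (@continuous_comp C C R (fun w => w * a^*) (fun w => complex.Re w)).
    apply: (@continuousMC R C id (cst a^*)); [exact: (fun A h => h)|exact: cst_continuous].
  exact: Re_continuous.
have oO : open O.
  have -> : O = (fun z : C => complex.Re z - complex.Re (z * a^*)) @^-1` [set x | 0 < x].
    by apply/seteqP; split => w /=; rewrite subr_gt0.
  apply: open_comp; last exact: open_gt.
  by move=> w _; exact: cRe.
apply: (connected_sub_open (@immediate_connected _ _ _) oO _ _ Az).
- move=> w /immediate_subset bw cw; rewrite /O /= lt_neqAle; apply/andP; split.
    by apply/eqP => /(Re_axis ad a1)/eqP; apply/negP; exact: basin1_axis.
  rewrite -subr_ge0.
  have : closed ((fun z : C => complex.Re z - complex.Re (z * a^*)) @^-1` [set x | 0 <= x]).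
    by apply: preimage_closed; [move=> v _; exact: cRe|exact: closed_ge].
  move=> /(_ w); apply; apply: closureS cw => v /=.
  by rewrite subr_ge0; exact: ltW.
- exists 1; split; first exact: immediate_root.
  rewrite /O /= mul1r; case: (a) ad a1 => x y ad a1 /=.
  have := ler_Re (x +i* y); rewrite cmod_root //= => h.
  rewrite lt_neqAle (le_trans (ler_norm _) h) andbT; apply: contraNneq a1 => x1.
  have := sqr_cmod (x +i* y); rewrite cmod_root //= x1 expr1n => h2.
  have /eqP : y ^+ 2 = 0 by lra.
  by rewrite sqrf_eq0 => /eqP->.
Qed.

(* The rays that bisect the sectors of the roots of unity. *)
Definition neg_rays (z : C) : Prop := exists2 x : R, 0 <= x & z ^+ d = - x%:C.

Lemma root_exists : exists2 a : R[i], a ^+ d = 1 & a != 1.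
Proof.
pose q : {poly R[i]} := \poly_(i < d) 1.
have q1 : size q != 1%N.
  by rewrite size_poly_eq ?oner_neq0 //; apply/eqP; lia.
have [a /eqP qa] := closed_rootP _ q1.
have qE : q.[a] = \sum_(i < d) a ^+ i.
  by rewrite horner_poly; apply: eq_bigr => i _; rewrite mul1r.
exists a; first by apply/eqP; rewrite -subr_eq0 subrX1 -qE qa mulr0.
apply/eqP => a1; move: qa; rewrite qE a1.
under eq_bigr do rewrite expr1n.
by rewrite sumr_const card_ord => /eqP; rewrite pnatr_eq0; lia.
Qed.

Lemma neg_root_exists : exists w : R[i], w ^+ d = -1.
Proof.
have q1 : size ('X^d + 1%:P : {poly R[i]}) != 1%N.
  by rewrite size_XnaddC ?d_gt0 //; apply/eqP; lia.
have [w] := closed_rootP _ q1; rewrite /root hornerD hornerXn hornerC addr_eq0 => /eqP.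
by exists w.
Qed.

(** After a rotation that takes [a] to 1, the quotient [w / w^*] is a root of unity. If it differs
    from 1, [w] is on the axis of a reflection that moves 1; otherwise [w] is a negative real
    number, which [immediate1_sector] excludes. *)
Lemma immediate_neg a z : a ^+ d = 1 -> A a z -> ~ neg_rays z.
Proof.
move=> ad Az [x x0 zx]; have a0 := root_neq0 ad.
have ra : fixed_root a by right.
have ad' : a^-1 ^+ d = 1 by rewrite exprVn ad invr1.
have := immediate_rotate ad' ra Az; rewrite mulVf //; set w := a^-1 * z => Aw.
have wx : w ^+ d = - x%:C by rewrite exprMn ad' mul1r.
have w0 : w != 0.
  apply/eqP => w0; have b0 : basin F 0 0 by apply/immediate_subset/immediate_root; left.
  have := immediate_subset Aw; rewrite w0 => /(basin_unique b0)/eqP.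
  by rewrite eq_sym oner_eq0.
have wc0 : w^* != 0 by rewrite fmorph_eq0.
have wd0 : w ^+ d != 0 by rewrite expf_neq0.
have xc : (- x%:C)^* = - x%:C :> R[i] by simpc.
have zd : (w / w^*) ^+ d = 1.
  have wcd : w^* ^+ d = (w ^+ d)^* by rewrite rmorphXn.
  by rewrite exprMn exprVn wcd wx xc divff // -wx.
have [z1|z1] := eqVneq (w / w^*) 1; last first.
  have := basin1_axis zd z1 (immediate_subset Aw).
  by rewrite divfK // eqxx.
have wr : w = w^* by apply/eqP; rewrite -subr_eq0 -[w in w - _](divfK wc0) z1 mul1r subrr.
have wI : w = (complex.Re w)%:C.
  apply: real_complexP; move: wr; case: (w) => s t [] /= /eqP.
  by rewrite -subr_eq0 opprK -mulr2n mulrn_eq0 /= => /eqP.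
have wneg : complex.Re w < 0.
  rewrite ltNge; apply/negP => wpos; move: wx; rewrite wI -rmorphXn -rmorphN => -[] h.
  have h2 : 0 <= complex.Re w ^+ d by rewrite exprn_ge0.
  have x1 : x = 0 by lra.
  by move/eqP: wd0; apply; rewrite wI -rmorphXn h x1 oppr0.
have [b bd b1] := root_exists; have := immediate1_sector bd b1 Aw.
have ReE (r : R) c : complex.Re (r%:C * c^*) = r * complex.Re c.
  by case: c => s t; simpc.
have := le_trans (ler_norm _) (ler_Re b); rewrite (cmod_root bd) wI ReE /=.
by move: wneg; move: (complex.Re w) (complex.Re b) => r s; nra.
Qed.

Lemma neg_ray z : neg_rays z -> exists E : set C, [/\ connected E, E z,
  E `<=` neg_rays & forall M : R, exists2 w : C, E w & M < cmod w].
Proof.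
have scale (t : R) w : 0 <= t -> neg_rays w -> neg_rays (t%:C * w).
  move=> t0 [x x0 wx]; exists (t ^+ d * x); first by rewrite mulr_ge0 ?exprn_ge0.
  by rewrite exprMn wx -rmorphXn rmorphM mulrN.
move=> nz; have [v v0 vz] : exists2 v, v != 0 &
    forall t : R, 0 <= t -> neg_rays (z + t%:C * v).
  have [->|z0] := eqVneq z 0; last first.
    exists z => // t t0; have -> : z + t%:C * z = (1 + t)%:C * z.
      by rewrite rmorphD rmorph1; ring.
    by apply: scale => //; rewrite addr_ge0.
  have [w wd] := neg_root_exists; exists w.
    apply: contra_eq_neq wd => ->; rewrite expr0d // eq_sym oppr_eq0.
    exact: oner_neq0.
  by move=> t t0; rewrite add0r; apply: scale => //; exists 1; rewrite // wd.
have [cE Ez Einf] := half_line z v0; exists [set w : C | exists2 t : R, 0 <= t & w = z + t%:C * v].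
split; [exact: cE|exact: Ez| |exact: Einf].
by move=> _ [t t0 ->]; exact: vz.
Qed.

Lemma neg_rays0 : neg_rays 0.
Proof. by exists 0; rewrite // expr0d // oppr0. Qed.

Lemma num_zero_neg z : num.[z] = 0 -> neg_rays z.
Proof.
move/eqP; rewrite numE mulf_eq0 (negbTE (d_neq0 d_ge2)) /= -mulrA mulf_eq0.
case/orP=> [/eqP->|]; first exact: neg_rays0.
rewrite mulf_eq0 => /orP[/eqP zd|/eqP zd]; first by exists 0; rewrite // zd oppr0.
have d1 : d.+1%:R != 0 :> R[i] by rewrite pnatr_eq0.
exists ((d%:R - 1) / d.+1%:R).
  by rewrite divr_ge0 // subr_ge0 ler1n d_gt0.
apply: (mulfI d1); rewrite mulrN -(rmorph_nat (real_complex R)) -rmorphM /=.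
rewrite mulrCA divff ?mulr1 ?pnatr_eq0 // rmorphB rmorph_nat rmorph1.
by apply/eqP; rewrite -addr_eq0 -[X in _ == X]zd rmorph_nat.
Qed.

Lemma connected_enters (E V : set C) a z : open V -> connected E ->
  (forall w : C, closure V w -> ~ V w -> A a w) ->
  (forall w : C, E w -> ~ A a w) -> E z -> V z -> E `<=` V.
Proof.
move=> oV cE fV EA Ez Vz; apply: (connected_sub_open cE oV).
  by move=> w Ew cw; apply: contrapT => nw; apply: (EA w Ew); exact: fV.
by exists z.
Qed.

Lemma closure_frontier (V : set C) z : open V -> closure V z -> ~ (closure V)° z -> ~ V z.
Proof.
move=> oV; have VK : V `<=` (closure V)°.
  by rewrite -open_subsetE //; exact: subset_closure.
move=> cz nz Vz; exact: (nz (VK z Vz)).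
Qed.

Lemma compact_closure (V : set C) (M : R) : (forall z : C, V z -> cmod z <= M) ->
  compact (closure V).
Proof.
move=> VM; apply: (@bounded_closed_compact_plane _ _ M); last exact: closed_closure.
move=> z /closure_cmodP cz; rewrite leNgt; apply/negP => Mz.
have e0 : 0 < cmod z - M by rewrite subr_gt0.
have [w /VM wM wz] := cz _ e0; have := lerB_cmod z w; rewrite cmodB.
by move: wz wM; lra.
Qed.

Lemma full_immediate_root a : a ^+ d = 1 -> full (A a).
Proof.
move=> ad; have ra : fixed_root a by right.
have [del d0 attr] := root_attracting ra.
apply: (immediate_basin_full FS FN (num_den_indep d_ge2) d0 attr).
move=> V M oV VM fV z Vz; apply/eqP => dz.
have noneg w : closure V w -> ~ neg_rays w.
  move=> cw nw; have [Vw|Vw] := pselect (V w); last first.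
    exact: immediate_neg ad (fV w cw Vw) nw.
  have [E [cE Ew En Einf]] := neg_ray nw; have [v Ev] := Einf M.
  have : V v.
    apply: (connected_enters oV cE fV) Ev; [|exact: Ew|exact: Vw].
    by move=> u /En nu Au; exact: immediate_neg ad Au nu.
  by move/VM; rewrite leNgt => /negP.
have [v vd] := neg_root_exists.
have v0 : v != 0.
  by apply: contra_eq_neq vd => ->; rewrite expr0d // eq_sym oppr_eq0 oner_neq0.
(* At the pole 1 / H has the value 0, where this ray starts. A value t v of 1 / H with t != 0 means
   H^d = - 1/t^d, so that [H] takes a value on the negative rays. *)
have [cE Ez Einf] := half_line 0 v0.
have nd c : den != c *: num.
  by have := den_num_indep d_ge2 0 c; rewrite scale0r subr0.
have nK w : closure V w -> num.[w] != 0.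
  by move=> /noneg nw; apply/eqP => /num_zero_neg.
have [|w [cw nw [t t0 wt]]] := ratfun_escape nd (compact_closure VM) nK cE Einf
    (subset_closure Vz).
  by exists 0; rewrite // /ratfun dz !mul0r addr0.
have Aw : A a w by apply: fV => //; exact: closure_frontier nw.
have dw := immediate_den Aw; have Afw := immediate_map ra Aw.
apply: (immediate_neg ad Afw); rewrite /ratfun add0r in wt *.
have t_gt0 : t != 0.
  apply: contra_neq dw => t00; move: wt; rewrite t00 mul0r => /eqP.
  by rewrite mulf_eq0 invr_eq0 (negbTE (nK w cw)) orbF => /eqP.
exists ((t ^+ d)^-1); first by rewrite invr_ge0 exprn_ge0.
rewrite -[_ / _]invrK invf_div wt exprVn exprMn vd -rmorphXn mulrN1 invrN.
by rewrite -fmorphV.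
Qed.

End HalleyBasins.

(** * Invariant rays *)

Section ShiftedCoefficients.
Context {R : realType}.
Implicit Types p q : {poly R}.

(** Nonnegative Taylor coefficients at 1: an algebraic certificate of nonnegativity on [1, +oo),
    stable under sums, products and integration from 1. *)
Definition nneg1 p := forall i, 0 <= (p \Po ('X + 1))`_i.

Lemma nneg1_horner p r : nneg1 p -> 1 <= r -> 0 <= p.[r].
Proof.
move=> np r1; have -> : p.[r] = (p \Po ('X + 1)).[r - 1].
  by rewrite horner_comp hornerD hornerX hornerC subrK.
by rewrite horner_coef sumr_ge0 // => i _; rewrite mulr_ge0 // exprn_ge0 // subr_ge0.
Qed.

Lemma nneg1M p q : nneg1 p -> nneg1 q -> nneg1 (p * q).
Proof.
move=> np nq i; rewrite comp_polyM coefM sumr_ge0 // => j _.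
by rewrite mulr_ge0.
Qed.

Lemma nneg1D p q : nneg1 p -> nneg1 q -> nneg1 (p + q).
Proof. by move=> np nq i; rewrite comp_polyD coefD addr_ge0. Qed.

Lemma nneg1C (c : R) : 0 <= c -> nneg1 c%:P.
Proof. by move=> c0 i; rewrite comp_polyC coefC; case: ifP. Qed.

Lemma nneg1_sub1 : nneg1 ('X - 1).
Proof.
by move=> i; rewrite comp_polyB comp_polyX -polyC1 comp_polyC addrK coefX ler0n.
Qed.

Lemma nneg1X : nneg1 'X.
Proof. by have := nneg1D nneg1_sub1 (nneg1C ler01); rewrite polyC1 subrK. Qed.

Lemma nneg1Xn n : nneg1 'X^n.
Proof.
elim: n => [|n IH]; first by rewrite expr0 -polyC1; exact: nneg1C.
by rewrite exprS; apply: nneg1M => //; exact: nneg1X.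
Qed.

Lemma nneg1_deriv p : 0 <= p.[1] -> nneg1 p^`() -> nneg1 p.
Proof.
move=> p1 np [|i]; first by rewrite -horner_coef0 horner_comp hornerD hornerX hornerC add0r.
have := np i; have -> : p^`() \Po ('X + 1) = (p \Po ('X + 1))^`().
  by rewrite deriv_comp derivD derivX -polyC1 derivC addr0 mulr1.
by rewrite coef_deriv -mulr_natr pmulr_lge0.
Qed.

Lemma deriv_monomial (c : R) k : (c *: 'X^k)^`() = (c * k%:R) *: 'X^(k.-1).
Proof. by rewrite derivZ derivXn -scaler_nat scalerA. Qed.

(** This is [num - den] as a real polynomial; where [den] is positive, H(r) >= 1 amounts to its
    nonnegativity. *)
Definition halley_gap d : {poly R} :=
  (d * d.+1)%:R *: 'X^((d + d).+1) + (d%:R * (d%:R - 1)) *: 'X^(d.+1)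
  - (d.+1 * d.+2)%:R *: 'X^(d + d) - (d.+1%:R * (d%:R - 4)) *: 'X^d - 2%:P.

(** H - 1 has a triple zero at 1: the gap vanishes at 1, its derivative is n (n + 1) X^(d-1) [g],
    both [g] and its derivative [g1] vanish at 1, and the derivative [g2] of [g1] is a product of
    polynomials with evident certificates. *)
Lemma halley_gap_nneg d : (2 <= d)%N -> nneg1 (halley_gap d).
Proof.
move=> d2; have [e de] : exists e, d = e.+2 by exists d.-2; lia.
pose n : R := d%:R.
pose g : {poly R} := (n *+ 2 + 1) *: 'X^(d.+1) - (n *+ 2 + 4) *: 'X^d +
  (n - 1) *: 'X - (n - 4)%:P.
pose g1 : {poly R} := ((n *+ 2 + 1) * (n + 1)) *: 'X^d - ((n *+ 2 + 4) * n) *: 'X^(e.+1)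
  + (n - 1)%:P.
pose g2 : {poly R} := n%:P * 'X^e * (((n *+ 2 + 1) * (n + 1))%:P * ('X - 1) + (n + 5)%:P).
have nE : n = e%:R + 2 by rewrite /n de -addn2 natrD.
have n0 : 0 <= n by rewrite ler0n.
have g2E : g1^`() = g2.
  rewrite /g1 derivD derivB !deriv_monomial derivC addr0 /g2 -!mul_polyC.
  have -> : d.-1 = e.+1 by rewrite de.
  rewrite -[e.+1.-1]/e exprS -/n -natr1 nE.
  rewrite !(rmorphD, rmorphM, rmorphB, rmorphMn) /=; ring.
have ng1 : nneg1 g1.
  apply: nneg1_deriv; first by rewrite le_eqVlt; apply/orP; left; apply/eqP;
    rewrite /g1 hornerD hornerD hornerN !hornerZ !hornerXn hornerC !expr1n; ring.
  rewrite g2E; apply: nneg1M; first by apply: nneg1M; [exact: nneg1C|exact: nneg1Xn].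
  apply: nneg1D; last by apply: nneg1C; lra.
  by apply: nneg1M; [apply: nneg1C; nra|exact: nneg1_sub1].
have ng : nneg1 g.
  apply: nneg1_deriv; first by rewrite le_eqVlt; apply/orP; left; apply/eqP;
    rewrite /g !hornerD !hornerN !hornerZ !hornerXn hornerX hornerC !expr1n; ring.
  suff -> : g^`() = g1 by [].
  rewrite /g derivB derivD derivB !deriv_monomial derivZ derivX derivC subr0 /g1.
  have -> : d.-1 = e.+1 by rewrite de.
  by rewrite -natr1 -/n alg_polyC.
apply: nneg1_deriv.
  rewrite le_eqVlt; apply/orP; left; apply/eqP.
  by rewrite /halley_gap !hornerD !hornerN !hornerZ !hornerXn hornerC !expr1n !natrM
    -!natr1 -/n; ring.
suff -> : (halley_gap d)^`() = (n * (n + 1))%:P * 'X^(e.+1) * g.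
  apply: nneg1M => //; apply: nneg1M; last exact: nneg1Xn.
  by apply: nneg1C; rewrite mulr_ge0 // addr_ge0.
rewrite /halley_gap !derivB derivD !deriv_monomial derivC subr0.
have -> : d.+1.-1 = d by [].
have -> : (d + d).+1.-1 = (d + d)%N by [].
have -> : (d + d).-1 = (d + e.+1)%N by lia.
have -> : d.-1 = e.+1 by lia.
rewrite /g !natrM -!natr1 natrD -/n -!mul_polyC !exprD [in 'X^(d.+1)]exprS.
have -> : 'X^d = 'X * 'X^(e.+1) :> {poly R} by rewrite de exprS.
move: ('X^(e.+1)) => Y.
rewrite !(rmorphD, rmorphM, rmorphB, rmorphMn) /=; ring.
Qed.

End ShiftedCoefficients.

Section RealRays.
Context {R : realType}.
Local Notation C := (Cplane R).
Implicit Types (z w a b : R[i]).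

Definition den_real d (s : R) : R :=
  (d.+1 * d.+2)%:R * s ^+ 2 + d.+1%:R * (d%:R - 4) * s + 2.
(** Where z^d is a real number s, [H] multiplies z by this real number. *)
Definition factor d (s : R) : R :=
  d%:R * s * (d.+1%:R * s + (d%:R - 1)) / den_real d s.

Lemma den_realE d z (s : R) : z ^+ d = s%:C -> (den d).[z] = (den_real d s)%:C.
Proof.
move=> zs; rewrite denE zs /den_real.
have main (x y t : R) : (x * s ^+ 2 + y * s + t)%:C =
    x%:C * s%:C ^+ 2 + y%:C * s%:C + t%:C by rewrite !(rmorphD, rmorphM, rmorphXn).
by rewrite main rmorphM rmorphB !rmorph_nat.
Qed.

Lemma ratfun_real d z (s : R) : z ^+ d = s%:C ->
  ratfun (num d) (den d) z = (factor d s)%:C * z.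
Proof.
move=> zs; rewrite /ratfun (den_realE zs) numE zs /factor.
have main (x y t : R) : (x * s * (y * s + t))%:C = x%:C * s%:C * (y%:C * s%:C + t%:C).
  by rewrite !(rmorphD, rmorphM).
rewrite fmorph_div /= main rmorphB !rmorph_nat rmorph1.
by move: (_^-1) => v; ring.
Qed.

Lemma factor_pow d z (s : R) : z ^+ d = s%:C ->
  (ratfun (num d) (den d) z) ^+ d = (factor d s ^+ d * s)%:C.
Proof. by move=> zs; rewrite (ratfun_real zs) exprMn zs -rmorphXn -rmorphM. Qed.

Lemma halley_real_ray d (r : R) : (2 <= d)%N -> 1 <= r ->
  [/\ 0 < den_real d (r ^+ d), 1 <= factor d (r ^+ d) * r &
    factor d (r ^+ d) * r - 1 <=
    (1 - (2 * d%:R) / (2 * d%:R ^+ 2 + 4 * d%:R + 4)) * (r - 1)].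
Proof.
move=> d2 r1; pose n : R := d%:R; have n2 : 2 <= n by rewrite /n ler_nat.
set u := r ^+ d; have u1 : 1 <= u by rewrite exprn_ege1.
have D0 : 0 < den_real d u.
  rewrite /den_real natrM -!natr1 -/n.
  have h : 0 <= (n + 2) * u + n - 4 by nra.
  have : 0 <= (n + 1) * u * ((n + 2) * u + n - 4) by rewrite !mulr_ge0 //; lra.
  by lra.
have gap := nneg1_horner (halley_gap_nneg d2) r1.
have low : 1 <= factor d u * r.
  rewrite /factor mulrAC ler_pdivlMr // mul1r -subr_ge0.
  suff -> : d%:R * u * (d.+1%:R * u + (d%:R - 1)) * r - den_real d u = (halley_gap d).[r] by [].
  rewrite /halley_gap !hornerD !hornerN !hornerZ !hornerXn hornerC /den_real.
  by rewrite !exprS exprD -/u !natrM; ring.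
(* [q] is a coarse upper bound of [den_real d u] / u^2, valid for u >= 1 and for both signs of d -
   4. Together with r (u - 1) >= (r - 1) u and (n + 1) u - 1 >= n u it yields the contraction rate 1
   - 2 n / q. *)
split=> //; set q := 2 * n ^+ 2 + 4 * n + 4.
have q0 : 0 < q by rewrite /q; nra.
have main : 2 * n / q * (r - 1) * den_real d u <= 2 * r * (u - 1) * ((n + 1) * u - 1).
  have h1 : (r - 1) * u <= r * (u - 1).
    have ru : r <= u by rewrite /u -[leLHS]expr1; apply: ler_weXn2l => //; lia.
    lra.
  have h2 : 0 <= (n + 1) * u - 1 by nra.
  have h3 : n * u <= (n + 1) * u - 1 by nra.
  have h4 : den_real d u <= q * u ^+ 2.
    by rewrite /den_real /q natrM -!natr1 -/n; nra.
  have r0 : 0 <= r - 1 by rewrite subr_ge0.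
  have e1 : 2 * n / q * (r - 1) * den_real d u <= 2 * n * (r - 1) * u ^+ 2.
    have -> : 2 * n * (r - 1) * u ^+ 2 = 2 * n / q * (r - 1) * (q * u ^+ 2).
      by field; rewrite gt_eqF.
    by rewrite ler_wpM2l // mulr_ge0 // divr_ge0 ?mulr_ge0 //; lra.
  apply: le_trans e1 _.
  have -> : 2 * n * (r - 1) * u ^+ 2 = 2 * (((r - 1) * u) * (n * u)) by ring.
  have -> : 2 * r * (u - 1) * ((n + 1) * u - 1) = 2 * ((r * (u - 1)) * ((n + 1) * u - 1)).
    by ring.
  rewrite ler_pM2l // ler_pM // mulr_ge0 //; lra.
have -> : factor d u * r - 1 = (r - 1) - 2 * r * (u - 1) * ((n + 1) * u - 1) / den_real d u.
  rewrite /factor; have -> : den_real d u = (n + 1) * (n + 2) * u ^+ 2 + (n + 1) * (n - 4) * u + 2.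
    by rewrite /den_real natrM -!natr1 -/n; ring.
  rewrite -natr1 -/n; field; move: D0; rewrite /den_real natrM -!natr1 -/n => D0.
  by apply/eqP => h; move: D0; lra.
rewrite mulrBl mul1r lerD2l lerN2 ler_pdivlMr //.
Qed.

Lemma positive_ray d (r : R) : (2 <= d)%N -> 1 <= r -> basin (Hd R d) 1 r%:C.
Proof.
move=> d2 r1; have n2 : 2 <= d%:R :> R by rewrite ler_nat.
pose P (z : C) := exists2 r : R, 1 <= r & z = r%:C.
apply: (@contracting_basin R d d2 1
  (1 - (2 * d%:R) / (2 * d%:R ^+ 2 + 4 * d%:R + 4)) P _ _ _ r%:C); last by exists r.
- by right; rewrite expr1n.
- have h : 0 < 2 * d%:R / (2 * d%:R ^+ 2 + 4 * d%:R + 4) :> R.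
    by rewrite divr_gt0 //; nra.
  have h2 : 2 * d%:R / (2 * d%:R ^+ 2 + 4 * d%:R + 4) <= 1 :> R.
    by rewrite ler_pdivrMr; nra.
  by rewrite subr_ge0 h2 ltrBlDr ltrDl.
move=> _ [s s1 ->]; have [D0 h1 h2] := halley_real_ray d2 s1.
have sd : s%:C ^+ d = (s ^+ d)%:C :> R[i] by rewrite rmorphXn.
rewrite (den_realE sd) (ratfun_real sd) -rmorphM; split.
- by rewrite fmorph_eq0 gt_eqF.
- by exists (factor d (s ^+ d) * s).
- have rc (x : R) : x%:C - 1 = (x - 1)%:C :> R[i] by rewrite rmorphB rmorph1.
  by rewrite !rc !cmodR !ger0_norm ?subr_ge0.
Qed.

Lemma root_ray d a (t : R) : (2 <= d)%N -> a ^+ d = 1 -> 0 <= t ->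
  basin (Hd R d) a (a + t%:C * a).
Proof.
move=> d2 ad t0; have -> : a + t%:C * a = a * (1 + t)%:C by rewrite rmorphD rmorph1; ring.
have := basin_rotate d2 ad (positive_ray d2 (_ : 1 <= 1 + t)).
by rewrite mulr1; apply; rewrite lerDl.
Qed.

(** d / (d + 2) is the limit of [factor d s] as s tends to infinity. An even power of the factor
    keeps the sign of s. For d = 3 the factor is negative between -1/2 and 0, so an orbit may leave
    the rays s <= 0; the invariant set is therefore enlarged to s <= 1/7, the point where the factor
    equals 3/5. *)
Lemma small_factor d (s : R) : [\/ d = 2, d = 3 | d = 4]%N ->
  s <= 0 \/ d = 3%N /\ s <= 1 / 7 ->
  [/\ 0 < den_real d s, `|factor d s| <= d%:R / (d%:R + 2) &
   factor d s ^+ d * s <= 0 \/ d = 3%N /\ factor d s ^+ d * s <= 1 / 7].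
Proof.
move=> d4 hs.
have D0 : 0 < den_real d s.
  by rewrite /den_real; case: d4 hs => -> hs; nra.
have fa : `|factor d s| <= d%:R / (d%:R + 2).
  rewrite /factor normrM [`|_^-1|]gtr0_norm ?invr_gt0 // ler_pdivrMr //.
  rewrite ler_norml /den_real.
  have e2 : 2 / (2 + 2) = 1 / 2 :> R by field.
  have e3 : 3 / (3 + 2) = 3 / 5 :> R by field.
  have e4 : 4 / (4 + 2) = 2 / 3 :> R by field.
  (* These squares, for d = 2, 3, 4 in turn, complete the quadratic that expresses - d / (d + 2) <=
     [factor d s]. *)
  have h2 := sqr_ge0 (s - 1 / 24); have h3 := sqr_ge0 (s + 3 / 40).
  have h4 := sqr_ge0 (s + 3 / 20).
  by case: d4 hs {D0} => -> [hs|[// _ hs]]; rewrite ?e2 ?e3 ?e4; apply/andP; split; lra.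
split=> //; move: fa; set phi := factor d s => fa.
case: d4 hs fa => dE; rewrite {}dE in D0 phi * => hs fa.
- by left; case: hs => [hs|[]//]; have := sqr_ge0 phi; nra.
- have e3 : 3 / (3 + 2) = 3 / 5 :> R by field.
  rewrite {}e3 in fa; have [s0|s0] := lerP s 0; last first.
    right; split => //; case: hs => [|[_ hs]]; first by rewrite leNgt s0.
    have phi0 : 0 <= phi.
      by rewrite /phi /factor divr_ge0 ?(ltW D0) //; nra.
    rewrite ger0_norm // in fa; have fa1 : phi <= 1 by lra.
    have : phi ^+ 3 <= 1 by rewrite exprn_ile1.
    by nra.
  have [phi0|phi0] := lerP 0 phi; first by left; rewrite mulr_ge0_le0 // exprn_ge0.
  (* A negative factor confines s to [-1/2, 0], so the new value is at most (3/5)^3 / 2, which is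
     less than 1/7. *)
  right; split => //; have s2 : - (1 / 2) <= s.
    rewrite leNgt; apply/negP => s2; move: phi0; rewrite ltNge => /negP; apply.
    by rewrite /phi /factor divr_ge0 ?(ltW D0) //; nra.
  rewrite ltr0_norm // in fa.
  have h3 : (- phi) ^+ 3 <= 27 / 125.
    have -> : 27 / 125 = (3 / 5) ^+ 3 :> R by field.
    by rewrite ler_pXn2r ?nnegrE //; lra.
  have -> : phi ^+ 3 * s = (- phi) ^+ 3 * (- s) by ring.
  have p0 : 0 <= (- phi) ^+ 3 by rewrite exprn_ge0 //; lra.
  by nra.
- left; case: hs => [hs|[]//]; rewrite mulr_ge0_le0 //.
  by have := sqr_ge0 (phi ^+ 2); rewrite -exprM.
Qed.

Lemma neg_rays_basin d z : [\/ d = 2, d = 3 | d = 4]%N -> @neg_rays R d z ->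
  basin (Hd R d) 0 z.
Proof.
move=> d4 [x x0 zx]; have d2 : (2 <= d)%N by case: d4 => ->.
pose P (z : C) := exists2 s : R, z ^+ d = s%:C & s <= 0 \/ d = 3%N /\ s <= 1 / 7.
apply: (@contracting_basin R d d2 0 (d%:R / (d%:R + 2)) P _ _ _ z).
- by left.
- by rewrite divr_ge0 // ltr_pdivrMr ?mul1r ?ltrDl // addr_gt0 // ltr0n; lia.
- move=> w [s ws hs]; have [D0 fs hs'] := small_factor d4 hs.
  rewrite (den_realE ws); split.
  + by rewrite fmorph_eq0 gt_eqF.
  + by exists (factor d s ^+ d * s) => //; exact: factor_pow.
  + by rewrite (ratfun_real ws) !subr0 cmodM cmodR ler_wpM2r ?cmod_ge0.
- by exists (- x); [rewrite rmorphN|left; rewrite oppr_le0].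
Qed.

Lemma neg_rays_immediate d z : [\/ d = 2, d = 3 | d = 4]%N -> @neg_rays R d z ->
  immediate_basin (Hd R d) 0 z.
Proof.
move=> d4 nz; have d2 : (2 <= d)%N by case: d4 => ->.
have [E [cE E0 Ez EB]] : exists E : set C,
    [/\ connected E, E 0, E z & E `<=` basin (Hd R d) 0].
  have [t t01|E [cE EB Ez E0]] := @segment_sub R z 0 (basin (Hd R d) 0); last by exists E.
  apply: neg_rays_basin => //; case: nz => x x0 zx; exists ((1 - t) ^+ d * x).
    by rewrite mulr_ge0 // exprn_ge0 // subr_ge0; case/andP: t01.
  have -> : z + t%:C * (0 - z) = (1 - t)%:C * z by rewrite rmorphB rmorph1; ring.
  by rewrite exprMn zx -rmorphXn rmorphM mulrN.
exact: (immediate_contains cE E0 EB).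
Qed.

Lemma unbounded_set (B : set C) :
  (forall M : R, exists2 w : C, B w & M < cmod w) -> ~ bounded_set B.
Proof.
move=> Binf [M [Mreal h]]; have := h (M + 1); rewrite ltrDl ltr01 => /(_ isT) {}h.
have MR : M = (complex.Re M)%:C.
  apply: real_complexP; move: Mreal; rewrite realE !lecE /=.
  by case/orP => /andP[/eqP].
have [w Bw] := Binf (complex.Re M + 1); have := h w Bw.
by rewrite /= -cmodE MR -(rmorph1 (real_complex R)) -rmorphD lecR leNgt => /negP.
Qed.

Lemma immediate_root_unbounded d a : (2 <= d)%N -> a ^+ d = 1 ->
  ~ bounded_set (immediate_basin (Hd R d) a).
Proof.
move=> d2 ad; have [cE Ea Einf] := half_line a (root_neq0 d2 ad).
apply: unbounded_set => M; have [w Ew Mw] := Einf M; exists w => //.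
apply: (immediate_contains cE Ea) Ew.
by move=> _ [t t0 ->]; exact: root_ray.
Qed.

Lemma immediate0_unbounded d : [\/ d = 2, d = 3 | d = 4]%N ->
  ~ bounded_set (immediate_basin (Hd R d) 0).
Proof.
move=> d4; have d2 : (2 <= d)%N by case: d4 => ->.
have [E [cE E0 En Einf]] := neg_ray d2 (@neg_rays0 R d d2).
apply: unbounded_set => M; have [w Ew Mw] := Einf M; exists w => //.
by apply: neg_rays_immediate => //; exact: En.
Qed.

End RealRays.

(** * The basin of 0 for d <= 4 *)

Section OnePreimages.
Context {R : realType}.
Implicit Types (z w a b : R[i]) (x y r : R).

Lemma Re_realM r z : complex.Re (r%:C * z) = r * complex.Re z.
Proof. by case: z => s t; simpc. Qed.

Lemma ReD z w : complex.Re (z + w) = complex.Re z + complex.Re w.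
Proof. by case: z w => ? ? []. Qed.

Lemma ReJ z : complex.Re z^* = complex.Re z.
Proof. by case: z. Qed.

Lemma nat_realC (n : nat) : n%:R = (n%:R : R)%:C :> R[i].
Proof. by rewrite rmorph_nat. Qed.

(** Chebyshev's polynomials, made homogeneous by r = |z|^2. *)
Lemma Re_powers z : let x := complex.Re z in let r := cmod z ^+ 2 in
  [/\ complex.Re (z ^+ 2) = 2 * x ^+ 2 - r,
      complex.Re (z ^+ 3) = x * (4 * x ^+ 2 - 3 * r),
      complex.Re (z ^+ 4) = 8 * x ^+ 4 - 8 * x ^+ 2 * r + r ^+ 2 &
      complex.Re (z ^+ 5) = x * (16 * x ^+ 4 - 20 * x ^+ 2 * r + 5 * r ^+ 2)].
Proof.
move=> x r; rewrite /r sqr_cmod /x; case: z {x r} => x y.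
have z2 : (x +i* y) ^+ 2 = (x ^+ 2 - y ^+ 2) +i* (2 * x * y).
  by rewrite expr2; simpc; congr (_ +i* _); ring.
have z3 : (x +i* y) ^+ 3 = (x ^+ 3 - 3 * x * y ^+ 2) +i* (3 * x ^+ 2 * y - y ^+ 3).
  by rewrite exprS z2; simpc; congr (_ +i* _); ring.
have z4 : (x +i* y) ^+ 4 = (x ^+ 4 - 6 * x ^+ 2 * y ^+ 2 + y ^+ 4) +i*
    (4 * x ^+ 3 * y - 4 * x * y ^+ 3).
  by rewrite exprS z3; simpc; congr (_ +i* _); ring.
have z5 : (x +i* y) ^+ 5 = (x ^+ 5 - 10 * x ^+ 3 * y ^+ 2 + 5 * x * y ^+ 4) +i*
    (5 * x ^+ 4 * y - 10 * x ^+ 2 * y ^+ 3 + y ^+ 5).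
  by rewrite exprS z4; simpc; congr (_ +i* _); ring.
by rewrite z2 z3 z4 z5 /=; split; ring.
Qed.

(** Multiplied by [z^*], the polynomial becomes r (3 z + 3) + [z^*] with r = |z|^2, whose real part
    is positive. *)
Lemma cofactor2_neq0 z : 0 < complex.Re z -> 3 * z ^+ 2 + 3 * z + 1 != 0.
Proof.
move=> x0; apply/eqP => q0.
have : (cmod z ^+ 2)%:C * (3%:R%:C * z + 3%:R%:C) + z^* = 0.
  rewrite -mulc_conj -!nat_realC -[RHS](mul0r z^*) -q0; ring.
move/(congr1 (@complex.Re R)); rewrite ReD Re_realM ReD Re_realM ReJ /=.
have r0 : 0 <= cmod z ^+ 2 := sqr_ge0 _.
by nra.
Qed.

(** The hypotheses describe the sector |arg z| <= 60 degrees. Again the polynomial is multiplied by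
    a power of [z^*], which brings the exponents of its main terms close to 0: the first power
    ([e1]) serves when |z| is small, the third ([e3]) when it is large. *)
Lemma cofactor3_neq0 z : 0 < complex.Re z -> cmod z ^+ 2 <= 4 * complex.Re z ^+ 2 ->
  6 * z ^+ 4 + 8 * z ^+ 3 + 6 * z ^+ 2 + 3 * z + 1 != 0.
Proof.
move=> x0 rx; apply/eqP => q0; have [c2 c3 _ _] := Re_powers z.
have r_gt0 : 0 < cmod z ^+ 2.
  by rewrite exprn_gt0 // cmod_gt0; apply: contraTneq x0 => ->; rewrite ltxx.
have e1 : (cmod z ^+ 2)%:C * (6%:R%:C * z ^+ 3 + 8%:R%:C * z ^+ 2 + 6%:R%:C * z + 3%:R%:C)
    + z^* = 0.
  rewrite -mulc_conj -!nat_realC -[RHS](mul0r z^*) -q0; ring.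
have e3 : ((cmod z ^+ 2) ^+ 3)%:C * (6%:R%:C * z + 8%:R%:C)
    + ((cmod z ^+ 2) ^+ 2)%:C * (6%:R%:C * z^*) + (cmod z ^+ 2)%:C * (3%:R%:C * z^* ^+ 2)
    + z^* ^+ 3 = 0.
  rewrite [((cmod z ^+ 2) ^+ 3)%:C]rmorphXn [((cmod z ^+ 2) ^+ 2)%:C]rmorphXn /=.
  by rewrite -mulc_conj -!nat_realC -[RHS](mul0r (z^* ^+ 3)) -q0; ring.
move/(congr1 (@complex.Re R)): e1; move/(congr1 (@complex.Re R)): e3.
rewrite !(ReD, Re_realM) -!rmorphXn !ReJ /= c2 c3.
move=> {q0 c2 c3}; move: (complex.Re z) (cmod z ^+ 2) x0 rx r_gt0 => x r x0 rx r0 e3 e1.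
have [r1|r1] := lerP r (45 / 100).
  have h1 : 0 <= x * (4 * x ^+ 2 - r) by rewrite mulr_ge0 ?subr_ge0 // ltW.
  have h2 : 0 <= 6 * x - 12 * x * r by nra.
  have h3 : 0 < 6 * (x * (4 * x ^+ 2 - 3 * r)) + 8 * (2 * x ^+ 2 - r) + 6 * x + 3.
    by nra.
  have h4 := mulr_gt0 r0 h3.
  by lra.
have h1 : 0 <= x * (4 * x ^+ 2 - r) by rewrite mulr_ge0 ?subr_ge0 // ltW.
have h2 : 0 <= x * r by rewrite mulr_ge0 ?ltW.
have h3 : 0 < 6 * (x * r) * r ^+ 2 + 8 * r ^+ 3 + 6 * (x * r) * r
    - 3 / 2 * r ^+ 2 - 2 * (x * r).
  have h4 : 0 <= (x * r) * (6 * r ^+ 2 + 6 * r - 2) by rewrite mulr_ge0 //; nra.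
  have h5 : 0 < r ^+ 2 * (8 * r - 3 / 2) by rewrite mulr_gt0 ?exprn_gt0 //; lra.
  by lra.
have h6 : 0 <= r * (4 * x ^+ 2 - r) by rewrite mulr_ge0 ?subr_ge0 // ltW.
by lra.
Qed.

(** The same method in the sector |arg z| <= 45 degrees, with the first and the fourth power of
    [z^*]. *)
Lemma cofactor4_neq0 z : 0 < complex.Re z -> cmod z ^+ 2 <= 2 * complex.Re z ^+ 2 ->
  10 * z ^+ 6 + 15 * z ^+ 5 + 15 * z ^+ 4 + 10 * z ^+ 3 + 6 * z ^+ 2 + 3 * z + 1 != 0.
Proof.
move=> x0 rx; apply/eqP => q0; have [c2 c3 c4 c5] := Re_powers z.
have r_gt0 : 0 < cmod z ^+ 2.
  by rewrite exprn_gt0 // cmod_gt0; apply: contraTneq x0 => ->; rewrite ltxx.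
have e1 : (cmod z ^+ 2)%:C * (10%:R%:C * z ^+ 5 + 15%:R%:C * z ^+ 4 + 15%:R%:C * z ^+ 3
    + 10%:R%:C * z ^+ 2 + 6%:R%:C * z + 3%:R%:C) + z^* = 0.
  rewrite -mulc_conj -!nat_realC -[RHS](mul0r z^*) -q0; ring.
have e4 : ((cmod z ^+ 2) ^+ 4)%:C * (10%:R%:C * z ^+ 2 + 15%:R%:C * z + 15%:R%:C)
    + ((cmod z ^+ 2) ^+ 3)%:C * (10%:R%:C * z^*)
    + ((cmod z ^+ 2) ^+ 2)%:C * (6%:R%:C * z^* ^+ 2)
    + (cmod z ^+ 2)%:C * (3%:R%:C * z^* ^+ 3) + z^* ^+ 4 = 0.
  rewrite [((cmod z ^+ 2) ^+ 4)%:C]rmorphXn [((cmod z ^+ 2) ^+ 3)%:C]rmorphXn.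
  rewrite [((cmod z ^+ 2) ^+ 2)%:C]rmorphXn /=.
  by rewrite -mulc_conj -!nat_realC -[RHS](mul0r (z^* ^+ 4)) -q0; ring.
move/(congr1 (@complex.Re R)): e1; move/(congr1 (@complex.Re R)): e4.
rewrite !(ReD, Re_realM) -!rmorphXn !ReJ /= c2 c3 c4 c5.
move=> {q0 c2 c3 c4 c5}; move: (complex.Re z) (cmod z ^+ 2) x0 rx r_gt0 => x r x0 rx r0 e4 e1.
have d0 : 0 <= 2 * x ^+ 2 - r by rewrite subr_ge0.
have h3 : 0 <= x * (2 * x ^+ 2 - r) by rewrite mulr_ge0 // ltW.
have h4 : 0 <= 8 * x ^+ 4 - 8 * x ^+ 2 * r + 2 * r ^+ 2.
  by have := sqr_ge0 (2 * x ^+ 2 - r); lra.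
have h5 : 0 <= x * (16 * x ^+ 4 - 20 * x ^+ 2 * r + 25 / 4 * r ^+ 2).
  rewrite mulr_ge0 ?(ltW x0) //.
  by have := sqr_ge0 (4 * x ^+ 2 - 5 / 2 * r); lra.
have xr : 0 < x * r by rewrite mulr_gt0.
have [r1|r1] := lerP r (36 / 100).
  have r2 : r ^+ 2 <= 1296 / 10000 by nra.
  have h6 : x * r ^+ 2 <= 1296 / 10000 * x by nra.
  have h7 : x * r <= 36 / 100 * x by nra.
  have h8 : - (102 / 100) * x < 10 * (x * (16 * x ^+ 4 - 20 * x ^+ 2 * r + 5 * r ^+ 2))
    + 15 * (8 * x ^+ 4 - 8 * x ^+ 2 * r + r ^+ 2) + 15 * (x * (4 * x ^+ 2 - 3 * r))
    + 10 * (2 * x ^+ 2 - r) + 6 * x + 3 by lra.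
  have h9 := ltr_pM2l r0 (- (102 / 100) * x); rewrite -h9 in h8.
  by nra.
have h6 : 0 <= r ^+ 4 * (2 * x ^+ 2 - r) by rewrite mulr_ge0 // exprn_ge0 // ltW.
have h7 : 0 <= r ^+ 2 * (2 * x ^+ 2 - r) by rewrite mulr_ge0 // exprn_ge0 // ltW.
have h8 : 0 <= r * (x * (2 * x ^+ 2 - r)) by rewrite mulr_ge0 // ltW.
have h9 : 0 <= (x * r ^+ 2) * (15 * r ^+ 2 + 10 * r - 3).
  by rewrite mulr_ge0 ?mulr_ge0 ?exprn_ge0 ?ltW //; nra.
have h10 : 0 < r ^+ 2 * (15 * r ^+ 2 - 1) by rewrite mulr_gt0 ?exprn_gt0 //; nra.
by lra.
Qed.

End OnePreimages.

(** * Sectors of the roots of unity, bordered by the negative rays *)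

Section Sectors.
Context {R : realType}.
Local Notation C := (Cplane R).
Implicit Types (z w a b c : R[i]).

(* The open sector of the points closer to the [d]-th root of unity [a] than to
   any other one. *)
Definition sector d a : set C :=
  [set z : C | forall b, b ^+ d = 1 -> b != a ->
    complex.Re (z * b^*) < complex.Re (z * a^*)].

Lemma roots_of_unity d : (0 < d)%N ->
  exists rs : seq R[i], forall b, (b \in rs) = (b ^+ d == 1).
Proof.
move=> d0; have [rs rsE] := closed_field_poly_normal ('X^d - 1 : {poly R[i]}).
exists rs => b; rewrite -root_prod_XsubC.
have -> : \prod_(z <- rs) ('X - z%:P) = 'X^d - 1 :> {poly R[i]}.
  by rewrite rsE lead_coefXnsubC // scale1r.
by rewrite /root hornerD hornerN hornerXn hornerC subr_eq0.
Qed.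

Lemma argmax_seq (T : eqType) (g : T -> R) (s : seq T) x : x \in s ->
  exists2 y, y \in s & forall t, t \in s -> g t <= g y.
Proof.
elim: s x => // y s IH x _; case: s IH => [|y' s] IH.
  by exists y => [|b]; rewrite inE // => /eqP->.
have [a sa ga] := IH y' (mem_head _ _).
have [ya|ya] := lerP (g y) (g a).
  by exists a => [|b]; rewrite inE ?sa ?orbT // => /orP[/eqP->|/ga].
exists y => [|b]; rewrite inE ?eqxx // => /orP[/eqP->|/ga] //.
by move=> ba; rewrite (le_trans ba) // ltW.
Qed.

Lemma sector_continuous a b :
  continuous (fun z : C => complex.Re (z * a^*) - complex.Re (z * b^*)).
Proof.
have cRe c : continuous (fun z : C => complex.Re (z * c^*)).
  move=> w; apply: (@continuous_comp C C R (fun w => w * c^*) (fun w => complex.Re w)).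
    apply: (@continuousMC R C id (cst c^*)); [exact: (fun A h => h)|exact: cst_continuous].
  exact: Re_continuous.
by move=> w; apply: (@continuousB _ _ _ (fun z : C => complex.Re (z * a^*) : R)
  (fun z : C => complex.Re (z * b^*) : R)); exact: cRe.
Qed.

Lemma sector_open d a : (0 < d)%N -> open (sector d a).
Proof.
move=> d0; have [rs rsE] := roots_of_unity d0.
have -> : sector d a = [set z : C | forall b, b \in rs -> b != a ->
    complex.Re (z * b^*) < complex.Re (z * a^*)].
  by apply/seteqP; split => z h b; [rewrite rsE => /eqP; exact: h|move=> bd;
    apply: h; rewrite rsE bd].
elim: rs {rsE} => [|c rs IH].
  rewrite (_ : [set z : C | _] = setT); first exact: openT.
  by apply/seteqP; split => z.
have [ca|ca] := eqVneq c a.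
  rewrite (_ : [set z : C | _] = [set z : C | forall b, b \in rs -> b != a ->
    complex.Re (z * b^*) < complex.Re (z * a^*)]) //.
  apply/seteqP; split => z h b bs ba; first by apply: h; rewrite // inE bs orbT.
  by move: bs; rewrite inE -ca in ba *; rewrite (negbTE ba) => /h; rewrite -ca; apply.
have oc : open [set z : C | complex.Re (z * c^*) < complex.Re (z * a^*)].
  rewrite (_ : [set z : C | _] =
    (fun z : C => complex.Re (z * a^*) - complex.Re (z * c^*)) @^-1` [set x | 0 < x]).
    apply: open_comp; last exact: open_gt.
    by move=> w _; exact: sector_continuous.
  by apply/seteqP; split => w /=; rewrite subr_gt0.
rewrite (_ : [set z : C | _] = [set z : C | complex.Re (z * c^*) < complex.Re (z * a^*)]
  `&` [set z : C | forall b, b \in rs -> b != a ->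
    complex.Re (z * b^*) < complex.Re (z * a^*)]); first exact: openI.
apply/seteqP; split => z.
  move=> h; split; first by apply: h; rewrite ?mem_head.
  by move=> b bs; apply: h; rewrite inE bs orbT.
by move=> [zc h] b; rewrite inE => /orP[/eqP->|]//; exact: h.
Qed.

(** The tie puts [z] on the axis of the reflection that exchanges [a] and [b], so z^d is real. Were
    it positive, [z] would be a positive multiple of a root of unity, which would then be the only
    maximiser, against the tie. *)
Lemma sector_tie d a b z : (2 <= d)%N -> a ^+ d = 1 -> b ^+ d = 1 -> b != a ->
  (forall c, c ^+ d = 1 -> complex.Re (z * c^*) <= complex.Re (z * a^*)) ->
  complex.Re (z * b^*) = complex.Re (z * a^*) -> @neg_rays R d z.
Proof.
move=> d2 ad bd ba amax tie; have aa := root_conj d2 ad; have a0 := root_neq0 d2 ad.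
have Jd c : c ^+ d = 1 -> c^* ^+ d = 1 by move=> cd; rewrite -rmorphXn /= cd rmorph1.
have cd : (b * a^*) ^+ d = 1 by rewrite exprMn bd Jd // mulr1.
have c1 : b * a^* != 1.
  apply: contra_neq ba => h; apply: (mulIf (_ : a^* != 0)); first by rewrite fmorph_eq0.
  by rewrite h aa.
have wE c : z * a^* * c^* = z * (a * c)^*.
  by rewrite rmorphM /= mulrA.
have wc : z * a^* = (b * a^*) * (z * a^*)^*.
  apply: (Re_axis d2 cd c1); rewrite wE mulrCA aa mulr1; exact: tie.
have [z0|z0] := eqVneq z 0; first by rewrite z0; exact: neg_rays0.
have wd : (z * a^*) ^+ d = z ^+ d by rewrite exprMn Jd // mulr1.
have zr : (z ^+ d)^* = z ^+ d.
  by rewrite -[RHS]wd wc exprMn cd mul1r -rmorphXn wd.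
have zI : z ^+ d = (complex.Re (z ^+ d))%:C.
  apply: real_complexP; move: zr; case: (z ^+ d) => s t [] /= /eqP.
  by rewrite -subr_eq0 -opprD oppr_eq0 -mulr2n mulrn_eq0 /= => /eqP.
have [s0|s0] := lerP (complex.Re (z ^+ d)) 0.
  by exists (- complex.Re (z ^+ d)); rewrite ?oppr_ge0 // rmorphN opprK.
exfalso; have zn0 : cmod z != 0 by rewrite cmod_eq0.
have zpos : 0 < cmod z by rewrite cmod_gt0.
have zc0 : (cmod z)%:C != 0 :> R[i] by rewrite fmorph_eq0.
pose e := z / (cmod z)%:C.
have ed : e ^+ d = 1.
  rewrite exprMn exprVn -rmorphXn /= -cmodX [in cmod _]zI cmodR gtr0_norm //.
  by rewrite -zI divff // expf_neq0.
have ze : z = (cmod z)%:C * e by rewrite mulrC divfK.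
have ReE (r : R) c : complex.Re (r%:C * c) = r * complex.Re c := Re_realM r c.
have := amax e ed; rewrite ze -mulrA (root_conj d2 ed) mulr1 -mulrA !ReE.
rewrite -[leLHS]mulr1 /= ler_pM2l // => h1.
have ea : e * a^* = 1.
  have h2 : cmod (e * a^*) = 1 by rewrite cmodM cmodJ !(cmod_root d2) // mulr1.
  have h3 := sqr_cmod (e * a^*); rewrite h2 in h3.
  have := ler_Re (e * a^*); rewrite h2 => /(le_trans (ler_norm _)) h4.
  have h5 : complex.Re (e * a^*) = 1 by apply/le_anti; rewrite h4.
  rewrite h5 in h3; apply/eqP; rewrite eq_complex h5 eqxx /= -sqrf_eq0.
  by apply/eqP; lra.
have rC : ((cmod z)%:C)^* = (cmod z)%:C :> R[i] by simpc.
have zaE : z * a^* = (cmod z)%:C by rewrite {1}ze -mulrA ea mulr1.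
move: wc; rewrite zaE => wc; have /eqP := etrans wc (congr1 (fun c => b * a^* * c) rC).
by rewrite eq_sym -subr_eq0 -[X in _ - X]mul1r -mulrBl mulf_eq0 subr_eq0 (negbTE c1)
  (negbTE zc0).
Qed.

Lemma sector_neg_rays d z : (2 <= d)%N -> ~ @neg_rays R d z ->
  exists2 a, a ^+ d = 1 & sector d a z.
Proof.
move=> d2 nz; have [rs rsE] := roots_of_unity (ltnW d2).
have r1 : 1 \in rs by rewrite rsE expr1n.
have [a] := argmax_seq (fun c => complex.Re (z * c^*)) r1.
rewrite rsE => /eqP ad amax; exists a => // b bd ba.
have {}amax c : c ^+ d = 1 -> complex.Re (z * c^*) <= complex.Re (z * a^*).
  by move=> cd; apply: amax; rewrite rsE cd.
rewrite lt_neqAle amax // andbT; apply/eqP => tie; apply: nz.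
exact: sector_tie ad bd ba amax tie.
Qed.

Lemma sector_closure d a z : (2 <= d)%N -> a ^+ d = 1 -> closure (sector d a) z ->
  ~ sector d a z -> @neg_rays R d z.
Proof.
move=> d2 ad cz nz; have amax c : c ^+ d = 1 -> complex.Re (z * c^*) <= complex.Re (z * a^*).
  move=> cd; have [->|ca] := eqVneq c a; first exact: lexx.
  rewrite -subr_ge0.
  have : closed ((fun z : C => complex.Re (z * a^*) - complex.Re (z * c^*))
      @^-1` [set x | 0 <= x]).
    apply: preimage_closed; last exact: closed_ge.
    by move=> v _; exact: sector_continuous.
  move=> /(_ z); apply; apply: closureS cz => v /= h.
  by rewrite subr_ge0 ltW // h.
have [b [bd ba tie]] : exists b, [/\ b ^+ d = 1, b != a &
    ~ complex.Re (z * b^*) < complex.Re (z * a^*)].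
  apply: contrapT => h; apply: nz => b bd ba; apply: contrapT => tie; apply: h.
  by exists b.
apply: (sector_tie d2 ad bd ba amax); apply/le_anti; rewrite amax //=.
by rewrite leNgt; apply/negP.
Qed.

Lemma sector_rotate d a z : (2 <= d)%N -> a ^+ d = 1 -> sector d a z ->
  sector d 1 (a^-1 * z).
Proof.
move=> d2 ad h b bd b1; have a0 := root_neq0 d2 ad.
have aV : a^-1 = a^* by apply: (mulfI a0); rewrite divff // (root_conj d2).
have -> : a^-1 * z * b^* = z * (a * b)^* by rewrite rmorphM aV; ring.
have -> : a^-1 * z * 1^* = z * a^* by rewrite rmorph1 aV; ring.
apply: h; first by rewrite exprMn ad bd mulr1.
by apply: contra_neq b1 => h; apply: (mulfI a0); rewrite h mulr1.
Qed.

(* The identity [num - den = 2 (z - 1)^3 q] leaves the zeros of the cofactor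
   [q], none of which lies in the sector of [1]. *)
Lemma unique_preimage d z : [\/ d = 2, d = 3 | d = 4]%N -> sector d 1 z ->
  (@num R d).[z] = (@den R d).[z] -> z = 1.
Proof.
move=> d4 hz.
have cube (q e : R[i]) : q != 0 -> e = 2 * (z - 1) ^+ 3 * q -> e = 0 -> z = 1.
  move=> q0 -> h; apply/eqP; apply: contraTT isT => z1.
  have : 2 * (z - 1) ^+ 3 * q != 0.
    by rewrite !mulf_neq0 ?expf_neq0 ?subr_eq0 ?pnatr_eq0.
  by rewrite h eqxx.
have Sq (s t : R) : complex.Re (z * (s +i* t)^*) = complex.Re z * s + complex.Im z * t.
  by case: z {hz cube} => x y; simpc; rewrite /=; ring.
have Rx : complex.Re (z * 1^*) = complex.Re z by rewrite rmorph1 mulr1.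
move=> /eqP; rewrite -subr_eq0 numE denE => /eqP; case: d4 hz => -> hz.
- have /hz : (-1) ^+ 2 = 1 :> R[i] by rewrite sqrrN expr1n.
  have n1 : -1 != 1 :> R[i].
    by rewrite -subr_eq0 -opprD oppr_eq0 -mulr2n pnatr_eq0.
  rewrite n1 Rx rmorphN rmorph1 mulrN1 raddfN /= => /(_ isT) hx.
  by apply: (cube (3 * z ^+ 2 + 3 * z + 1)); [apply: cofactor2_neq0; lra|ring].
(* The two other cube roots of unity turn membership in the sector into |Im z| < sqrt 3 Re z, whence
   the hypothesis of [cofactor3_neq0]. *)
- pose s := Num.sqrt 3 : R; have s2 : s ^+ 2 = 3 by rewrite sqr_sqrtr.
  have s0 : 0 < s by rewrite sqrtr_gt0.
  have b3 (t : R) : t ^+ 2 = 3 -> (- (1 / 2) +i* (t / 2)) ^+ 3 = 1 :> R[i].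
    move=> t2; have t3 : t ^+ 3 = 3 * t by rewrite exprSr t2.
    by rewrite exprS expr2; simpc; move=> {hz cube Sq Rx}; congr (_ +i* _); lra.
  have b1 (t : R) : - (1 / 2) +i* (t / 2) != 1 :> R[i].
    by rewrite eq_complex /= negb_and; apply/orP; left; apply/eqP; lra.
  have h1 := hz _ (b3 s s2) (b1 s).
  have sN : (- s) ^+ 2 = 3 by rewrite sqrrN.
  have h2 := hz _ (b3 _ sN) (b1 _).
  rewrite Rx !Sq in h1 h2; apply: (cube (6 * z ^+ 4 + 8 * z ^+ 3 + 6 * z ^+ 2 + 3 * z + 1)).
    apply: cofactor3_neq0; move=> {hz b1 b3 cube Sq Rx};
      move: (complex.Re z) (complex.Im z) (sqr_cmod z) h1 h2 => x y cE h1 h2.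
      by clear -h1 h2; lra.
    rewrite cE; have y2 : 0 < (3 * x - s * y) * (3 * x + s * y).
      by rewrite mulr_gt0; clear -h1 h2; lra.
    have y3 : s ^+ 2 * y ^+ 2 = 3 * y ^+ 2 by rewrite s2.
    by clear -y2 y3; lra.
  by ring.
- have b4 (t : R) : t ^+ 2 = 1 -> (0 +i* t) ^+ 4 = 1 :> R[i].
    move=> t2; rewrite (exprM _ 2 2) [in X in X ^+ 2]expr2; simpc.
    by rewrite -expr2 t2 expr2; simpc.
  have b1 (t : R) : 0 +i* t != 1 :> R[i].
    by rewrite eq_complex /= negb_and eq_sym oner_eq0.
  have h1 := hz _ (b4 1 (expr1n _ _)) (b1 _).
  have sN : (- 1) ^+ 2 = 1 :> R by rewrite sqrrN expr1n.
  have h2 := hz _ (b4 _ sN) (b1 _).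
  rewrite Rx !Sq in h1 h2.
  apply: (cube (10 * z ^+ 6 + 15 * z ^+ 5 + 15 * z ^+ 4 + 10 * z ^+ 3 + 6 * z ^+ 2 + 3 * z + 1)).
    apply: cofactor4_neq0; move=> {hz b1 b4 cube Sq Rx};
      move: (complex.Re z) (complex.Im z) (sqr_cmod z) h1 h2 => x y cE h1 h2; first by clear -h1 h2; lra.
    rewrite cE; have y2 : 0 < (x - y) * (x + y) by rewrite mulr_gt0; clear -h1 h2; lra.
    by clear -y2; lra.
  by ring.
Qed.

End Sectors.

Section FullSmall.
Context {R : realType}.
Local Notation C := (Cplane R).
Implicit Types (z w a b c : R[i]).

Lemma sector_value_root d a z : [\/ d = 2, d = 3 | d = 4]%N -> a ^+ d = 1 ->
  sector d a z -> (@den R d).[z] != 0 -> ratfun (num d) (den d) z = a -> z = a.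
Proof.
move=> d4 ad sz dz fz; have d2 : (2 <= d)%N by case: d4 => ->.
have a0 := root_neq0 d2 ad; have ad' : a^-1 ^+ d = 1 by rewrite exprVn ad invr1.
have w1 : ratfun (num d) (den d) (a^-1 * z) = 1.
  by rewrite ratfun_rotate // fz mulVf.
have dw : (@den R d).[a^-1 * z] != 0 by rewrite den_rotate.
have := unique_preimage d4 (sector_rotate d2 ad sz).
rewrite -[(num d).[_]](divfK dw) -/(ratfun (num d) (den d) (a^-1 * z)) w1 mul1r.
by move=> /(_ erefl) w; rewrite -[z](mulVKf a0) w mulr1.
Qed.

Lemma full_immediate0_small d : [\/ d = 2, d = 3 | d = 4]%N ->
  full (immediate_basin (Hd R d) 0).
Proof.
move=> d4; have d2 : (2 <= d)%N by case: d4 => ->.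
have r0 : fixed_root d (0 : R[i]) by left.
have [del del0 attr] := root_attracting d2 r0.
apply: (immediate_basin_full (Hd_Some d2) (Hd_None d2) (num_den_indep d2) del0 attr).
move=> V M oV VM fV z0 Vz0; apply/eqP => dz0.
have [|a ad sz0] := @sector_neg_rays R d z0 d2.
  by move=> /(neg_rays_immediate d4)/(immediate_den d2); rewrite dz0 eqxx.
have ra : fixed_root d a by right.
have a0 := root_neq0 d2 ad.
have uniq w : immediate_basin (Hd R d) 0 w -> basin (Hd R d) a w -> False.
  move=> /immediate_subset w0 /(basin_unique w0) h.
  by move: a0; rewrite -h eqxx.
(* Cutting [V] down to the sector of [a] discards the other preimages of [a]. The boundary gained in
   this way lies on the negative rays, hence in the immediate basin of 0. *)
pose W := V `&` sector d a; have oW : open W.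
  by apply: openI => //; apply: sector_open; exact: ltnW.
have WM w : W w -> cmod w <= M by case=> /VM.
have fW w : closure W w -> ~ W w -> immediate_basin (Hd R d) 0 w.
  move=> cw nw; have cV : closure V w by apply: closureS cw => v [].
  have cS : closure (sector d a) w by apply: closureS cw => v [].
  have [Vw|Vw] := pselect (V w); last exact: fV.
  apply: neg_rays_immediate => //; apply: (sector_closure d2 ad cS) => Sw.
  by apply: nw; split.
have nVa : ~ V a.
  move=> Va; have [cE Ea Einf] := half_line a a0; have [w Ew] := Einf M.
  suff : V w by move/VM; rewrite leNgt => /negP.
  apply: (connected_enters oV cE fV) Ew; [|exact: Ea|exact: Va].
  by move=> _ [t t0 ->] /uniq; apply; exact: root_ray.
pose m : {poly R[i]} := num d - a *: den d.
have mK w : closure W w -> m.[w] != 0.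
  move=> cw; apply/eqP; rewrite horner_comb => /eqP; rewrite subr_eq0 => /eqP nw.
  have dw : (den d).[w] != 0.
    apply/eqP => dw; apply: (@num_den_coprime R d d2 w) => //.
    by rewrite nw dw mulr0.
  have fw : ratfun (num d) (den d) w = a by rewrite /ratfun nw mulfK.
  have [[Vw Sw]|Ww] := pselect (W w).
    by apply: nVa; rewrite -(sector_value_root d4 ad Sw dw fw).
  apply: (uniq a); last by apply/immediate_subset/(immediate_root d2).
  by rewrite -fw; apply: immediate_map => //; exact: fW.
have aV0 : a^-1 != 0 by rewrite invr_eq0.
(* A value t / a of 1 / (H - a) with t != 0 means H = a + a / t, a point of the ray from [a]
   outwards. *)
have [cE E0 Einf] := half_line 0 aV0.
have [|w [cw nw [t t0 wt]]] := ratfun_escape (den_num_indep d2 a) (compact_closure WM) mK cE Einf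
    (subset_closure (conj Vz0 sz0)).
  by exists 0; rewrite // /ratfun dz0 !mul0r addr0.
have Aw : immediate_basin (Hd R d) 0 w.
  by apply: fW => //; exact: (closure_frontier oW cw nw).
have dw := immediate_den d2 Aw.
apply: (uniq (ratfun (num d) (den d) w)); first exact: immediate_map.
move: wt; rewrite add0r /ratfun => wt.
have t1 : t%:C != 0 :> R[i].
  apply: contra_neq dw => t00; move: wt; rewrite t00 mul0r => /eqP.
  by rewrite mulf_eq0 invr_eq0 (negbTE (mK w cw)) orbF => /eqP.
have -> : (num d).[w] / (den d).[w] = a + t^-1%:C * a.
  rewrite fmorphV; have := congr1 (fun v => v^-1) wt.
  rewrite /= invf_div invfM invrK horner_comb => <-.
  by rewrite mulrBl mulfK // addrC subrK.
by apply: root_ray => //; rewrite invr_ge0.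
Qed.

End FullSmall.

(** * The basin of 0 for d >= 5 *)

Section Barrier.
Context {R : realType}.
Local Notation C := (Cplane R).
Variable d : nat.
Hypothesis d_ge5 : (5 <= d)%N.
Implicit Types (z w : R[i]) (s r x y : R).
Local Notation num := (@num R d).
Local Notation den := (@den R d).
Local Notation f := (ratfun num den).
Local Notation F := (Hd R d).
Local Notation A := (immediate_basin F).
Let n : R := d%:R.

Let d2 : (2 <= d)%N. Proof. exact: leq_trans d_ge5. Qed.
Let n_ge5 : 5 <= n. Proof. by rewrite /n (ler_nat _ 5). Qed.
Let n1 : d.+1%:R = n + 1 :> R. Proof. by rewrite -natr1. Qed.
Let n2 : d.+2%:R = n + 2 :> R. Proof. by rewrite -!natr1 -/n; ring. Qed.

(* The disc [|z^d| < 1/(d+1)], cut along the rays that start at the poles on the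
   negative axes of [z^d]. *)
Definition barrier : set C := [set z : C | cmod (z ^+ d) < (n + 1)^-1 /\
  ~ (complex.Im (z ^+ d) = 0 /\ complex.Re den.[z] <= 0)].

Lemma barrier_open : open barrier.
Proof.
have cX : continuous (fun z : C => z ^+ d : C).
  have -> : (fun z : C => z ^+ d : C) = (fun z : C => ('X^d : {poly R[i]}).[z] : C).
    by apply/funext => z; rewrite hornerXn.
  exact: horner_continuous.
have o1 : open [set z : C | cmod (z ^+ d) < (n + 1)^-1].
  apply: (@open_comp C R (fun z : C => cmod (z ^+ d)) [set x | x < (n + 1)^-1]).
    move=> z _; apply: (@continuous_comp C C R (fun z : C => z ^+ d : C) (fun w : C => cmod w)).
      exact: cX.
    exact: cmod_continuous.
  exact: open_lt.
have c1 : closed [set z : C | complex.Im (z ^+ d) = 0].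
  apply: (@preimage_closed C R (fun z : C => complex.Im (z ^+ d)) [set x | x = 0]).
    move=> z _; apply: (@continuous_comp C C R (fun z : C => z ^+ d : C)
      (fun w : C => complex.Im w)); first exact: cX.
    exact: Im_continuous.
  exact: closed_eq.
have c2 : closed [set z : C | complex.Re den.[z] <= 0].
  apply: (@preimage_closed C R (fun z : C => complex.Re den.[z]) [set x | x <= 0]).
    move=> z _; apply: (@continuous_comp C C R (fun z : C => den.[z] : C)
      (fun w : C => complex.Re w)); first exact: horner_continuous.
    exact: Re_continuous.
  exact: closed_le.
apply: openI o1 _; apply: closed_openC; exact: closedI c1 c2.
Qed.

Lemma den_real_barrier z : complex.Im (z ^+ d) = 0 ->
  z ^+ d = (complex.Re (z ^+ d))%:C /\
  complex.Re den.[z] = den_real d (complex.Re (z ^+ d)).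
Proof. by move=> /real_complexP zs; split; rewrite // (den_realE zs). Qed.

Lemma den_realN y : den_real d (- y) = (n + 1) * (n + 2) * y ^+ 2 - (n + 1) * (n - 4) * y + 2.
Proof. by rewrite /den_real natrM n1 n2 -/n; ring. Qed.

Lemma den_real_le0 s : den_real d s <= 0 -> s < 0.
Proof.
have n5 := n_ge5.
rewrite -{1}[s]opprK den_realN -oppr_gt0; move: (- s) => y.
have h1 : 0 <= (n + 1) * (n + 2) by rewrite mulr_ge0; lra.
have h2 : 0 <= (n + 1) * (n - 4) by rewrite mulr_ge0; lra.
rewrite !ltNge => h; apply/negP => y0; move/negP: h; apply.
have h3 := mulr_ge0 h1 (sqr_ge0 y).
have h4 : 0 <= (n + 1) * (n - 4) * (- y) by rewrite mulr_ge0 // oppr_ge0.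
by move=> h; lra.
Qed.

(* [den_real d (- y) / y] decreases while [y < 1 / (d + 1)]. *)
Lemma den_real_decr y y' : 0 < y -> y <= y' -> y' < (n + 1)^-1 ->
  den_real d (- y) <= 0 -> den_real d (- y') <= 0.
Proof.
have n5 := n_ge5.
move=> y0 yy y1; rewrite !den_realN => h.
set D := (X in X <= 0) in h; set D' := (X in X <= 0).
have n10 : 0 < n + 1 by lra.
have y'1 : y' * (n + 1) < 1 by rewrite -ltr_pdivlMr // div1r.
have y2 : y * (n + 1) < 1 by rewrite (le_lt_trans _ y'1) // ler_pM2r.
have yp : y * (n + 1) * (y' * (n + 1)) < 1.
  by rewrite -[ltRHS]mul1r ltr_pM // mulr_ge0 //; lra.
have h1 : (n + 1) * (n + 2) * (y * y') <= 2.
  have yy0 : 0 <= y * y' by rewrite mulr_ge0; lra.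
  have : (n + 1) * (n + 2) * (y * y') <= (n + 1) * (2 * (n + 1)) * (y * y').
    by rewrite ler_wpM2r // ler_pM2l //; lra.
  lra.
have h2 : y * D' <= y' * D.
  rewrite -subr_le0.
  have -> : y * D' - y' * D = (y' - y) * ((n + 1) * (n + 2) * (y * y') - 2).
    by rewrite /D /D'; ring.
  by rewrite mulr_ge0_le0 // ?subr_ge0 // subr_le0.
have : y * D' <= 0 by rewrite (le_trans h2) // mulr_ge0_le0 //; lra.
by rewrite pmulr_rle0.
Qed.

(** Moving outwards cannot lead back into the disc, and by [den_real_decr] a point of the slit stays
    on the slit as long as it is in the disc. *)
Lemma barrier_outward z r : 1 <= r -> ~ barrier z -> ~ barrier (r%:C * z).
Proof.
move=> r1 nz [cz hz]; apply: nz; have r0 : 0 <= r by lra.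
have rd1 : 1 <= r ^+ d by rewrite exprn_ege1.
have rz : (r%:C * z) ^+ d = (r ^+ d)%:C * z ^+ d by rewrite exprMn rmorphXn.
rewrite rz cmodM cmodR ger0_norm ?exprn_ge0 // in cz.
split; first by rewrite (le_lt_trans _ cz) // ler_peMl ?cmod_ge0.
case=> Iz; have [zE ->] := den_real_barrier Iz => Dz; apply: hz.
have Irz : complex.Im ((r%:C * z) ^+ d) = 0.
  by rewrite rz zE -rmorphM.
split=> //; have [_ ->] := den_real_barrier Irz.
rewrite rz zE -rmorphM /=; have s0 := den_real_le0 Dz; rewrite zE cmodR ltr0_norm // in cz.
rewrite -[X in den_real d X]opprK -mulrN; apply: (@den_real_decr (- complex.Re (z ^+ d))) => //.
- by rewrite oppr_gt0.
- by rewrite ler_peMl // oppr_ge0 ltW.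
- by rewrite opprK.
Qed.

(** On this circle v = (d+1) u has modulus 1. Multiplying [den] by (d+1) [v^*] keeps the comparison
    and makes the expression linear in the coordinates of v. *)
Lemma barrier_circle z : den.[z] != 0 -> cmod (z ^+ d) = (n + 1)^-1 ->
  cmod z <= cmod (f z).
Proof.
have n5 := n_ge5.
move=> dz zc; have n10 : 0 < n + 1 by lra.
rewrite /ratfun cmodM cmodV ler_pdivlMr ?cmod_gt0 // numE.
pose v : R[i] := (n + 1)%:C * z ^+ d.
have v1 : cmod v = 1 by rewrite cmodM cmodR gtr0_norm // zc mulfV // gt_eqF.
have vv : v * v^* = 1 by rewrite mulc_conj v1 expr1n.
have nc : n%:C = d%:R :> R[i] by rewrite rmorph_nat.
have n1c : (n + 1)%:C != 0 :> R[i] by rewrite fmorph_eq0 gt_eqF.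
have n1E : d.+1%:R = (n + 1)%:C :> R[i] by rewrite -n1 rmorph_nat.
have n2E : d.+2%:R = (n + 2)%:C :> R[i] by rewrite -n2 rmorph_nat.
have dE : (n + 1)%:C * den.[z] * v^* =
    (n + 2)%:C * v + ((n + 1) * (n - 4))%:C + (2 * (n + 1))%:C * v^*.
  have -> : (n + 1)%:C * den.[z] = (n + 2)%:C * v ^+ 2 + ((n + 1) * (n - 4))%:C * v
      + (2 * (n + 1))%:C.
    rewrite denE natrM n1E n2E -nc /v !(rmorphM, rmorphB, rmorphD) /= !rmorph_nat rmorph1.
    by ring.
  by rewrite !mulrDl [v ^+ 2]expr2 -[in LHS]mulrA -[v * v * _]mulrA vv mulr1 -mulrA vv mulr1.
have nE : (n + 1)%:C * (d%:R * (z * z ^+ d * (d.+1%:R * z ^+ d + (d%:R - 1)))) =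
    z * v * (n%:C * (v + (n - 1)%:C)).
  by rewrite n1E -nc /v rmorphB rmorph1; ring.
rewrite -(ler_pM2l n10).
have cn1 : n + 1 = cmod (n + 1)%:C by rewrite cmodR gtr0_norm.
have -> : (n + 1) * cmod (d%:R * (z * z ^+ d * (d.+1%:R * z ^+ d + (d%:R - 1)))) =
    cmod z * cmod (n%:C * (v + (n - 1)%:C)).
  by rewrite [in LHS]cn1 -cmodM nE cmodM [cmod (z * v)]cmodM v1 mulr1.
rewrite mulrCA ler_wpM2l ?cmod_ge0 //.
have -> : (n + 1) * cmod den.[z] = cmod ((n + 1)%:C * den.[z] * v^*).
  by rewrite !cmodM cmodJ v1 mulr1 -cn1.
rewrite dE -(@ler_pXn2r _ 2) ?nnegrE ?cmod_ge0 // !sqr_cmod.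
have := sqr_cmod v; rewrite v1 expr1n; have := ler_Re v; rewrite v1.
case: v {vv dE nE v1} => x y; rewrite ler_norml => /andP[/= x1 x2] xy; simpc.
rewrite /= -subr_ge0.
have y2 : y ^+ 2 = 1 - x ^+ 2 by lra.
(* The factor 1 - x vanishes at the fixed points with (d+1) u = 1. The last factor is least at x =
   -1, where it equals 2 (n^2 - 4 n - 4); its sign requires n >= 5. *)
set G := (X in 0 <= X); have -> : G = (2 * n + 4) * (1 - x) *
    ((4 * n + 4) * x + 2 * n ^+ 2 - 4 * n - 4) +
    (y ^+ 2 - (1 - x ^+ 2)) * 0 by rewrite /G; ring.
rewrite mulr0 addr0 !mulr_ge0 ?subr_ge0 //; first by lra.
have h1 : 0 <= (4 * n + 4) * (x + 1) by rewrite mulr_ge0; lra.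
have h2 : 0 <= (n - 5) * n by rewrite mulr_ge0; lra.
by clear -h1 h2 n5; lra.
Qed.

Lemma barrier_slit z : den.[z] != 0 -> complex.Im (z ^+ d) = 0 ->
  complex.Re den.[z] <= 0 -> cmod (z ^+ d) <= (n + 1)^-1 ->
  exists2 r, 1 <= r & f z = r%:C * z.
Proof.
have n5 := n_ge5.
move=> dz Iz; have [zE ->] := den_real_barrier Iz => Dz.
exists (factor d (complex.Re (z ^+ d))); last exact: ratfun_real.
have D0 : den_real d (complex.Re (z ^+ d)) < 0.
  by rewrite lt_neqAle Dz andbT; apply: contra_neq dz; rewrite (den_realE zE) => ->.
have s0 := den_real_le0 Dz; rewrite /factor.
rewrite ler_ndivlMr // mul1r.
move: (complex.Re _) D0 s0 => s; rewrite /den_real natrM n1 n2 -/n => D0 s0.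
rewrite -subr_ge0; set G := (X in 0 <= X).
have -> : G = 2 * (n + 1) * s ^+ 2 + (2 * n + 4) * (- s) + 2 by rewrite /G; ring.
have h1 : 0 <= 2 * (n + 1) * s ^+ 2 by rewrite mulr_ge0 ?sqr_ge0 //; lra.
have h2 : 0 <= (2 * n + 4) * (- s) by rewrite mulr_ge0; lra.
lra.
Qed.

Lemma barrier0 : barrier 0.
Proof.
have n5 := n_ge5.
split; rewrite expr0d //; first by rewrite cmod0 invr_gt0; lra.
have -> : den.[0] = 2%:R%:C by rewrite rmorph_nat; exact: den0.
by case=> _ /=; lra.
Qed.

Lemma immediate0_barrier : A 0 `<=` barrier.
Proof.
have [del del0 attr] := root_attracting d2 (or_introl erefl : fixed_root d (0 : R[i])).
have [e e0 he] := (open_cmodP _).1 barrier_open 0 barrier0.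
(* The radius is shrunk so that the attracting disc also lies in the barrier. *)
have m0 : 0 < Num.min e del by rewrite lt_min e0.
apply: (immediate_basin_barrier (Hd_Some d2) (Hd_None d2) (del := Num.min e del) m0).
- by move=> z; rewrite lt_min => /andP[_]; exact: attr.
- exact: barrier_open.
- by move=> z; rewrite lt_min => /andP[/he].
move=> z Az cz nz; have dz := immediate_den d2 Az.
have zc : cmod (z ^+ d) <= (n + 1)^-1.
  have : closed [set z : C | cmod (z ^+ d) <= (n + 1)^-1].
    apply: (@preimage_closed C R (fun z : C => cmod (z ^+ d)) [set x | x <= (n + 1)^-1]).
      move=> w _; apply: (@continuous_comp C C R (fun z : C => z ^+ d : C) (fun w : C => cmod w)).
        have -> : (fun z : C => z ^+ d : C) = (fun z : C => ('X^d : {poly R[i]}).[z] : C).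
          by apply/funext => v; rewrite hornerXn.
        exact: horner_continuous.
      exact: cmod_continuous.
    exact: closed_le.
  by move=> /(_ z); apply; apply: closureS cz => w [/ltW].
have [[Iz Dz]|h] := pselect (complex.Im (z ^+ d) = 0 /\ complex.Re den.[z] <= 0).
  have [r r1 ->] := barrier_slit dz Iz Dz zc.
  exact: barrier_outward.
have zc1 : cmod (z ^+ d) = (n + 1)^-1.
  by apply/le_anti; rewrite zc leNgt; apply/negP => zl; apply: nz.
have := barrier_circle dz zc1 => h1 [h2 _]; move: h2; rewrite ltNge => /negP; apply.
by rewrite -zc1 !cmodX lerXn2r ?nnegrE ?cmod_ge0.
Qed.

Lemma immediate0_bounded z : A 0 z -> cmod z <= 1.
Proof.
have n5 := n_ge5.
move=> /immediate0_barrier[h _]; rewrite leNgt; apply/negP => z1.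
have h1 : 1 <= cmod (z ^+ d) by rewrite cmodX exprn_ege1 // ltW.
have : (n + 1)^-1 <= 1 by rewrite invf_le1; lra.
by move: h1 h; lra.
Qed.

(** Real zeros u of the denominator lie on the slit or outside the disc. Nonreal ones are conjugate,
    so |u|^2 is their product 2 / ((d+1)(d+2)), which exceeds 1 / (d+1)^2. *)
Lemma barrier_den z : barrier z -> den.[z] != 0.
Proof.
have n5 := n_ge5.
move=> [zc hz]; apply/eqP => dz; have n10 : 0 < n + 1 by lra.
have Iz : complex.Im (z ^+ d) != 0.
  by apply/eqP => Iz; apply: hz; rewrite dz.
have n1E : d.+1%:R = (n + 1)%:C :> R[i] by rewrite -n1 rmorph_nat.
have n2E : d.+2%:R = (n + 2)%:C :> R[i] by rewrite -n2 rmorph_nat.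
have nc : n%:C = d%:R :> R[i] by rewrite rmorph_nat.
have main : ((n + 1) * (n + 2) * cmod (z ^+ d) ^+ 2)%:C * z ^+ d +
    ((n + 1) * (n - 4) * cmod (z ^+ d) ^+ 2)%:C + 2%:R%:C * (z ^+ d)^* = 0.
  have cE x : (x * cmod (z ^+ d) ^+ 2)%:C = x%:C * (z ^+ d * (z ^+ d)^*).
    by rewrite rmorphM mulc_conj.
  rewrite !cE.
  rewrite -[RHS](mul0r (z ^+ d)^*) -dz denE natrM n1E n2E -nc !rmorphM rmorphB rmorph_nat.
  by ring.
have := congr1 (@complex.Im R) main.
move: zc Iz; case: (z ^+ d) => x y /=; set c := cmod _ => zc y0.
rewrite !mul0r !addr0 => /eqP.
have -> : (n + 1) * (n + 2) * c ^+ 2 * y + 2 * - y = ((n + 1) * (n + 2) * c ^+ 2 - 2) * y by ring.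
rewrite mulf_eq0 (negbTE y0) orbF => /eqP h.
have c0 : 0 <= c := cmod_ge0 _.
have c1 : c * (n + 1) < 1 by rewrite -ltr_pdivlMr // div1r.
have c2 : (c * (n + 1)) ^+ 2 <= 1 by rewrite exprn_ile1 // ?mulr_ge0 //; lra.
(* The constant 6/5 comes from n + 2 <= 6/5 (n + 1), valid for n >= 4; any constant below 2 would
   contradict [h]. *)
have : (n + 1) * (n + 2) * c ^+ 2 <= 6 / 5 * (c * (n + 1)) ^+ 2.
  have -> : 6 / 5 * (c * (n + 1)) ^+ 2 = (n + 1) * (6 / 5 * (n + 1)) * c ^+ 2 by ring.
  by rewrite ler_wpM2r ?sqr_ge0 // ler_pM2l //; lra.
lra.
Qed.

Lemma full_immediate0_large : full (A 0).
Proof.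
have [del del0 attr] := root_attracting d2 (or_introl erefl : fixed_root d (0 : R[i])).
apply: (immediate_basin_full (Hd_Some d2) (Hd_None d2) (num_den_indep d2) del0 attr).
move=> V M oV VM fV z Vz; apply: barrier_den; apply: contrapT => nz.
have z0 : z != 0 by apply/eqP => z0; apply: nz; rewrite z0; exact: barrier0.
have [cE Ez Einf] := half_line z z0; have [w Ew] := Einf M.
suff : V w by move/VM; rewrite leNgt => /negP.
apply: (connected_enters oV cE fV) Ew; [|exact: Ez|exact: Vz].
move=> _ [t t0 ->] /immediate0_barrier; have -> : z + t%:C * z = (1 + t)%:C * z.
  by rewrite rmorphD rmorph1; ring.
by apply: barrier_outward => //; rewrite lerDl.
Qed.

End Barrier.

Lemma alpha_root (R : realType) d k : (0 < d)%N -> alpha R d k ^+ d = 1.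
Proof.
move=> d0; have dR : d%:R != 0 :> R by rewrite pnatr_eq0 -lt0n.
pose t : R := pi *+ 2 *+ k / d%:R.
have argE : 2 * k%:R * (pi : R)%:C * 'i / d%:R = 0 +i* t :> R[i].
  have -> : 0 +i* t = t%:C * 'i :> R[i] by simpc.
  have -> : t = 2 * k%:R * pi / d%:R by rewrite /t -mulrnA -[_ *+ _]mulr_natl natrM.
  by rewrite fmorph_div !rmorphM !rmorph_nat; ring.
have moivre n : (cos t +i* sin t) ^+ n = cos (t *+ n) +i* sin (t *+ n) :> R[i].
  elim: n => [|n IH]; first by rewrite mulr0n cos0 sin0.
  by rewrite exprS IH mulrS cosD sinD; simpc; congr (_ +i* _); ring.
rewrite /alpha argE /cexp /= expR0 mul1r moivre.
have -> : t *+ d = 0 + pi *+ 2 *+ k by rewrite -mulr_natr /t divfK // add0r.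
by rewrite (periodicn (@cosD2pi R)) (periodicn (@sinD2pi R)) cos0 sin0.
Qed.

Theorem theoremA (R : realType) (d : nat) (hd : (2 <= d)%N) :
  [/\ (forall k : 'I_d,
         simply_connected R (immediate_basin (Hd R d) (alpha R d k))) /\
      simply_connected R (immediate_basin (Hd R d) 0),
      forall k : 'I_d,
        ~ bounded_set (immediate_basin (Hd R d) (alpha R d k)),
      [\/ d = 2, d = 3 | d = 4]%N ->
        ~ bounded_set (immediate_basin (Hd R d) 0) &
      (5 <= d)%N -> bounded_set (immediate_basin (Hd R d) 0)].
Proof.
have alphaE k := @alpha_root R d k (ltnW hd).
have sc (b : R[i]) : fixed_root d b -> full (immediate_basin (Hd R d) b) ->
    simply_connected R (immediate_basin (Hd R d) b).
  move=> rb fb; apply: full_simply_connected => //.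
  - exact: immediate_isopen.
  - exact: immediate_connected.
  - by exists b; exact: immediate_root.
split.
- split=> [k|].
    by apply: sc; [right|exact: full_immediate_root].
  apply: sc; first by left.
  have [d5|d5] := leqP 5 d; first exact: full_immediate0_large.
  apply: full_immediate0_small; case: d hd d5 {alphaE} => [|[|[|[|[|]]]]] // _ _;
    by [constructor 1|constructor 2|constructor 3].
- by move=> k; exact: immediate_root_unbounded.
- exact: immediate0_unbounded.
- move=> d5; exists 1; split; first exact: real1.
  move=> M M1 z Az; rewrite /= -cmodE (le_trans _ (ltW M1)) //.
  by rewrite -(rmorph1 (real_complex R)) lecR; exact: immediate0_bounded d5 z Az.
Qed.
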